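(* There is a (randomized) CONGEST algorithm that, given a directed unweighted $n$-vertex graph $G$ with undirected diameter $D$, vertices $s,t$ and a shortest $s$-$t$ path $P_{st}$ with $h_{st}$ edges, solves Replacement Paths for $P_{st}$ with high probability in $\tilde{O}\!\left(\min\!\left(n^{2/3}+\sqrt{n\,h_{st}}+D,\ (\sqrt{n}D^{1/4}+D)\cdot h_{st}\right)\right)$ rounds.
   Context: CONGEST model: the communication network is the graph $G=(V,E)$, $n=|V|$; each node has a unique identifier in $\{0,\dots,n-1\}$, knows its own and its neighbours' identifiers and its incident edges; computation proceeds in synchronous rounds in which each node may send a message of $O(\log n)$ bits to each neighbour; local computation is free; communication links are bidirectional even when $G$ is directed. The undirected diameter $D$ is the diameter of the underlying undirected unweighted graph of $G$; $h_{st}$ is the number of edges of $P_{st}$. Replacement Paths: for each edge $e\in P_{st}$ some vertex must compute the length of a shortest simple $s$-$t$ path $P_e$ avoiding $e$, and every vertex on $P_e$ must know its successor on $P_e$. $\tilde{O}$ hides polylogarithmic factors in $n$. *)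

(* Defs.v *)
From Stdlib Require Import Reals ClassicalEpsilon.
From mathcomp Require Import all_boot.

Set Implicit Arguments.
Unset Strict Implicit.
Unset Printing Implicit Defensive.

(* Graph notions.  A directed simple graph on the vertex set 'I_n is an     *)
(* irreflexive relation E; E u v means there is an edge u -> v.             *)

Definition uadj (n : nat) (E : rel 'I_n) : rel 'I_n := fun u v => E u v || E v u.

Definition uwalk_len (n : nat) (E : rel 'I_n) (u v : 'I_n) (k : nat) : Prop :=
  exists p : seq 'I_n, path (uadj E) u p /\ last u p = v /\ size p = k.

(* D is the undirected diameter of (the underlying graph of) E
   (in particular the underlying undirected graph is connected). *)
Definition undirected_diameter (n : nat) (E : rel 'I_n) (D : nat) : Prop :=
  (forall u v : 'I_n, exists k, k <= D /\ uwalk_len E u v k) /\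
  (exists u v : 'I_n, forall k, uwalk_len E u v k -> D <= k).

Definition remove_edge (n : nat) (E : rel 'I_n) (a b : 'I_n) : rel 'I_n :=
  fun x y => E x y && ~~ ((x == a) && (y == b)).

Definition dwalk (n : nat) (F : rel 'I_n) (s t : 'I_n) (q : seq 'I_n) : Prop :=
  path F s q /\ last s q = t.

Definition shortest_path (n : nat) (F : rel 'I_n) (s t : 'I_n) (q : seq 'I_n) : Prop :=
  dwalk F s t q /\ forall q', dwalk F s t q' -> size q <= size q'.

Definition dist_is (n : nat) (F : rel 'I_n) (s t : 'I_n) (d : option nat) : Prop :=
  match d with
  | Some k => (exists q, dwalk F s t q /\ size q = k) /\
              (forall q, dwalk F s t q -> k <= size q)
  | None => forall q, ~ dwalk F s t q
  end.

(* Local input of a node: n, its own identifier, the identifiers of its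
   out-neighbours and in-neighbours (i.e. its incident edges), whether it is
   s, whether it is t, and its successor on P_st (if it lies on P_st, t
   excepted). *)
Record Input := mkInput {
  in_n : nat;
  in_id : nat;
  in_out : seq nat;
  in_in : seq nat;
  in_is_s : bool;
  in_is_t : bool;
  in_succ : option nat
}.

(* Output of a node: a list of claims ((a,b), l) "the replacement distance for
   the edge (a,b) of P_st is l" (None = no replacement path), and a list of
   claims ((a,b), w) "my successor on the replacement path P_(a,b) is w". *)
Definition Output := (seq ((nat * nat) * option nat) * seq ((nat * nat) * nat))%type.

(* A (randomized, uniform) CONGEST algorithm: a local state type, an initial
   state computed from the local input and the local random tape, a message
   function (message to the neighbour with a given id, None = no message), a
   transition function (from the messages received, indexed by sender id), and
   an output function (Some o = the node has halted with output o).  Local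
   computation is arbitrary.  Each node gets a random tape of tape_len n bits;
   messages are bit strings truncated to msg_const A * (log2 n + 1) bits. *)
Record Algo := mkAlgo {
  St : Type;
  a_init : Input -> seq bool -> St;
  a_send : St -> nat -> option (seq bool);
  a_recv : St -> (nat -> option (seq bool)) -> St;
  a_out : St -> option Output;
  tape_len : nat -> nat;
  msg_const : nat
}.

Arguments a_init : clear implicits.
Arguments a_send : clear implicits.
Arguments a_recv : clear implicits.
Arguments a_out : clear implicits.

Definition msg_cap (A : Algo) (n : nat) : nat := msg_const A * (trunc_log 2 n).+1.

Definition local_input (n : nat) (E : rel 'I_n) (s t : 'I_n) (ps : seq 'I_n)
  (v : 'I_n) : Input :=
  mkInput n (val v)
    [seq val u | u <- enum 'I_n & E v u]
    [seq val u | u <- enum 'I_n & E u v]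
    (v == s) (v == t)
    (if v \in belast s ps then Some (val (nth s ps (index v (s :: ps)))) else None).

Fixpoint run (A : Algo) {n : nat} (E : rel 'I_n) (inp : 'I_n -> Input)
  (tape : 'I_n -> seq bool) (r : nat) : 'I_n -> St A :=
  match r with
  | 0 => fun v => a_init A (inp v) (tape v)
  | r'.+1 =>
      let prev := run A E inp tape r' in
      fun v =>
        if a_out A (prev v) is Some _ then prev v
        else a_recv A (prev v) (fun j =>
               match @insub nat (fun x => x < n) 'I_n j with
               | Some u =>
                   if uadj E u v then
                     if a_out A (prev u) is None then
                       omap (take (msg_cap A n)) (a_send A (prev u) (val v))
                     else None
                   else None
               | None => None
               end)
  end.

Definition rp_correct (n : nat) (E : rel 'I_n) (s t : 'I_n) (ps : seq 'I_n)
  (out : 'I_n -> Output) : Prop :=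
  forall i, i < size ps ->
    let a := nth s (s :: ps) i in
    let b := nth s ps i in
    (exists v l, ((val a, val b), l) \in (out v).1) /\
    (forall v l, ((val a, val b), l) \in (out v).1 -> dist_is (remove_edge E a b) s t l) /\
    ((forall q, ~ dwalk (remove_edge E a b) s t q) \/
     exists q, shortest_path (remove_edge E a b) s t q /\
       forall j, j < size q -> forall w : nat,
         (((val a, val b), w) \in (out (nth s (s :: q) j)).2) = (w == val (nth s q j))).

Definition asb (P : Prop) : bool := if excluded_middle_informative P then true else false.

Definition succeeds (A : Algo) (n : nat) (E : rel 'I_n) (s t : 'I_n) (ps : seq 'I_n)
  (T : R) (tp : {ffun 'I_n -> (tape_len A n).-tuple bool}) : Prop :=
  exists r : nat, Rle (INR r) T /\
    exists out : 'I_n -> Output,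
      (forall v, a_out A (run A E (local_input E s t ps) (fun v => val (tp v)) r v)
                 = Some (out v)) /\
      rp_correct E s t ps out.

(* with high probability: success probability >= 1 - 1/n, the probability
   being uniform over all assignments of random tapes to the nodes *)
Definition whp_succeeds (A : Algo) (n : nat) (E : rel 'I_n) (s t : 'I_n)
  (ps : seq 'I_n) (T : R) : Prop :=
  #|[set tp : {ffun 'I_n -> (tape_len A n).-tuple bool} | asb (succeeds E s t ps T tp)]| * n
  >= #|{: {ffun 'I_n -> (tape_len A n).-tuple bool}}| * (n - 1).

Definition round_bound (c k n h D : nat) : R :=
  Rmult (Rmult (INR c) (pow (Rplus 1 (ln (INR n))) k))
   (Rmin (Rplus (Rplus (Rpower (INR n) (Rdiv 2 3)) (sqrt (Rmult (INR n) (INR h)))) (INR D))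
         (Rmult (Rplus (Rmult (sqrt (INR n)) (sqrt (sqrt (INR D)))) (INR D)) (INR h))).

(* Main.v *)
(* Everything is assembled from one primitive, flooding: in each round every
   node forwards to its neighbours the lexicographically smallest pair
   (distance, token) that it has not sent yet.  The pair (d, x) is then known
   at v after d + (rank of (d, x) at v) rounds, so K tokens spread to distance
   l in l + K rounds.  This yields broadcast, K-source BFS of bounded depth
   and, by doubling, an estimate Dl of the diameter.  Random landmarks are
   announced so that every w consecutive vertices of the relevant shortest
   paths contain one with high probability; landmarks at distance at most 2w
   form the skeleton graph.

   For n^(2/3) + sqrt(n h) + D: BFS from landmarks and path vertices in
   G - E(P_st) finds all short detours, the skeleton is made public, and the best
   vertex to leave P_st at is found for all edges by a bitwise search.

   For (sqrt n D^(1/4) + D) h: one single-target computation per edge, settling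
   landmarks by increasing distance in windows of length w.  A window costs a
   broadcast only if some settled landmark still has more than k unsettled
   in-neighbours (those with at most k have published their edges); these
   settle within two windows, so this happens at most |L| / k times, and
   k ~ sqrt Dl balances the costs.

   In both cases a node keeps an upper bound on its distance to t, witnessed by
   an out-neighbour with a smaller bound; if the bound is exact at s, following
   the witnesses from s traces a shortest path. *)

Require Import Defs.
From Stdlib Require Import Reals Lra Lia ClassicalEpsilon FunctionalExtensionality.
From mathcomp Require Import all_boot zify.

Set Implicit Arguments.
Unset Strict Implicit.
Unset Printing Implicit Defensive.

(** Randomness enters once, in the draw of the landmarks; the rest is deterministic, so success
    reduces to the single event [hit_all]. Fixing one canonical shortest path per pair leaves n^4
    windows to hit over all graphs involved, which a union bound can afford. There is no
    coordinator: the control flow of a program depends only on data that all nodes hold alike, so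
    the nodes stay in lockstep and rounds are bounded by composing one rule per primitive. Up to
    logarithms, width w means c = n/w landmarks. Publishing the skeleton and its links to the path
    costs c^2 + c h, a search costs w: hence w^3 >= n^2 and w^2 >= n h. For a single edge, a
    broadcast in each of the n/w windows would exceed w by a factor sqrt Dl; with the in-degree
    threshold k, publication costs c k and the communicating windows (c/k) Dl. This gives k = sqrt
    Dl, and c k <= w then asks for w^2 >= n sqrt Dl. *)

Ltac slia :=
  repeat match goal with
  | H : ?T |- _ =>
      lazymatch T with
      | is_true (leq _ _) => fail
      | @eq nat _ _ => fail
      | @eq (Equality.sort _) _ _ => fail
      | nat => fail
      | _ => clear H
      end
  end; lia.

(** * Bounded reachability *)

Section Reach.
Variables (n : nat) (nb : rel 'I_n) (H : pred 'I_n).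

(** [nb v u] reads: [v] listens to [u]. Information travels against [nb], so when [nb] is an edge
    relation, [rch] and [isd] measure the distance to [H] along the edges. *)
Fixpoint rch (k : nat) (v : 'I_n) : bool :=
  if k is k'.+1 then rch k' v || [exists u, nb v u && rch k' u] else H v.

Definition isd (d : nat) (v : 'I_n) : bool :=
  rch d v && ((d == 0) || ~~ rch d.-1 v).

Lemma rchS k v : rch k v -> rch k.+1 v.
Proof. by move=> /= ->. Qed.

Lemma rch_leq k l v : k <= l -> rch k v -> rch l v.
Proof.
move=> /subnKC <-; elim: (l - k) => [|m IH] h; first by rewrite addn0.
by rewrite addnS; apply: rchS; apply: IH.
Qed.

Lemma rch_step k v u : nb v u -> rch k u -> rch k.+1 v.
Proof. by move=> e h /=; apply/orP; right; apply/existsP; exists u; rewrite e. Qed.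

Lemma isd_rch d v : isd d v -> rch d v.
Proof. by case/andP. Qed.

Lemma isd_leq d k v : isd d v -> rch k v -> d <= k.
Proof.
case/andP=> _ /orP[/eqP -> //|h] hk; rewrite leqNgt; apply/negP => lt.
by case/negP: h; apply: rch_leq hk; case: d lt.
Qed.

Lemma isd_inj d d' v : isd d v -> isd d' v -> d = d'.
Proof.
move=> h h'; apply/eqP; rewrite eqn_leq (isd_leq h (isd_rch h')).
by rewrite (isd_leq h' (isd_rch h)).
Qed.

Lemma rch_isd k v : rch k v -> exists2 d, d <= k & isd d v.
Proof.
elim: k => [|k IH] h; first by exists 0 => //; rewrite /isd h.
have [hk|hk] := boolP (rch k v).
  by have [d le dd] := IH hk; exists d => //; apply: leqW.
by exists k.+1 => //; rewrite /isd h /= hk.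
Qed.

Lemma isd_pred d v : isd d.+1 v -> exists2 u, nb v u & isd d u.
Proof.
move=> hd; case/andP: (hd) => /= /orP[->//|/existsP[u /andP[e r]]] nr.
exists u => //; have [d' le' h'] := rch_isd r.
suff -> : d = d' by [].
apply/eqP; rewrite eqn_leq le' andbT.
by have := isd_leq hd (rch_step e (isd_rch h')).
Qed.

Lemma rch_path k v :
  reflect (exists p, [/\ path nb v p, H (last v p) & size p <= k]) (rch k v).
Proof.
apply: (iffP idP).
  elim: k v => [|k IH] v /=; first by move=> h; exists [::].
  case/orP=> [/IH [p [a b c]]|/existsP[u /andP[e /IH [p [a b c]]]]].
    by exists p; split=> //; apply: leqW.
  by exists (u :: p); split=> //=; rewrite e.
case=> p; elim: p k v => [|u p IH] k v [/= a b c].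
  exact: (@rch_leq 0).
case: k c => // k c; case/andP: a => e a.
by apply: (rch_step e); apply: IH.
Qed.

End Reach.

(** * Flooding with pipelining *)

(** A fact is a pair (code, sender); the code d * M + x stands for token x < M at distance d, so the
    numeric order of codes is the lexicographic order of pairs. A token may arrive over a long route
    before a shortest one; only its smallest code heard so far is live. *)
Definition live (M : nat) (F : seq (nat * nat)) (c : nat) : bool :=
  has (fun f => f.1 == c) F &&
  all (fun f => (f.1 %% M == c %% M) ==> (c <= f.1)) F.

(** Codes of distance l or more are not forwarded, so no received fact exceeds distance l. *)
Definition nextc (M l : nat) (F : seq (nat * nat)) (S : seq nat) : option nat :=
  ohead [seq c <- iota 0 (l * M) | live M F c & c \notin S].

Lemma ohead_filter_iotaP (p : pred nat) N :
  match ohead [seq c <- iota 0 N | p c] with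
  | Some c => [/\ p c, c < N & forall c', c' < c -> ~~ p c']
  | None => forall c, c < N -> ~~ p c
  end.
Proof.
elim: N => [//|N]; have -> : iota 0 N.+1 = iota 0 N ++ [:: N] by rewrite -addn1 iotaD.
rewrite filter_cat /=.
case: [seq c <- iota 0 N | p c] => [|c s] /= IH.
  case E: (p N) => /=; last by move=> c; rewrite ltnS leq_eqVlt => /orP[/eqP->|/IH//]; rewrite E.
  by split=> // c' /IH.
by case: IH => a b d; split=> //; apply: leqW.
Qed.

Section Flood.
Variables (n M l : nat) (nb : rel 'I_n) (toks : 'I_n -> seq nat).
Hypothesis toks_lt : forall v x, x \in toks v -> x < M.

Definition fstate := (seq (nat * nat) * seq nat)%type.

Definition fnext (st : 'I_n -> fstate) (v : 'I_n) := nextc M l (st v).1 (st v).2.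

(** The state is (facts heard, codes sent). Adding [M] to a received code raises its distance by one
    and keeps its token. *)
Fixpoint fl (t : nat) : 'I_n -> fstate :=
  if t is t'.+1 then fun v =>
    ((fl t' v).1 ++ pmap (fun u => if nb v u then omap (fun c => (c + M, val u)) (fnext (fl t') u)
                                   else None) (enum 'I_n),
     if fnext (fl t') v is Some c then c :: (fl t' v).2 else (fl t' v).2)
  else fun v => ([seq (x, 0) | x <- toks v], [::]).

Definition holds (x : nat) : pred 'I_n := fun v => x \in toks v.
Notation R x := (rch nb (holds x)).

Definition known t v d x := has (fun f => f.1 == d * M + x) (fl t v).1.

Lemma fl_sub t v f : f \in (fl t v).1 -> f \in (fl t.+1 v).1.
Proof. by move=> h /=; rewrite mem_cat h. Qed.

Lemma rch_tok k v x : R x k v -> x < M.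
Proof. by case/rch_path=> p [_ h _]; apply: toks_lt h. Qed.

(** A heard code only bounds the distance from above. The last clause makes its sender a witness one
    step closer; this is what later turns facts into next hops. *)
Lemma fl_sound t v f : f \in (fl t v).1 ->
  0 < M /\ R (f.1 %% M) (f.1 %/ M) v /\
  (0 < f.1 %/ M -> exists u, [/\ val u = f.2, nb v u & R (f.1 %% M) (f.1 %/ M).-1 u]).
Proof.
elim: t v f => [|t IH] v f /=.
  case/mapP=> x hx ->; have lx := toks_lt hx; have M0: 0 < M by apply: leq_trans lx.
  by split=> //=; rewrite modn_small ?divn_small.
rewrite mem_cat => /orP[/IH//|]; rewrite mem_pmap => /mapP[u _].
case: ifP => // e; rewrite /fnext /nextc.
case: (ohead _) (ohead_filter_iotaP (fun c => live M (fl t u).1 c && (c \notin (fl t u).2)) (l * M)) => // c [+ _ _] [->] /=.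
case/andP=> /andP[/hasP [g hg /eqP <-] _] _.
have [M0 [h _]] := IH _ _ hg.
rewrite divnDr // divnn M0 modnDr addn1; split=> //; split=> [|_]; first exact: rch_step e h.
by exists u.
Qed.

(** Soundness forbids codes below the true distance, so nothing can displace a true pair once it is
    heard. *)
Lemma live_known t v d x : x < M ->
  isd nb (holds x) d v -> known t v d x -> live M (fl t v).1 (d * M + x).
Proof.
move=> lx hd hk; rewrite /live -/(known t v d x) hk /=; apply/allP => f hf; apply/implyP => /eqP.
rewrite modnMDl (modn_small lx) => fx.
have [M0 [hr _]] := fl_sound hf; rewrite fx in hr.
have := isd_leq hd hr => le; rewrite (divn_eq f.1 M) fx leq_add2r leq_mul2r le.
by rewrite orbT.
Qed.

Lemma live_isd t v d x : x < M -> live M (fl t v).1 (d * M + x) -> 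
  (forall d', isd nb (holds x) d' v -> known t v d' x) -> isd nb (holds x) d v.
Proof.
move=> lx /andP[/hasP[f hf /eqP ef] /allP hall] hk.
have M0 : 0 < M by apply: leq_trans lx.
have [_ [hr _]] := fl_sound hf.
rewrite ef divnMDl // divn_small // addn0 modnMDl modn_small // in hr.
have [d' le' h'] := rch_isd hr.
have /hasP[g hg /eqP eg] := hk _ h'.
have := hall _ hg; rewrite eg !modnMDl eqxx /= leq_add2r leq_mul2r => /orP[/eqP M00|le]; first by rewrite M00 in M0.
suff -> : d = d' by []. by apply/eqP; rewrite eqn_leq le le'.
Qed.

(* Position of the pair (d, y) in the lexicographic order of the true pairs at v. *)
Definition rank v d y : nat :=
  count (fun x => ((0 < d) && R x d.-1 v) || ((x < y) && R x d v)) (iota 0 M).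

Lemma count_lt (p q : pred nat) s x :
  x \in s -> (forall y, p y -> q y) -> ~~ p x -> q x -> count p s < count q s.
Proof.
move=> + pq np qx; elim: s => //= y s IH; rewrite inE => /orP[/eqP <-|/IH h].
  by rewrite (negbTE np) qx add0n add1n ltnS; apply: sub_count.
by rewrite -addnS; apply: leq_add => //; case E: (p y) => //; rewrite pq.
Qed.

(** A token ahead of (d, y) at [u] is at most one step farther from [v], hence ahead of (d+1, y)
    there. Delays therefore do not add up along a shortest route. *)
Lemma rank_step u v d y : nb v u -> rank u d y <= rank v d.+1 y.
Proof.
move=> e; apply: sub_count => x /= /orP[/andP[d0 h]|/andP[h1 h2]].
  by move: (rch_step e h); rewrite prednK //= => ->.
by have /= -> := rch_step e h2; rewrite h1 orbT.
Qed.

Lemma rank_lt v d x e y :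
  isd nb (holds x) e v -> e < d \/ e = d /\ x < y -> rank v e x < rank v d y.
Proof.
move=> hx hle; have hr := isd_rch hx; have lx := rch_tok hr.
apply: (@count_lt _ _ _ x); first by rewrite mem_iota.
- move=> z /= /orP[/andP[e0 h]|/andP[zx h]].
    case: hle => [lt|[ed _]].
      by rewrite (leq_trans _ lt) // (rch_leq _ h) //; slia.
    by rewrite -ed e0 h.
  case: hle => [lt|[ed xy]]; last by rewrite -ed h (ltn_trans zx xy) orbT.
  by rewrite (leq_trans _ lt) // (rch_leq _ h) //; slia.
- rewrite ltnn /= orbF; apply/negP => /andP[e0 h].
  by have := isd_leq hx h; slia.
- case: hle => [lt|[<- ->]]; last by rewrite hr orbT.
  by rewrite (leq_trans _ lt) // (rch_leq _ hr) //; slia.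
Qed.

Lemma code_lt d x e y : x < M -> d * M + x < e * M + y -> y < M ->
  d < e \/ d = e /\ x < y.
Proof.
move=> lx lt ly; case: (ltngtP d e) => [|h|h]; [by left| |].
  have : e.+1 * M <= d * M by rewrite leq_mul2r h orbT.
  by rewrite mulSn; slia.
by right; split=> //; move: lt; rewrite h ltn_add2l.
Qed.

(** Induction on the round. When the turn of (d, y) comes, every true pair ahead of it at [v] has no
    larger distance and a smaller rank, so it was heard and sent before. A live code still ahead
    would be such a true pair, hence already sent; so (d, y) is the smallest live unsent code. *)
Lemma fl_timely t v d y : isd nb (holds y) d v -> d <= l ->
  (d + rank v d y <= t -> known t v d y) /\
  (d < l -> d + rank v d y < t -> d * M + y \in (fl t v).2 /\
     forall w, nb w v -> known t w d.+1 y).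
Proof.
elim: t v d y => [|t IH] v d y hd dl; have ly := rch_tok (isd_rch hd).
  split=> [|_] //; rewrite leqn0 addn_eq0 => /andP[/eqP d0 _].
  apply/hasP; exists (y, 0) => /=; last by rewrite d0.
  by apply: map_f; move: hd; rewrite d0 => /isd_rch.
have knS w e x : known t w e x -> known t.+1 w e x.
  by case/hasP=> f hf h; apply/hasP; exists f => //; apply: fl_sub.
have sS w c : c \in (fl t w).2 -> c \in (fl t.+1 w).2.
  by move=> h /=; case: (fnext _ w) => // c'; rewrite inE h orbT.
(* The sending half is needed for all nodes at this same time, because hearing at [v] relies on the
   sending of a neighbour one step closer. *)
suff sent' v' d' y' : isd nb (holds y') d' v' -> d' < l -> d' + rank v' d' y' < t.+1 ->
    d' * M + y' \in (fl t.+1 v').2 /\ forall w, nb w v' -> known t.+1 w d'.+1 y'.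
  split=> [le|dl' lt]; last exact: sent'.
  have [h|/(IH v d y hd dl).1/knS //] := ltnP t (d + rank v d y).
  have {h le} et: d + rank v d y = t.+1 by slia.
  case: d hd dl et => [|d] hd dl et.
    apply/hasP; exists (y, 0); last by rewrite mul0n.
    elim: (t.+1) => [|t' IHt]; last exact: fl_sub.
    by apply/mapP; exists y => //; exact: (isd_rch hd).
  have [u e hu] := isd_pred hd.
  have [//||_ hw] := sent' u d y hu; last exact: hw.
  by have := rank_step d y e; slia.
move: v d y hd dl ly => _ _ _ _ _ _.
move: v' d' y' => v d y hd dl' lt; have ly := rch_tok (isd_rch hd).
have dl := ltnW dl'; have [IH1 IH2] := IH v d y hd dl.
have [h|h] := ltnP (d + rank v d y) t.
  have [a b] := IH2 dl' h; split; first exact: sS.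
  by move=> w /b /knS.
have [hin|hin] := boolP (d * M + y \in (fl t v).2).
  split; first exact: sS.
  move=> w e; suff: forall t', d * M + y \in (fl t' v).2 -> known t' w d.+1 y by move=> H; apply: knS; apply: H.
  elim=> // t' IHt /=; case E: (fnext (fl t') v) => [c|]; last first.
    move/IHt => /hasP[f hf ef]; apply/hasP; exists f => //; exact: fl_sub.
  rewrite inE => /orP[/eqP ec|/IHt /hasP[f hf ef]]; last by apply/hasP; exists f => //; exact: fl_sub.
  apply/hasP; exists (c + M, val v) => /=; last by rewrite -ec mulSn addnC addnA.
  rewrite mem_cat mem_pmap; apply/orP; right; apply/mapP; exists v; first by rewrite mem_enum.
  by rewrite e E.
have kn : known t v d y by apply: IH1; slia.
have Enext : fnext (fl t) v = Some (d * M + y).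
  have lv := live_known ly hd kn.
  have M0 : 0 < M by apply: leq_trans ly.
  have cl : d * M + y < l * M.
    apply: leq_trans (_ : d.+1 * M <= _); first by rewrite mulSn; slia.
    by rewrite leq_mul2r dl' orbT.
  rewrite /fnext /nextc.
  case: (ohead _) (ohead_filter_iotaP (fun c => live M (fl t v).1 c && (c \notin (fl t v).2)) (l * M)) => [c|]; last first.
    by move/(_ _ cl); rewrite lv hin.
  case=> /andP[lc nc] _ mn; congr Some; apply/eqP; rewrite eqn_leq; apply/andP; split.
    by rewrite leqNgt; apply/negP => /mn; rewrite lv hin.
  rewrite leqNgt; apply/negP => ltc.
  have ec := divn_eq c M; set e := c %/ M in ec; set x := c %% M in ec.
  have lx : x < M by rewrite ltn_mod.
  (* the true pair of token x at v precedes (d, y), so it is known and sent *)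
  have [f hf /eqP ef] := hasP (proj1 (andP lc)).
  have [_ [hr _]] := fl_sound hf; rewrite ef -/e -/x in hr.
  have [e' le' he'] := rch_isd hr.
  have lex : e' < d \/ e' = d /\ x < y.
    have [ed|[ed xy]] : e < d \/ e = d /\ x < y by apply: code_lt => //; rewrite -ec.
      by left; slia.
    by case: (ltnP e' d) => [|h2]; [left|right; split=> //; slia].
  have rk := rank_lt he' lex.
  have e'l : e' < l by case: lex => [|[]]; slia.
  have [k1 k2] := IH v e' x he' (ltnW e'l).
  have lt' : e' + rank v e' x < t by case: lex => [|[]]; slia.
  have [s2 _] := k2 e'l lt'; have k1' := k1 (ltnW lt').
  have ee : e = e'.
    apply/eqP; rewrite eqn_leq le' andbT.
    have /andP[_ /allP al] := live_known lx he' k1'.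
    have := (proj2 (andP lc)) => /allP al2.
    have /hasP[g hg /eqP eg] := k1'.
    have := al2 _ hg; rewrite eg modnMDl (modn_small lx) eqxx /= ec leq_add2r leq_mul2r.
    by case/orP=> // /eqP M00; rewrite M00 in M0.
  by move: nc; rewrite ec ee s2.
split; first by rewrite /= Enext inE eqxx.
move=> w e; apply/hasP; exists (d * M + y + M, val v) => /=; last by rewrite mulSn addnC addnA.
rewrite mem_cat mem_pmap; apply/orP; right; apply/mapP; exists v; first by rewrite mem_enum.
by rewrite e Enext.
Qed.

Definition present x := [exists v, x \in toks v].

Lemma fl_complete K t v d x :
  count present (iota 0 M) <= K -> l + K <= t ->
  isd nb (holds x) d v -> d <= l -> known t v d x.
Proof.
move=> cK lt hd dl; apply: (fl_timely t hd dl).1.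
suff : rank v d x <= K by slia.
apply: leq_trans cK; apply: sub_count => z /=.
by case/orP=> /andP[_ /rch_path[p [_ hh _]]]; apply/existsP; exists (last v p).
Qed.

(** If at most [K] tokens were known, the first missing pair would have only known tokens ahead of
    it, hence rank at most [K], and would have arrived by [fl_timely]. *)
Lemma fl_overflow K t v :
  (forall x, present x -> R x l v) -> l + K <= t ->
  K < count present (iota 0 M) ->
  K < count (fun x => has (fun f => f.1 %% M == x) (fl t v).1) (iota 0 M).
Proof.
move=> hall lt hK; set kn := fun x => has _ _; rewrite ltnNge; apply/negP => cK.
have [x px nx] : exists2 x, present x & ~~ kn x.
  have [/allP h|] := boolP (all (fun x => present x ==> kn x) (iota 0 M)).
    have : count present (iota 0 M) <= count kn (iota 0 M).
      rewrite -!size_filter; apply: uniq_leq_size; first by rewrite filter_uniq ?iota_uniq.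
      by move=> x; rewrite !mem_filter => /andP[a b]; rewrite b (implyP (h _ b) a).
    by slia.
  by case/allPn => x _; rewrite negb_imply => /andP[]; exists x.
(* The least d with a missing token within distance d, then the least such token, give the
   lexicographically first missing pair. *)
pose Q d := has (fun x => [&& R x d v, ~~ kn x & present x]) (iota 0 M).
have exQ : exists d, Q d.
  exists l; apply/hasP; exists x; last by rewrite hall // nx px.
  by rewrite mem_iota; apply: rch_tok (hall _ px).
case: (ex_minnP exQ) => d /hasP[x0 _ h0] dmin.
pose Q' y := [&& R y d v, ~~ kn y & present y].
have exQ' : exists y, Q' y by exists x0.
case: (ex_minnP exQ') => y /and3P[ry ny py] ymin.
have ly := rch_tok ry.
have Qk z e : R z e v -> ~~ kn z -> d <= e.
  move=> rz nz; apply: dmin; apply/hasP; exists z; first by rewrite mem_iota; apply: rch_tok rz.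
  by rewrite rz nz /=; case/rch_path: rz => p [_ hh _]; apply/existsP; exists (last v p).
have hd : isd nb (holds y) d v.
  have [d' le' h'] := rch_isd ry.
  suff -> : d = d' by []. apply/eqP; rewrite eqn_leq le' andbT; exact: Qk (isd_rch h') ny.
have dl : d <= l by apply: Qk (hall _ py) ny.
case/negP: ny.
have /hasP[f hf /eqP ef] : known t v d y.
  apply: (fl_timely t hd dl).1.
  suff : rank v d y <= K by slia.
  apply: leq_trans cK; apply: sub_count => z /= /orP[/andP[d0 rz]|/andP[zy rz]].
    by apply/negPn/negP => nz; have := Qk _ _ rz nz; slia.
  apply/negPn/negP => nz; suff /ymin : Q' z by slia.
  by rewrite /Q' rz nz; case/rch_path: rz => p [_ hh _]; apply/existsP; exists (last v p).
by apply/hasP; exists f => //; rewrite ef modnMDl modn_small.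
Qed.

End Flood.

(** * Node programs *)

Fixpoint enc (L c : nat) : seq bool :=
  if L is L'.+1 then odd c :: enc L' c./2 else [::].

Definition dec (s : seq bool) : nat := foldr (fun (x : bool) a => x + a.*2) 0 s.

Lemma encK L c : c < 2 ^ L -> dec (enc L c) = c.
Proof.
elim: L c => [|L IH] c /=; first by rewrite expn0; case: c.
rewrite expnS => lt; rewrite IH ?odd_double_half //.
by rewrite -(odd_double_half c) in lt; lia.
Qed.

Lemma size_enc L c : size (enc L c) = L.
Proof. by elim: L c => //= L IH c; rewrite IH. Qed.

(* [base n] bounds all distances and [ntok n] all token codes put on the wire. *)
Definition base (n : nat) : nat := 8 * n.+1.
Definition ntok (n : nat) : nat := base n ^ 3.
Definition msg_len (n : nat) : nat := 16 * (trunc_log 2 n).+1.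

Lemma trunc_log2P n : n < 2 ^ (trunc_log 2 n).+1 /\ (0 < n -> 2 ^ (trunc_log 2 n).+1 <= 2 * n).
Proof.
split; first exact: trunc_log_ltn.
by move=> n0; rewrite expnS leq_mul2l /= trunc_logP.
Qed.

(** With B = trunc_log 2 n + 1 one has n + 1 <= 2^B and 8 <= 2^(3B), so each of the four factors
    [base n] fits in 4B bits. *)
Lemma base_msg n : base n * ntok n <= 2 ^ msg_len n.
Proof.
have [lt _] := trunc_log2P n.
rewrite /ntok -expnS /msg_len /base; set B := (trunc_log 2 n).+1 in lt *.
have -> : 16 * B = (3 * B + B) * 4 by lia.
rewrite expnM leq_exp2r // expnD; apply: leq_mul => //.
by rewrite (@leq_exp2l 2 3) // /B; lia.
Qed.

Definition wire (n c : nat) : seq bool := locked enc (msg_len n) c.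


(* A program floods: [Flood l tau acc toks k] takes part in [tau.+1] rounds of
   flooding up to distance [l], listening only to the neighbours in [acc], and
   continues with [k] applied to the facts (code, sender) heard. *)
Inductive prog :=
  | Done of Output
  | Flood (l tau : nat) (acc : pred nat) (toks : seq nat) (k : seq (nat * nat) -> prog).

Record mstate := MState {
  ms_n : nat; ms_prog : prog; ms_facts : seq (nat * nat); ms_sent : seq nat; ms_time : nat }.

Definition start (n : nat) (p : prog) : mstate :=
  MState n p (if p is Flood _ _ _ toks _ then [seq (x, 0) | x <- toks] else [::]) [::] 0.

Definition ms_next (st : mstate) : option nat :=
  if ms_prog st is Flood l _ _ _ _ then nextc (ntok (ms_n st)) l (ms_facts st) (ms_sent st)
  else None.

Definition heard (n : nat) (acc : pred nat) (f : nat -> option (seq bool)) : seq (nat * nat) :=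
  pmap (fun j => if acc j then omap (fun bs => (dec bs + ntok n, j)) (f j) else None) (iota 0 n).

Definition ms_recv (st : mstate) (f : nat -> option (seq bool)) : mstate :=
  if ms_prog st is Flood l tau acc toks k then
    let F := ms_facts st ++ heard (ms_n st) acc f in
    if ms_time st == tau then start (ms_n st) (k F)
    else MState (ms_n st) (ms_prog st) F
           (if ms_next st is Some c then c :: ms_sent st else ms_sent st) (ms_time st).+1
  else st.

(** The same message goes to every neighbour; directions are imposed by the receiver through [acc].
    The constant 16 makes the message cap equal to [msg_len]. *)
Definition algo_of (main : Input -> seq bool -> prog) (tl : nat -> nat) : Algo :=
  mkAlgo (fun i tape => start (in_n i) (main i tape))
    (fun st _ => omap (wire (ms_n st)) (ms_next st))
    ms_recv
    (fun st => if ms_prog st is Done o then Some o else None)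
    tl 16.

(** * Proof rules: rounds of the machine as steps of abstract flooding *)

Section Machine.
Variables (main : Input -> seq bool -> prog) (tl : nat -> nat).
Notation A := (algo_of main tl).
Variables (n : nat) (E : rel 'I_n) (Post : ('I_n -> Output) -> Prop).

Definition cstep (C : 'I_n -> mstate) : 'I_n -> mstate := fun v =>
  if a_out A (C v) is Some _ then C v
  else a_recv A (C v) (fun j =>
         match @insub nat (fun x => x < n) 'I_n j with
         | Some u =>
             if uadj E u v then
               if a_out A (C u) is None then omap (take (msg_cap A n)) (a_send A (C u) (val v))
               else None
             else None
         | None => None
         end).

Lemma run_iter inp tape r : run A E inp tape r = iter r cstep (run A E inp tape 0).
Proof. by elim: r => //= r ->. Qed.

(** Acts as a weakest precondition with a round budget: each rule below peels one primitive off the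
    front of [P] and pays for it out of [r]. *)
Definition ok (P : 'I_n -> prog) (r : nat) : Prop :=
  exists r' out, [/\ r' <= r,
    forall v, a_out A (iter r' cstep (fun v => start n (P v)) v) = Some (out v) & Post out].

Lemma ok_leq P r r' : r <= r' -> ok P r -> ok P r'.
Proof. by move=> le [x [o [h1 h2 h3]]]; exists x, o; split=> //; apply: leq_trans le. Qed.

Lemma ok_ext P Q r : (forall v, P v = Q v) -> ok Q r -> ok P r.
Proof. by move=> /functional_extensionality ->. Qed.

Lemma ok_done (o : 'I_n -> Output) r : Post o -> ok (fun v => Done (o v)) r.
Proof. by move=> h; exists 0, o. Qed.

Lemma pmap_map (T T' T'' : Type) (g : T -> T') (f : T' -> option T'') s :
  pmap f (map g s) = pmap (fun x => f (g x)) s.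
Proof. by elim: s => //= x s ->. Qed.

Definition nbr (acc : 'I_n -> pred nat) : rel 'I_n := fun v u => uadj E u v && acc v (val u).

Section FloodRule.
Variables (l tau : nat) (acc : 'I_n -> pred nat) (toks : 'I_n -> seq nat).
Variable k : 'I_n -> seq (nat * nat) -> prog.
Hypothesis hl : l <= base n.
Let P v := Flood l tau (acc v) (toks v) (k v).
Let G := fl (ntok n) l (nbr acc) toks.

Lemma fnext_small t u c : fnext (ntok n) l (G t) u = Some c -> c < 2 ^ msg_len n.
Proof.
rewrite /fnext /nextc.
case: (ohead _) (ohead_filter_iotaP (fun c => live (ntok n) (G t u).1 c && (c \notin (G t u).2)) (l * ntok n)) => // c' [_ lt _] [<-].
apply: leq_trans lt _; apply: leq_trans (base_msg n).
by rewrite leq_mul2r hl orbT.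
Qed.

(** Decoding undoes encoding because sent codes stay below l * ntok n, and no bit is truncated
    because a message is exactly as long as the cap. *)
Lemma heard_fl (C : 'I_n -> mstate) t v :
  (forall u, C u = MState n (P u) (G t u).1 (G t u).2 t) ->
  cstep C v =
  if t == tau then start n (k v (G t.+1 v).1)
  else MState n (P v) (G t.+1 v).1 (G t.+1 v).2 t.+1.
Proof.
move=> hC; rewrite /cstep hC /= /ms_recv /=.
set hh := heard _ _ _.
have -> : (G t v).1 ++ hh = (G t.+1 v).1.
  rewrite /= -/(G t); congr cat; rewrite /hh /heard -val_enum_ord pmap_map.
  apply: eq_pmap => u; rewrite valK /nbr !hC /= andbC.
  case: (acc v u) => //=; case: (uadj E u v) => //=.
  rewrite /ms_next /= /fnext.
  case Ec: (nextc _ _ _ _) => [c|] //=.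
  rewrite take_oversize; last by rewrite /wire -lock size_enc.
  by rewrite /wire -lock (@encK (msg_len n) c) //; apply: (@fnext_small t u c).
by case: eqP.
Qed.

Lemma flood_run t : t <= tau ->
  iter t cstep (fun v => start n (P v)) = fun v => MState n (P v) (G t v).1 (G t v).2 t.
Proof.
elim: t => [//|t IH] lt; rewrite iterS IH ?(ltnW lt) //.
apply: functional_extensionality => v; rewrite (@heard_fl _ t) //.
by case: eqP => // et; rewrite et ltnn in lt.
Qed.

Lemma ok_flood r :
  ok (fun v => k v (G tau.+1 v).1) r -> ok P (tau.+1 + r).
Proof.
case=> r' [o [h1 h2 h3]]; exists (r' + tau.+1), o; split=> //; first by lia.
move=> v; rewrite iterD -(h2 v); congr (a_out A (iter r' cstep _ v)).
rewrite iterS flood_run //; apply: functional_extensionality => u; by rewrite (@heard_fl _ tau) // eqxx.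
Qed.

End FloodRule.
End Machine.

(** * Broadcast, multi-source search and diameter estimation *)

Lemma eq_rch n (nb nb' : rel 'I_n) (H H' : pred 'I_n) :
  nb =2 nb' -> H =1 H' -> forall k, rch nb H k =1 rch nb' H' k.
Proof.
move=> e eH; elim=> [|k IH] v /=; first exact: eH.
by rewrite IH; congr orb; apply: eq_existsb => u; rewrite e IH.
Qed.

Lemma rch_mono n (nb : rel 'I_n) (H H' : pred 'I_n) k v :
  (forall u, H u -> H' u) -> rch nb H k v -> rch nb H' k v.
Proof. by move=> s /rch_path[p [a b c]]; apply/rch_path; exists p; split=> //; apply: s. Qed.

Lemma eq_isd n (nb nb' : rel 'I_n) (H H' : pred 'I_n) :
  nb =2 nb' -> H =1 H' -> forall k, isd nb H k =1 isd nb' H' k.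
Proof. by move=> e eH k v; rewrite /isd !(eq_rch e eH). Qed.

Lemma rch_trans n (nb : rel 'I_n) (H : pred 'I_n) b c i j :
  rch nb H j b -> rch nb (pred1 b) i c -> rch nb H (i + j) c.
Proof.
move=> h; elim: i c => [|i IH] c /=; first by move/eqP->.
case/orP=> [/IH->//|/existsP[u /andP[e /IH hu]]].
by apply/orP; right; apply/existsP; exists u; rewrite e.
Qed.

Lemma rch_sym n (nb : rel 'I_n) a b k :
  symmetric nb -> rch nb (pred1 a) k b -> rch nb (pred1 b) k a.
Proof.
move=> sy; elim: k b => [|k IH] b /=; first by rewrite eq_sym.
case/orP=> [/IH->//|/existsP[u /andP[e /IH hu]]].
have h1 : rch nb (pred1 b) 1 u by apply: (@rch_step _ _ _ 0 u b) => //=; rewrite sy.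
by have := rch_trans h1 hu; rewrite addn1.
Qed.

Lemma isd_below n (nb : rel 'I_n) H d v e : isd nb H d v -> e <= d -> exists z, isd nb H e z.
Proof.
elim: d v => [|d IH] v h; first by rewrite leqn0 => /eqP->; exists v.
rewrite leq_eqVlt => /orP[/eqP->|]; first by exists v.
by rewrite ltnS => le; have [u _ hu] := isd_pred h; apply: IH hu le.
Qed.

(* A shortest walk has no repeated vertex. *)
Lemma isd_lt n (nb : rel 'I_n) H d v : isd nb H d v -> d < n.
Proof.
move=> h; have /rch_path[p [a b c]] := isd_rch h.
have : d < #|'I_n|; last by rewrite card_ord.
case: (shortenP a) b => p' a' u' _ b'.
have le : d <= size p' by apply: (isd_leq h); apply/rch_path; exists p'.
have := card_uniqP u'; rewrite /= => e.
by apply: leq_trans (max_card (mem (v :: p'))); rewrite e ltnS.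
Qed.

Section Bcast.
Variables (T : finType).

Definition tokens_of (X : {set T}) : seq nat := [seq val (enum_rank x) | x <- enum X].

Definition factset (n : nat) (F : seq (nat * nat)) : {set T} :=
  [set x : T | has (fun f => f.1 %% ntok n == val (enum_rank x)) F].

Fixpoint bcast_rec (n Dl f K : nat) (X : {set T}) (k : {set T} -> prog) : prog :=
  Flood Dl (Dl + K) predT (tokens_of X) (fun F =>
    let Y := factset n F in
    if f is f'.+1 then if #|Y| <= K then k Y else bcast_rec n Dl f' (2 * K) X k
    else k Y).

(* The number of tokens is unknown: guess K, and double it as long as more
   than K tokens show up, an event all nodes agree on. *)
Definition bcast (n Dl : nat) (X : {set T}) (k : {set T} -> prog) : prog :=
  bcast_rec n Dl #|T| Dl.+1 X k.

Lemma count_codes M (p : pred nat) : #|T| <= M -> (forall x, p x -> x < #|T|) ->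
  count p (iota 0 M) = #|[set x : T | p (val (enum_rank x))]|.
Proof.
move=> le hp; rewrite -size_filter cardE -(size_map (fun x : T => val (enum_rank x))).
apply: perm_size; apply: uniq_perm.
- by rewrite filter_uniq ?iota_uniq.
- have inj : injective (fun x : T => val (enum_rank x)) by move=> x y /val_inj/enum_rank_inj.
  by rewrite (map_inj_uniq inj) enum_uniq.
move=> c; rewrite mem_filter mem_iota /=; apply/andP/mapP => [[pc _]|[x]].
  have lt := hp _ pc; exists (enum_val (Ordinal lt)); last by rewrite enum_valK.
  by rewrite mem_enum inE enum_valK.
rewrite mem_enum inE => px ->; split=> //=.
exact: leq_trans (ltn_ord _) le.
Qed.

End Bcast.

Definition acc_id n (acc : pred 'I_n) : pred nat :=
  fun j => if @insub nat (fun x => x < n) 'I_n j is Some u then acc u else false.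

(** Each source floods its own identifier. The smallest code heard for [y] gives the distance to
    [y], and the sender of a live code of positive distance is a next hop towards [y]. *)
Definition mbfs n (l K : nat) (acc : pred 'I_n) (v : 'I_n) (src : bool)
  (k : ('I_n -> nat -> bool) -> ('I_n -> option 'I_n) -> prog) : prog :=
  Flood l (l + K) (acc_id acc) (if src then [:: val v] else [::]) (fun F =>
    k (fun y d => (d <= l) && live (ntok n) F (d * ntok n + y))
      (fun y => [pick u : 'I_n | has (fun f =>
         [&& f.2 == val u, f.1 %% ntok n == y, 0 < f.1 %/ ntok n & live (ntok n) F f.1]) F])).

(** Node 0 floods to distance g; nodes it missed raise an alarm, which flooded to distance 2g+1
    reaches everyone. Silence thus tells all nodes alike that everything lies within g of node 0, so
    2g bounds the diameter. *)
Fixpoint find_diam n (v : 'I_n) (f g : nat) (k : nat -> prog) : prog :=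
  Flood g g.+1 predT (if val v == 0 then [:: 0] else [::]) (fun F =>
    Flood (2 * g).+1 (2 * g).+2 predT
      (if has (fun h => h.1 %/ ntok n <= g) F then [::] else [:: 0]) (fun F' =>
      if F' == [::] then k (2 * g)
      else if f is f'.+1 then find_diam v f' (2 * g) k else k 0)).

(** * Correctness and round bounds of the communication primitives *)

Section Rules.
Variables (main : Input -> seq bool -> prog) (tl : nat -> nat).
Variables (n : nat) (E : rel 'I_n).

Definition diam_le (Dl : nat) : Prop := forall u v, rch (uadj E) (pred1 u) Dl v.

Lemma uadj_sym : symmetric (uadj E).
Proof. by move=> u v; rewrite /uadj orbC. Qed.

Lemma nbrT : nbr E (fun _ => predT) =2 uadj E.
Proof. by move=> u v; rewrite /nbr /= andbT uadj_sym. Qed.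

Lemma ntok_gt0 : 0 < ntok n.
Proof. by rewrite expn_gt0. Qed.

Section BcastRule.
Variables (T : finType) (Dl : nat) (X : 'I_n -> {set T}).
Hypotheses (hD : diam_le Dl) (hDb : Dl <= base n) (hT : #|T| <= ntok n).

Let U := \bigcup_v X v.
Let tk v := tokens_of (X v).
Let G := fl (ntok n) Dl (nbr E (fun _ => predT)) tk.

Lemma tk_lt v x : x \in tk v -> x < #|T|.
Proof. case/mapP=> y _ ->; exact: ltn_ord. Qed.

Lemma tk_ltM v x : x \in tk v -> x < ntok n.
Proof. by move/tk_lt => h; apply: leq_trans h hT. Qed.

Lemma mem_tk v (x : T) : (val (enum_rank x) \in tk v) = (x \in X v).
Proof.
apply/mapP/idP => [[y hy /val_inj /enum_rank_inj ->]|h]; first by rewrite mem_enum in hy.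
by exists x => //; rewrite mem_enum.
Qed.

Lemma present_rch x v : present tk x -> rch (nbr E (fun _ => predT)) (holds tk x) Dl v.
Proof.
case/existsP=> u hu; rewrite (eq_rch nbrT (frefl _)).
by apply: rch_mono (hD u v) => w /eqP ->.
Qed.

Lemma card_U : count (present tk) (iota 0 (ntok n)) = #|U|.
Proof.
rewrite (@count_codes T) //; last by move=> x /existsP[v /tk_lt].
apply: eq_card => x; rewrite inE; apply/existsP/bigcupP => [[v]|[v _]].
  by rewrite mem_tk => h; exists v.
by move=> h; exists v; rewrite mem_tk.
Qed.

Lemma factset_present t v x : has (fun f => f.1 %% ntok n == x) (G t v).1 -> present tk x.
Proof.
case/hasP=> f hf /eqP <-; have [_ [h _]] := fl_sound tk_ltM hf.
by case/rch_path: h => p [_ b _]; apply/existsP; exists (last v p).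
Qed.

Lemma bcast_all K v : #|U| <= K -> factset T n (G (Dl + K).+1 v).1 = U.
Proof.
move=> hK; apply/setP => x; rewrite inE; apply/idP/bigcupP.
  by move/factset_present/existsP => [u]; rewrite mem_tk => h; exists u.
case=> u _ hx; have px : present tk (val (enum_rank x)) by apply/existsP; exists u; rewrite mem_tk.
have [d le hd] := rch_isd (present_rch v px).
have cK : count (present tk) (iota 0 (ntok n)) <= K by rewrite card_U.
have /hasP[f hf /eqP ef] := fl_complete tk_ltM cK (leqnSn (Dl + K)) hd le.
apply/hasP; exists f => //; rewrite ef modnMDl modn_small //.
apply: leq_trans hT; exact: ltn_ord.
Qed.

(** Together with [bcast_all] this makes the test on [K] come out alike everywhere: a guess is
    rejected by all nodes or by none. *)
Lemma bcast_over K v : K < #|U| -> K < #|factset T n (G (Dl + K).+1 v).1|.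
Proof.
rewrite -card_U => hK.
have := fl_overflow tk_ltM (fun x px => present_rch v px) (leqnSn (Dl + K)) hK.
by rewrite (@count_codes T) // => x /factset_present/existsP[u /tk_lt].
Qed.

(** A guess K > Dl costs at most 2K rounds and is doubled only while K < #|U|, so the costs form a
    geometric sum; [maxn (2 * K) (8 * #|U| - 2 * K)] is the budget left at guess K. *)
Lemma ok_bcast Post (k : 'I_n -> {set T} -> prog) r :
  ok main tl E Post (fun v => k v U) r ->
  ok main tl E Post (fun v => bcast n Dl (X v) (k v)) (8 * #|U| + 2 * Dl.+1 + r).
Proof.
move=> hk; rewrite /bcast.
(* The fuel [#|T|] outlasts the doubling, since 2^#|T| exceeds the number of possible tokens. *)
have hU : #|U| <= 2 ^ #|T| * Dl.+1.
  apply: leq_trans (max_card _) _; apply: leq_trans (ltnW (ltn_expl _ (isT : 1 < 2))) _.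
  by rewrite leq_pmulr.
suff H f K : Dl < K -> #|U| <= 2 ^ f * K ->
    ok main tl E Post (fun v => bcast_rec n Dl f K (X v) (k v)) (maxn (2 * K) (8 * #|U| - 2 * K) + r).
  by apply: ok_leq (H _ _ (ltnSn _) hU); lia.
elim: f K => [|f IH] K lt hK.
  apply: (@ok_leq _ _ _ _ _ _ ((Dl + K).+1 + r)); first by lia.
  apply: ok_flood => //; rewrite -/tk -/G.
  suff -> : (fun v => k v (factset T n (G (Dl + K).+1 v).1)) = (fun v => k v U) by [].
  by apply: functional_extensionality => v; rewrite bcast_all //; lia.
have [hle|hgt] := leqP #|U| K.
  apply: (@ok_leq _ _ _ _ _ _ ((Dl + K).+1 + r)); first by lia.
  apply: ok_flood => //; rewrite -/tk -/G.
  set P := fun v => _; suff -> : P = (fun v => k v U) by [].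
  by apply: functional_extensionality => v; rewrite /P bcast_all // hle.
apply: (@ok_leq _ _ _ _ _ _ ((Dl + K).+1 + (maxn (2 * (2 * K)) (8 * #|U| - 2 * (2 * K)) + r))); first by lia.
apply: ok_flood => //; rewrite -/tk -/G.
set P := fun v => _; suff -> : P = (fun v => bcast_rec n Dl f (2 * K) (X v) (k v)).
  by apply: IH; [lia | move: hK; rewrite expnS; lia].
by apply: functional_extensionality => v; rewrite /P leqNgt bcast_over.
Qed.

End BcastRule.

(** With out-neighbours as [acc v], tokens travel against the edges and [v] learns its distances to
    the sources; with in-neighbours, the distances from them. Next hops are handed over as an
    abstract [PP], since the choice among several closer neighbours is immaterial. *)
Lemma ok_mbfs Post (l K : nat) (acc : 'I_n -> pred 'I_n) (src : {set 'I_n}) k r :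
  let nb : rel 'I_n := fun v u => uadj E u v && acc v u in
  l <= base n -> #|src| <= K ->
  (forall PP : 'I_n -> 'I_n -> option 'I_n,
     (forall v y d, y \in src -> d < l -> isd nb (pred1 y) d.+1 v ->
        exists u, [/\ PP v y = Some u, nb v u & isd nb (pred1 y) d u]) ->
     ok main tl E Post
       (fun v => k v (fun y d => [&& d <= l, y \in src & isd nb (pred1 y) d v]) (PP v)) r) ->
  ok main tl E Post (fun v => mbfs l K (acc v) v (v \in src) (k v)) ((l + K).+1 + r).
Proof.
move=> nb hl hK hk; apply: ok_flood => //.
set tk := fun v : 'I_n => if _ then _ else _.
set nb' := nbr _ _; set G := fl _ _ _ _.
have enb : nb' =2 nb by move=> v u; rewrite /nb' /nbr /acc_id valK.
have ltM (y : 'I_n) : val y < ntok n.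
  apply: leq_trans (ltn_ord y) _; rewrite /ntok /base expnS; have := expn_gt0 (8 * n.+1) 2; lia.
have tkM v x : x \in tk v -> x < ntok n.
  by rewrite /tk; case: ifP => // _; rewrite inE => /eqP->.
have hold (y : 'I_n) : y \in src -> holds tk (val y) =1 pred1 y.
  move=> hy v; rewrite /holds /tk; case: ifP => [_|hv]; first by rewrite inE /= eq_sym; apply/eqP/eqP => [/val_inj|->].
  by apply/esym/negbTE; apply: contraFN hv => /eqP->.
have hold0 (y : 'I_n) : y \notin src -> holds tk (val y) =1 pred0.
  move=> hy v; rewrite /holds /tk; case: ifP => // hv; rewrite inE.
  by apply: contraNF hy => /eqP/val_inj ->.
have pres : count (present tk) (iota 0 (ntok n)) <= K.
  apply: leq_trans hK; rewrite cardE -size_filter -(size_map val).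
  apply: uniq_leq_size; first by rewrite filter_uniq ?iota_uniq.
  move=> x; rewrite mem_filter => /andP[/existsP[v hx] _].
  move: hx; rewrite /tk; case: ifP => // hv; rewrite inE => /eqP ->.
  by apply: map_f; rewrite mem_enum.
have lK : l + K <= (l + K).+1 by [].
pose PP v (y : 'I_n) := [pick u : 'I_n | has (fun f =>
   [&& f.2 == val u, f.1 %% ntok n == y, 0 < f.1 %/ ntok n & live (ntok n) (G (l + K).+1 v).1 f.1]) (G (l + K).+1 v).1].
have LI v (y : 'I_n) d : d <= l -> live (ntok n) (G (l + K).+1 v).1 (d * ntok n + y) = (y \in src) && isd nb (pred1 y) d v.
  move=> dl; have [hy|hy] := boolP (y \in src); last first.
    apply/negP => /andP[/hasP[f hf /eqP ef] _].
    have [_ [hr _]] := fl_sound tkM hf; move: hr; rewrite ef modnMDl (modn_small (ltM y)).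
    by case/rch_path=> p [_ + _]; rewrite hold0.
  rewrite -(eq_isd enb (hold y hy)).
  apply/idP/idP => [lv|hd]; last first.
    exact: (live_known tkM (ltM y) hd (fl_complete tkM pres lK hd dl)).
  (* a live code is at most the true distance, which is known since it is at most l *)
  have /andP[/hasP[f hf /eqP ef] _] := lv.
  have [_ [hr _]] := fl_sound tkM hf; move: hr; rewrite ef modnMDl (modn_small (ltM y)) divnMDl ?ntok_gt0 // (divn_small (ltM y)) addn0 => hr.
  have [d' le' h'] := rch_isd hr.
  apply: (live_isd tkM (ltM y) lv) => d2 h2; rewrite -(isd_inj h' h2).
  by apply: (fl_complete tkM pres lK h'); apply: leq_trans dl.
set P := fun v => _.
suff -> : P = fun v => k v (fun y d => [&& d <= l, y \in src & isd nb (pred1 y) d v]) (PP v).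
  apply: hk => v y d hy dl hd.
  rewrite /PP; case: pickP => [u /hasP[f hf /and4P[/eqP fu /eqP fy f0 lf]]|none].
    exists u; have [_ [hr hp]] := fl_sound tkM hf.
    have [u' [e1 e2 e3]] := hp f0.
    have eu : u' = u by apply: val_inj; rewrite e1.
    rewrite eu enb in e2; rewrite eu fy (eq_rch enb (hold y hy)) in e3.
    rewrite fy (eq_rch enb (hold y hy)) in hr.
    (* Liveness pins the code down to the true distance; soundness then puts the sender within
       distance d, and it cannot be nearer. *)
    have fd : f.1 %/ ntok n = d.+1.
      apply/eqP; rewrite eqn_leq (isd_leq hd hr) andbT.
      have /andP[_ /allP al] := lf.
      have : live (ntok n) (G (l + K).+1 v).1 (d.+1 * ntok n + y) by rewrite LI // hy.
      case/andP=> /hasP[g hg /eqP eg] _; have := al _ hg; rewrite eg modnMDl fy (modn_small (ltM y)) eqxx /=.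
      rewrite {1}(divn_eq f.1 (ntok n)) fy leq_add2r leq_mul2r => /orP[/eqP e0|//].
      by have := ntok_gt0; rewrite e0.
    split=> //; rewrite fd /= in e3.
    have [d' le' h'] := rch_isd e3; suff -> : d = d' by [].
    apply/eqP; rewrite eqn_leq le' andbT -ltnS.
    by apply: (isd_leq hd); apply: rch_step e2 (isd_rch h').
  have lv : live (ntok n) (G (l + K).+1 v).1 (d.+1 * ntok n + y) by rewrite LI // hy.
  have /andP[/hasP[f hf /eqP ef] _] := lv.
  have [_ [_ hp]] := fl_sound tkM hf.
  have fd : f.1 %/ ntok n = d.+1 by rewrite ef divnMDl ?ntok_gt0 // (divn_small (ltM y)) addn0.
  have [|u [e1 _ _]] := hp; first by rewrite fd.
  have /negbT/hasPn := none u; move/(_ f hf)/negP; case.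
  by rewrite -e1 eqxx fd ef modnMDl (modn_small (ltM y)) eqxx /=.
apply: functional_extensionality => v; rewrite /P; congr (k v _ _).
apply: functional_extensionality => y; apply: functional_extensionality => d.
by have [dl|dl] /= := leqP d l; [rewrite LI | ].
Qed.

Lemma ok_find_diam D : undirected_diameter E D -> 1 < n ->
  D < n /\ exists Dl, [/\ diam_le Dl, D <= Dl <= 4 * D, 0 < Dl &
    forall Post k r, ok main tl E Post (fun v => k v Dl) r ->
      ok main tl E Post (fun v => find_diam v n 1 (k v)) (32 * D + r)].
Proof.
case=> hD1 [u1 [u2 hD2]] n1.
have n0 : 0 < n by lia.
pose o := Ordinal n0.
have hD : diam_le D.
  move=> u v; have [k [le [p [a [b c]]]]] := hD1 v u.
  by apply/rch_path; exists p; rewrite /= b c.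
have Dn : D < n.
  have [d le hd] := rch_isd (hD u2 u1).
  have /rch_path[p [a /eqP b c]] := isd_rch hd.
  apply: leq_ltn_trans (isd_lt hd); apply: leq_trans c; apply: hD2.
  by exists p.
split=> //; have D0 : 0 < D.
  rewrite lt0n; apply/negP => /eqP e.
  have := hD o (Ordinal n1); rewrite e /=; move/eqP/(congr1 val) => //.
pose tk1 (v : 'I_n) := if val v == 0 then [:: 0] else [::].
pose nbT := nbr E (fun _ => predT).
have sy : symmetric nbT by move=> u v; rewrite /nbT !nbrT uadj_sym.
have hDT u v : rch nbT (pred1 u) D v by rewrite (eq_rch (@nbrT) (frefl _)).
have tk1M v x : x \in tk1 v -> x < ntok n.
  by rewrite /tk1; case: ifP => // _; rewrite inE => /eqP->; apply: ntok_gt0.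
have hold1 : holds tk1 0 =1 pred1 o.
  move=> v; rewrite /holds /tk1 /=; have -> : (v == o) = (val v == 0) by [].
  by case: (val v == 0).
have bM : base n <= ntok n by rewrite /ntok /base expnS; have := expn_gt0 (8 * n.+1) 2; lia.
have pres1 : count (present tk1) (iota 0 (ntok n)) <= 1.
  rewrite -size_filter; apply: (@uniq_leq_size _ _ [:: 0]); first by rewrite filter_uniq ?iota_uniq.
  move=> x; rewrite mem_filter => /andP[/existsP[v +] _]; rewrite /tk1.
  by case: ifP => // _; rewrite !inE.
pose F1 g v := (fl (ntok n) g nbT tk1 g.+2 v).1.
have heardP g v : has (fun h => h.1 %/ ntok n <= g) (F1 g v) = rch nbT (pred1 o) g v.
  rewrite -(eq_rch (fun u w => erefl (nbT u w)) hold1).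
  apply/hasP/idP => [[f hf le]|/rch_isd[d le hd]].
    have [_ [hr _]] := fl_sound tk1M hf.
    have f0 : f.1 %% ntok n = 0.
      by case/rch_path: hr => p [_ + _]; rewrite /holds /tk1; case: ifP => // _; rewrite inE => /eqP.
    by rewrite f0 in hr; apply: rch_leq le hr.
  have gl : g + 1 <= g.+2 by lia.
  have /hasP[f hf /eqP ef] := fl_complete tk1M pres1 gl hd le.
  by exists f => //; rewrite ef addn0 mulnK ?ntok_gt0.
pose tk2 g v := if rch nbT (pred1 o) g v then [::] else [:: 0].
have tk2M g v x : x \in tk2 g v -> x < ntok n.
  by rewrite /tk2; case: ifP => // _; rewrite inE => /eqP->; apply: ntok_gt0.
have pres2 g : count (present (tk2 g)) (iota 0 (ntok n)) <= 1.
  rewrite -size_filter; apply: (@uniq_leq_size _ _ [:: 0]); first by rewrite filter_uniq ?iota_uniq.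
  move=> x; rewrite mem_filter => /andP[/existsP[v +] _]; rewrite /tk2.
  by case: ifP => // _; rewrite !inE.
pose F2 g v := (fl (ntok n) (2 * g).+1 nbT (tk2 g) (2 * g).+3 v).1.
have all2 g : (forall v, rch nbT (pred1 o) g v) -> forall v, F2 g v == [::].
  move=> hall v; apply/eqP; case E2: (F2 g v) => [//|f s].
  have hf : f \in F2 g v by rewrite E2 inE eqxx.
  have [_ [/rch_path[p [_ + _]] _]] := fl_sound (@tk2M g) hf.
  by rewrite /holds /tk2 hall.
have some2 g u0 : ~~ rch nbT (pred1 o) g u0 -> forall v, (F2 g v == [::]) = false.
  move=> hu0 v.
  (* If [v] is beyond g it is its own alarm. Otherwise, as [u0] is beyond g, some [z] is at distance
     exactly g+1 from [o], and going through [o] it is within 2g+1 of [v]. *)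
  have [z hz dz] : exists2 z, ~~ rch nbT (pred1 o) g z & rch nbT (pred1 z) (2 * g).+1 v.
    have [hv|hv] := boolP (rch nbT (pred1 o) g v); last first.
      by exists v => //; apply: (@rch_leq _ _ _ 0) => //=.
    have [d le hd] := rch_isd (hDT o u0).
    have gd : g < d by rewrite ltnNge; apply: contra hu0 => le'; apply: rch_leq le' (isd_rch hd).
    have [z hz] := isd_below hd gd; exists z.
      by apply/negP => /(isd_leq hz); rewrite ltnn.
    have := rch_trans (rch_sym sy (isd_rch hz)) hv.
    by apply: rch_leq; lia.
  have hr : rch nbT (holds (tk2 g) 0) (2 * g).+1 v.
    by apply: rch_mono dz => w /eqP ->; rewrite /holds /tk2 (negbTE hz).
  have [d le hd] := rch_isd hr.
  have gl : (2 * g).+1 + 1 <= (2 * g).+3 by lia.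
  have /hasP[f hf _] := fl_complete (@tk2M g) (pres2 g) gl hd le.
  by apply/negP => /eqP e0; move: hf; rewrite -/(F2 g v) e0.
have ex2 : exists j, [forall v, rch nbT (pred1 o) (2 ^ j) v].
  exists D; apply/forallP => v; apply: rch_leq (hDT o v).
  by apply: ltnW; apply: ltn_expl.
case: (ex_minnP ex2) => J /forallP hJ minJ.
have JD : 2 ^ J <= 2 * D.
  case: (J) minJ => [|J'] minJ; first by lia.
  rewrite expnS leq_mul2l /= leqNgt; apply/negP => lt.
  suff /minJ : [forall v, rch nbT (pred1 o) (2 ^ J') v] by rewrite ltnn.
  by apply/forallP => v; apply: rch_leq (ltnW lt) (hDT o v).
have Jd : diam_le (2 * 2 ^ J).
  move=> u v; rewrite -(eq_rch (@nbrT) (frefl _)) -/nbT.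
  have := rch_trans (rch_sym sy (hJ u)) (hJ v).
  by apply: rch_leq; lia.
exists (2 * 2 ^ J); split=> //.
- apply/andP; split; last by lia.
  have [d le hd] := rch_isd (Jd u2 u1); have /rch_path[p [a /eqP b c]] := isd_rch hd.
  apply: leq_trans le; apply: leq_trans c; apply: hD2; by exists p.
- by have := expn_gt0 2 J; lia.
move=> Post k r hk.
have Jn : J <= n.
  have := ltn_expl J (isT : 1 < 2).
  by move: JD; case: (J) => [//|J'] JD; have := ltn_expl J' (isT : 1 < 2); move: JD; rewrite expnS; lia.
have two i (W : 'I_n -> seq (nat * nat) -> prog) r' : i <= J ->
    ok main tl E Post (fun v => W v (F2 (2 ^ i) v)) r' ->
    ok main tl E Post (fun v => Flood (2 ^ i) (2 ^ i).+1 predT (tk1 v) (fun F =>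
      Flood (2 * 2 ^ i).+1 (2 * 2 ^ i).+2 predT
        (if has (fun h => h.1 %/ ntok n <= 2 ^ i) F then [::] else [:: 0]) (W v)))
      (8 * 2 ^ i + r').
  move=> iJ h; have i1 : 0 < 2 ^ i by rewrite expn_gt0.
  have iJ2 : 2 ^ i <= 2 ^ J by rewrite leq_exp2l.
  apply: (@ok_leq _ _ _ _ _ _ ((2 ^ i).+2 + ((2 * 2 ^ i).+3 + r'))); first by lia.
  apply: ok_flood; first by rewrite /base; lia.
  apply: ok_flood; first by rewrite /base; lia.
  apply: ok_ext h => v; rewrite /F2 -/nbT; congr (W v (fl _ _ _ _ _ _).1).
  by apply: functional_extensionality => u; rewrite /tk2 -heardP.
(* A trial at g = 2^i costs at most 8 * 2^i rounds; the budget 32 D - 8 * 2^i telescopes, and 2^J <=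
   2 D leaves enough for the last trial. *)
suff H : forall i f, i <= J -> J - i <= f ->
    ok main tl E Post (fun v => find_diam v f (2 ^ i) (k v)) (32 * D - 8 * 2 ^ i + r).
  by apply: ok_leq (H 0 n _ _) => //; lia.
have last_it : forall i f, i = J -> ok main tl E Post (fun v => find_diam v f (2 ^ i) (k v)) (32 * D - 8 * 2 ^ i + r).
  move=> i f ->; apply: (@ok_leq _ _ _ _ _ _ (8 * 2 ^ J + r)); first by lia.
  case: f => [|f]; apply: (two J) => //.
    by apply: ok_ext hk => v; rewrite all2.
  by apply: ok_ext hk => v; rewrite all2.
move=> i f; elim: f i => [|f IH] i iJ fJ; first by apply: last_it; lia.
have [ei|ni] := eqVneq i J; first exact: last_it.
have iJ' : i < J by lia.
have iJ2 : 2 ^ i.+1 <= 2 ^ J by rewrite leq_exp2l.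
rewrite expnS in iJ2.
apply: (@ok_leq _ _ _ _ _ _ (8 * 2 ^ i + (32 * D - 8 * 2 ^ i.+1 + r))); first by rewrite expnS; lia.
apply: (two i) => //.
have [u0 hu0] : exists u0, ~~ rch nbT (pred1 o) (2 ^ i) u0.
  apply/existsP; rewrite -negb_forall; apply/negP => /minJ; lia.
apply: ok_ext (IH i.+1 _ _) => [v||]; [by rewrite (some2 _ _ hu0) expnS | by [] | by lia].
Qed.

End Rules.

(** * Random hitting sets *)

Definition nbits (n : nat) : nat := (trunc_log 2 n).+1.

(** A draw is uniform in [0, 2^B) with B = [nbits n], so it lands in a set of w vertices with
    probability w / 2^B. A group of 2^B / w + 1 draws misses the set with probability at most 1/2,
    and 5B groups leave 2^(-5B) <= n^(-5). *)
Definition ndraws (n w : nat) : nat := 5 * nbits n * (2 ^ nbits n %/ w).+1.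

(** A form of Bernoulli's inequality: (b + w)^(k+1) >= b^(k+1) + k w b^k with b = a - w, while a <=
    q w gives b <= (q - 1) w. *)
Lemma half_expn a w q : 0 < a -> w <= a -> a <= q * w -> 2 * (a - w) ^ q <= a ^ q.
Proof.
move=> + /subnK ea; rewrite -ea addnK; set b := a - w => a0 aq.
have H k : b ^ k * b + k * w * b ^ k <= (b + w) ^ k * (b + w).
  elim: k => [|k IH]; first by rewrite !expn0; lia.
  rewrite !expnSr; apply: leq_trans (_ : (b ^ k * b + k * w * b ^ k) * (b + w) <= _).
    by move: (b ^ k) => x; nia.
  by rewrite leq_mul2r IH orbT.
case: q aq => [|q] aq; first by lia.
have := H q; rewrite !expnSr; have : b * b ^ q <= q * w * b ^ q by rewrite leq_mul2r; apply/orP; right; lia.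
by lia.
Qed.

Section Hitting.
Variables (n B m w : nat) (J : finType) (W : J -> {set 'I_n}).
Hypotheses (n0 : 0 < n) (nB : n <= 2 ^ B) (mn : m <= n).
Hypotheses (wB : w <= 2 ^ B) (hm : 2 ^ B <= (m %/ (5 * B)) * w) (B0 : 0 < B).
Hypothesis hJ : #|J| * n <= 2 ^ (5 * B).

(** Only the tapes of the nodes below [m] are read; a string that names no vertex is a wasted
    draw. *)
Definition draw (tp : 'I_n -> B.-tuple bool) : {set 'I_n} :=
  [set x : 'I_n | [exists v : 'I_n, (v < m) && (dec (tp v) == val x)]].

Definition hits (L : {set 'I_n}) : bool :=
  [forall j, (w <= #|W j|) ==> [exists x in W j, x \in L]].

Lemma card_avoid (A : {set 'I_n}) : w <= #|A| ->
  #|[pred tau : B.-tuple bool | [forall x in A, dec tau != val x]]| <= 2 ^ B - w.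
Proof.
move=> wA; set p := [pred tau | _].
pose enct (x : 'I_n) : B.-tuple bool := [tuple of (tcast (size_enc B x) (in_tuple (enc B x)))].
have encE x : dec (enct x) = x.
  by rewrite /enct /= val_tcast /= encK //; apply: leq_trans nB.
have inj : injective enct.
  by move=> x y e; apply: val_inj; rewrite /= -[LHS]encE e encE.
have : #|p| + #|[set enct x | x in A]| <= #|{: B.-tuple bool}|.
  rewrite -cardUI (_ : #|predI _ _| = 0) ?addn0 ?max_card //.
  apply: eq_card0 => tau; rewrite !inE; apply/negP => /andP[/forallP h /imsetP[x xA e]].
  by have := h x; rewrite xA e encE eqxx.
rewrite card_tuple card_bool (card_imset _ inj) => h.
by rewrite -(leq_add2r w) subnK //; apply: leq_trans h; rewrite leq_add2l.
Qed.

(** Independence as a product: the assignments missing the set lie in a [family] constrained at the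
    first [m] nodes only. *)
Lemma card_bad j : w <= #|W j| ->
  #|[set tp : {ffun 'I_n -> B.-tuple bool} | ~~ [exists x in W j, x \in draw tp]]| <=
  (2 ^ B - w) ^ m * (2 ^ B) ^ (n - m).
Proof.
move=> wj.
pose F (v : 'I_n) := if v < m then [pred tau : B.-tuple bool | [forall x in W j, dec tau != val x]] else predT.
apply: (@leq_trans #|family F|).
  apply: subset_leq_card; apply/subsetP => tp; rewrite inE => h.
  apply/familyP => v; rewrite /F; case: ifP => // vm; rewrite inE.
  apply/forallP => x; apply/implyP => xW; apply: contra h => e.
  by apply/existsP; exists x; rewrite xW inE; apply/existsP; exists v; rewrite vm.
rewrite card_family foldrE big_image /=.
apply: (@leq_trans (\prod_(v < n) (if v < m then 2 ^ B - w else 2 ^ B))).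
  apply: leq_prod => v _; rewrite /F; case: ifP => _; first exact: card_avoid.
  by apply: leq_trans (max_card _) _; rewrite card_tuple card_bool.
rewrite -(big_mkord xpredT (fun v => if v < m then 2 ^ B - w else 2 ^ B)).
rewrite (big_cat_nat (leq0n m) mn) //=.
rewrite (@eq_big_nat _ _ _ 0 m _ (fun _ => 2 ^ B - w)); last by move=> i /andP[_ ->].
rewrite (@eq_big_nat _ _ _ m n _ (fun _ => 2 ^ B)); last by move=> i /andP[h _]; rewrite ltnNge h.
by rewrite !prod_nat_const_nat subn0.
Qed.

(** Union bound over [J]. Applying [half_expn] to 5B groups of draws gains the factor 2^(5B), which
    absorbs #|J| * n. *)
Lemma hits_whp :
  #|{: {ffun 'I_n -> B.-tuple bool}}| * (n - 1) <=
  #|[set tp : {ffun 'I_n -> B.-tuple bool} | hits (draw tp)]| * n.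
Proof.
set good := [set tp | _]; set N := #|{: {ffun 'I_n -> B.-tuple bool}}|.
have e : #|good| + #|~: good| = N by rewrite cardsC.
suff h : #|~: good| * n <= N.
  by rewrite mulnBr muln1 leq_subLR -{1}e mulnDl addnC leq_add2r.
have hN : N = (2 ^ B) ^ n by rewrite /N card_ffun card_tuple card_bool card_ord.
have hb : #|~: good| <= #|J| * ((2 ^ B - w) ^ m * (2 ^ B) ^ (n - m)).
  pose bad j := if w <= #|W j| then
    [set tp : {ffun 'I_n -> B.-tuple bool} | ~~ [exists x in W j, x \in draw tp]] else set0.
  apply: (@leq_trans #|\bigcup_j bad j|).
    apply: subset_leq_card; apply/subsetP => tp; rewrite !inE /hits negb_forall => /existsP[j].
    rewrite negb_imply => /andP[wj h]; apply/bigcupP; exists j => //.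
    by rewrite /bad wj inE.
  rewrite -sum_nat_const; apply: leq_trans (_ : \sum_j #|bad j| <= _).
    by elim/big_rec2: _ => [|j a b _ IH]; rewrite ?cards0 // cardsU; lia.
  apply: leq_sum => j _; rewrite /bad; case: ifP => [wj|_]; last by rewrite cards0.
  exact: card_bad.
pose q := m %/ (5 * B); have hq : 2 ^ B <= q * w := hm.
have em : m = 5 * B * q + m %% (5 * B) by rewrite {1}(divn_eq m (5 * B)) mulnC.
have h2 : 2 ^ (5 * B) * (2 ^ B - w) ^ m <= (2 ^ B) ^ m.
  have X0 : 0 < 5 * B by lia.
  move: em X0; move: (5 * B) => X em X0; rewrite em.
  rewrite !expnD mulnA; apply: leq_mul; last by case: (_ %% _) => // k; rewrite leq_exp2r ?leq_subr.
  rewrite (mulnC X q) (expnM (2 ^ B - w)) (expnM (2 ^ B) q) -expnMn leq_exp2r //.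
  by apply: half_expn; rewrite ?expn_gt0.
have -> : N = (2 ^ B) ^ m * (2 ^ B) ^ (n - m) by rewrite hN -expnD subnKC.
apply: leq_trans (_ : #|J| * n * ((2 ^ B - w) ^ m * (2 ^ B) ^ (n - m)) <= _).
  by rewrite mulnAC leq_mul2r hb orbT.
rewrite mulnA; apply: leq_mul => //.
by apply: leq_trans h2; rewrite leq_mul2r hJ orbT.
Qed.

End Hitting.

(** * Shortest paths, landmarks and successor following *)

Lemma asbP (P : Prop) : reflect P (asb P).
Proof. by rewrite /asb; case: excluded_middle_informative => h; constructor. Qed.

Definition least (P : nat -> Prop) (m : nat) : Prop := P m /\ forall m', P m' -> m <= m'.

Lemma least_ex (P : nat -> Prop) m : P m -> exists2 m', least P m' & m' <= m.
Proof.
move=> h; have ex : exists m, asb (P m) by exists m; apply/asbP.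
case: (ex_minnP ex) => m' /asbP h1 h2; exists m'; last by apply: h2; apply/asbP.
by split=> // k hk; apply: h2; apply/asbP.
Qed.

Lemma least_inj P m m' : least P m -> least P m' -> m = m'.
Proof. by move=> [a b] [c d]; apply/eqP; rewrite eqn_leq b // d. Qed.

Section Paths.
Variables (n : nat) (F : rel 'I_n).

(** One fixed shortest path per pair lets the union bound range over triples (x, y, start) instead
    of over all shortest paths. *)
Definition canon (x y : 'I_n) : seq 'I_n :=
  epsilon (inhabits [::]) (fun q => shortest_path F x y q).

Lemma shortest_ex x y q : dwalk F x y q -> exists2 q', shortest_path F x y q' & size q' <= size q.
Proof.
move=> h; have [|m [[q' h' e] mn] le] := @least_ex (fun m => exists2 q', dwalk F x y q' & size q' = m) (size q).
  by exists q.
exists q'; last by rewrite e.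
by split=> // q2 h2; rewrite e; apply: mn; exists q2.
Qed.

Lemma canonP x y q : dwalk F x y q -> shortest_path F x y (canon x y).
Proof. by case/shortest_ex => q' h _; apply: epsilon_spec; exists q'. Qed.

Lemma isd_dwalk x y d : isd F (pred1 y) d x -> exists2 q, dwalk F x y q & size q = d.
Proof.
move=> h; have /rch_path[p [a /eqP b c]] := isd_rch h.
exists p => //; apply/eqP; rewrite eqn_leq c; apply: (isd_leq h).
by apply/rch_path; exists p; rewrite /= b.
Qed.

Lemma dwalk_rch x y q : dwalk F x y q -> rch F (pred1 y) (size q) x.
Proof. by case=> a b; apply/rch_path; exists q; rewrite /= b. Qed.

Lemma isd_le_dwalk x y d q : isd F (pred1 y) d x -> dwalk F x y q -> d <= size q.
Proof. by move=> h /dwalk_rch; apply: isd_leq. Qed.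

Lemma shortest_isd x y q : shortest_path F x y q -> isd F (pred1 y) (size q) x.
Proof.
case=> h mn; have [d le hd] := rch_isd (dwalk_rch h).
have [q' h' e] := isd_dwalk hd.
suff -> : size q = d by []. by apply/eqP; rewrite eqn_leq le -e mn.
Qed.

Lemma dwalk_cat x y z p q : dwalk F x y p -> dwalk F y z q -> dwalk F x z (p ++ q).
Proof. by move=> [a b] [c d]; split; rewrite ?cat_path ?last_cat b ?a. Qed.

Lemma last_take (x : 'I_n) q i : i <= size q -> last x (take i q) = nth x (x :: q) i.
Proof.
case: i => [|i] h; first by rewrite take0.
by rewrite (last_nth x) size_takel // /= nth_take.
Qed.

Lemma dwalk_take x y q i : i <= size q -> dwalk F x y q -> dwalk F x (nth x (x :: q) i) (take i q).
Proof.
move=> h [a b]; split; last by rewrite last_take.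
by move: a; rewrite -{1}(cat_take_drop i q) cat_path => /andP[].
Qed.

Lemma dwalk_drop x y q i : i <= size q -> dwalk F x y q -> dwalk F (nth x (x :: q) i) y (drop i q).
Proof.
move=> h [a b]; move: a; rewrite -{1}(cat_take_drop i q) cat_path => /andP[_].
rewrite last_take // => a; split=> //.
by move: b; rewrite -{1}(cat_take_drop i q) last_cat last_take.
Qed.

Lemma dwalk_sub x y q i j : i <= j -> j <= size q -> dwalk F x y q ->
  dwalk F (nth x (x :: q) i) (nth x (x :: q) j) (drop i (take j q)).
Proof.
move=> ij jq h; have h1 := dwalk_take jq h.
have sz : size (take j q) = j by rewrite size_takel.
have := @dwalk_drop _ _ _ i _ h1; rewrite sz => /(_ ij).
suff -> : nth x (x :: take j q) i = nth x (x :: q) i by [].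
by case: i ij {h1} => //= i ij; rewrite nth_take.
Qed.

(** Exchange argument: a shorter middle piece would shorten [q]. *)
Lemma shortest_sub x y q i j : i <= j -> j <= size q -> shortest_path F x y q ->
  isd F (pred1 (nth x (x :: q) j)) (j - i) (nth x (x :: q) i).
Proof.
move=> ij jq [h mn]; have hs := dwalk_sub ij jq h.
have sz : size (drop i (take j q)) = j - i by rewrite size_drop size_takel.
rewrite -sz; apply: shortest_isd; split=> // q' h'.
have h2 := dwalk_cat (dwalk_take (leq_trans ij jq) h) (dwalk_cat h' (dwalk_drop jq h)).
have := mn _ h2; rewrite !size_cat size_takel ?(leq_trans ij) // size_drop sz; lia.
Qed.

Lemma shortest_inj x y q i j : i <= size q -> j <= size q -> shortest_path F x y q ->
  nth x (x :: q) i = nth x (x :: q) j -> i = j.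
Proof.
wlog ij : i j / i <= j.
  by move=> H hi hj hs e; case/orP: (leq_total i j) => h; [apply: H | apply/esym; apply: H].
move=> _ hj hs e; have := shortest_sub ij hj hs; rewrite e => h.
have := isd_leq h (_ : rch F _ 0 _); rewrite /= eqxx => /(_ isT); lia.
Qed.

Lemma shortest_uniq x y q : shortest_path F x y q -> uniq (x :: q).
Proof.
move=> h; apply/(uniqP x) => i j; rewrite !inE /= !ltnS => hi hj.
exact: shortest_inj h.
Qed.

Definition window (w : nat) (x y : 'I_n) (a : nat) : {set 'I_n} :=
  [set z in take w (drop a (x :: canon x y))].

(** The cardinality test keeps only full windows; those cut off by the end of the path ask for
    nothing. *)
Definition hit (w : nat) (L : {set 'I_n}) : Prop :=
  forall x y (a : 'I_n), w <= #|window w x y a| -> [exists z in window w x y a, z \in L].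

Lemma hit_pos w L x y q a : 0 < w -> hit w L -> dwalk F x y q ->
  a + w <= (size (canon x y)).+1 ->
  exists p, [/\ a <= p, p < a + w & nth x (x :: canon x y) p \in L].
Proof.
move=> w0 hw hq; have := canonP hq; set c := canon x y => hc le.
have uc := shortest_uniq hc.
have cn : size c < n by apply: isd_lt (shortest_isd hc).
have an : a < n by lia.
have := hw x y (Ordinal an); rewrite /= /window -/c.
have usub : uniq (take w (drop a (x :: c))) by rewrite take_uniq // drop_uniq.
have sz : size (take w (drop a (x :: c))) = w by rewrite size_takel // size_drop /=; lia.
have -> : #|[set z in take w (drop a (x :: c))]| = w by rewrite cardsE (card_uniqP usub).
move=> /(_ (leqnn w))/existsP[z /andP[]]; rewrite inE => /(nthP x)[i]; rewrite sz => iw.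
rewrite nth_take // nth_drop => <- zL.
by exists (a + i); split=> //; lia.
Qed.

End Paths.

(** * The skeleton graph on the landmarks *)

Section Skeleton.
Variables (n : nat) (dirP : 'I_n -> nat -> Prop) (edge : 'I_n -> 'I_n -> nat -> Prop).

(** Lengths of skeleton walks: [edge] steps between landmarks, closed by one [dirP] step to the
    target. Any walk counts, not only a shortest one; distances are obtained through [least]. *)
Inductive sk : 'I_n -> nat -> Prop :=
  | sk_dir l m : dirP l m -> sk l m
  | sk_edge l y d m : edge l y d -> sk y m -> sk l (d + m).

Variables (F : rel 'I_n) (w : nat) (L : {set 'I_n}) (c : nat) (x y : 'I_n) (q0 : seq 'I_n).
Hypotheses (w0 : 0 < w) (hL : hit F w L) (hq : dwalk F x y q0).
Hypothesis hdir : forall l d, l \in L -> d <= 2 * w -> isd F (pred1 y) d l -> dirP l (d + c).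
Hypothesis hedge : forall l l' d, l \in L -> l' \in L -> w <= d -> d <= 2 * w ->
  isd F (pred1 l') d l -> edge l l' d.

Let q := canon F x y.
Let P i := nth x (x :: q) i.

(** Seeking the next landmark at positions i+w to i+2w-1 makes every skeleton edge at least w and at
    most 2w long; the lower bound is what allows settling in windows. The offset [c] is what remains
    to be travelled beyond [y]. *)
Lemma sk_chain i : i <= size q -> P i \in L -> sk (P i) (size q - i + c).
Proof.
have hs : shortest_path F x y q by exact: canonP hq.
have [k] := ubnP (size q - i); elim: k i => // k IH i; rewrite ltnS => le iq iL.
have ey : P (size q) = y by case: hs => [[_ e] _]; rewrite /P -last_nth.
have [h|h] := leqP (size q - i) (2 * w).
  apply: sk_dir; apply: hdir => //.
  by have := shortest_sub iq (leqnn _) hs; rewrite -/(P _) ey.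
have [|p [h1 h2 h3]] := @hit_pos _ _ w L x y q0 (i + w) w0 hL hq; first by rewrite -/q; lia.
have -> : size q - i + c = (p - i) + (size q - p + c) by rewrite -/q in h2 h3; lia.
apply: (@sk_edge _ (P p)); last by apply: IH => //; lia.
apply: hedge => //; try lia.
by apply: shortest_sub hs; lia.
Qed.

(** Either the whole path is within search depth 2w, or one of its positions 1 to w is a landmark,
    from which [sk_chain] goes on. *)
Lemma sk_entry : x != y -> 
  isd F (pred1 y) (size q) x /\ 0 < size q <= 2 * w \/
  exists l d, [/\ l \in L, 0 < d, d <= 2 * w, isd F (pred1 l) d x & sk l (size q - d + c)] /\ d <= size q.
Proof.
move=> xy; have hs : shortest_path F x y q by exact: canonP hq.
have q_gt0 : 0 < size q.
  by case: hs => [[_ e] _]; case: (q) e => //= e; rewrite e eqxx in xy.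
have [h|h] := leqP (size q) (2 * w).
  by left; split; [apply: shortest_isd | apply/andP].
right; have [|p [h1 h2 h3]] := @hit_pos _ _ w L x y q0 1 w0 hL hq; first by rewrite -/q; lia.
exists (P p), p; split; last by lia.
split=> //; try lia.
  have pq : p <= size q by lia.
  by have := shortest_sub (leq0n p) pq hs; rewrite subn0.
by apply: sk_chain => //; lia.
Qed.

End Skeleton.

(** * Routing options and the walks they trace *)

Section Options.
Variables (n : nat).
Implicit Types P : 'I_n -> nat -> Prop.

(* A node's options: [P y z] offers a route of length at most z via the out-neighbour y. *)
Definition best_val P : option nat :=
  if excluded_middle_informative (exists z y, P y z) then
    Some (epsilon (inhabits 0) (least (fun z => exists y, P y z)))
  else None.

Definition best_succ P : option 'I_n :=
  [pick y | asb (exists z, best_val P = Some z /\ P y z)].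

Lemma best_some P z : best_val P = Some z ->
  least (fun z => exists y, P y z) z /\ exists2 y, best_succ P = Some y & P y z.
Proof.
move=> E; have le : least (fun z => exists y, P y z) z.
  move: E; rewrite /best_val; case: excluded_middle_informative => // -[z1 h1] [<-].
  by apply: epsilon_spec; have [m hm _] := least_ex (P := fun z => exists y, P y z) h1; exists m.
split=> //; case: le => -[y hy] _; rewrite /best_succ E.
case: pickP => [y' /asbP[z2 [[<-] h]]|/(_ y)/asbP[]]; first by exists y'.
by exists z.
Qed.

Lemma best_le P y z : P y z -> exists2 z', best_val P = Some z' & z' <= z.
Proof.
move=> h; case E: (best_val P) => [z'|].
  by exists z' => //; have [[_ mn] _] := best_some E; apply: mn; exists y.
by move: E; rewrite /best_val; case: excluded_middle_informative => // -[]; exists z, y.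
Qed.

Variables (F : rel 'I_n) (s t : 'I_n) (opt : 'I_n -> 'I_n -> nat -> Prop).
Hypothesis opt_desc : forall x y z, x != t -> opt x y z ->
  [/\ F x y, 0 < z & y = t \/ exists y' z', opt y y' z' /\ z' < z].

(** The strict decrease of z bounds the number of steps, so the descent condition alone shows that z
    is at least the length of a real walk; options away from [s] may overestimate. *)
Lemma follow x z : x != t -> best_val (opt x) = Some z ->
  exists q, [/\ dwalk F x t q, size q <= z &
    forall j, j < size q -> best_succ (opt (nth x (x :: q) j)) = Some (nth x q j)].
Proof.
have [k] := ubnP z; elim: k x z => // k IH x z; rewrite ltnS => zk xt E.
have [_ [y es hy]] := best_some E.
have [e z0 [yt|[y' [z' [h lt]]]]] := opt_desc xt hy.
  exists [:: y]; split=> //; last by case.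
  by split=> //=; rewrite e.
have [yt|yt] := eqVneq y t.
  exists [:: y]; split=> //; last by case.
  by split=> //=; rewrite e.
have [z2 E2 le2] := best_le h.
have [|q [[h1 h2] h3 h4]] := IH y z2 _ yt E2; first by lia.
exists (y :: q); split=> /=; [by split=> //=; rewrite e | by lia |].
case=> [_|j] //=; rewrite ltnS => jq.
have jq' : j < size (y :: q) by apply: ltnW.
by rewrite (set_nth_default y x jq') (set_nth_default y x jq) h4.
Qed.

Hypothesis st : s != t.
Hypothesis opt_compl : forall q, dwalk F s t q -> exists y z, opt s y z /\ z <= size q.

(** Squeeze: following yields a walk no longer than the best value at [s], and completeness makes
    that value at most the length of any walk. *)
Lemma follow_correct :
  dist_is F s t (best_val (opt s)) /\
  ((forall q, ~ dwalk F s t q) \/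
   exists q, shortest_path F s t q /\
     forall j, j < size q -> best_succ (opt (nth s (s :: q) j)) = Some (nth s q j)).
Proof.
case E: (best_val (opt s)) => [z|]; last first.
  have none q : ~ dwalk F s t q.
    by move=> /opt_compl [y [z [h _]]]; have [z' E' _] := best_le h; rewrite E' in E.
  by split=> //; left.
have [q [h1 h2 h3]] := follow st E.
have mn q' : dwalk F s t q' -> z <= size q'.
  by move=> /opt_compl[y [z' [h le]]]; have [z2 E2 le2] := best_le h; move: E2; rewrite E => -[->]; lia.
have ez : size q = z by apply/eqP; rewrite eqn_leq h2 mn.
split; first by split=> //; exists q.
by right; exists q; split=> //; split=> // q' /mn; rewrite ez.
Qed.

End Options.

(** * Distances to a single target *)

Section SsspProgram.
Variables (n : nat) (v : 'I_n) (Dl w k : nat) (L : {set 'I_n}) (t : 'I_n).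
Notation B := 'I_(base n).
Implicit Types (sg : {set 'I_n * B}) (Q : {set 'I_n}) (Pub : {set 'I_n * 'I_n * B}).

Definition unset sg (l : 'I_n) : bool := [forall m, (l, m) \notin sg].

(** [ed] is a parameter because a communicating window uses the out-edges each landmark knows by
    itself, a silent one the published edges. *)
Definition reachable_val (ed : 'I_n -> B -> bool) (Dir sg : {set 'I_n * B}) (l : 'I_n) (m : B) : bool :=
  ((l, m) \in Dir) ||
  [exists p : 'I_n * B, [exists d : B, [&& p \in sg, ed p.1 d & val m == val d + val p.2]]].

Definition settles ed Dir sg (tau : nat) (p : 'I_n * B) : bool :=
  [&& p.1 \in L, unset sg p.1, val p.2 < tau, reachable_val ed Dir sg p.1 p.2 &
      [forall m, reachable_val ed Dir sg p.1 m ==> (p.2 <= m)]].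

Definition in_edges (Din : 'I_n -> nat -> bool) sg : {set 'I_n * B} :=
  [set p : 'I_n * B | [&& p.1 \in L, unset sg p.1, w <= p.2 & Din p.1 p.2]].

(** The second broadcast is separate because a landmark with no remaining in-edge publishes an empty
    set and still has to enter [Q]. *)
Definition publish (Din : 'I_n -> nat -> bool) sg Pub Q
    (kk : {set 'I_n * 'I_n * B} -> {set 'I_n} -> prog) : prog :=
  let mine := in_edges Din sg in
  let go := [&& v \in L, v \notin Q & #|mine| <= k] in
  bcast n Dl (if go then [set q : 'I_n * 'I_n * B | (q.1.2 == v) && ((q.1.1, q.2) \in mine)] else set0)
    (fun Z => bcast n Dl (if go then [set v] else set0) (fun Y => kk (Pub :|: Z) (Q :|: Y))).

Definition costly (Dout : 'I_n -> nat -> bool) Dir sg tau (kk : {set 'I_n * B} -> prog) : prog :=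
  bcast n Dl [set p : 'I_n * B | (p.1 == v) &&
                settles (fun y d => [&& y \in L, w <= d & Dout y d]) Dir sg tau p]
    (fun Z => kk (sg :|: Z)).

(* Landmarks are settled in windows of width w; as skeleton edges have length
   at least w, a window only depends on the previous ones. A window needs
   communication only if some settled landmark is not yet published, hence has
   more than k unsettled in-neighbours, all of which settle in two windows. *)
Fixpoint sssp_loop (Dout Din : 'I_n -> nat -> bool) Dir (f tau : nat) sg Pub Q
    (kk : {set 'I_n * B} -> prog) : prog :=
  if f is f'.+1 then
    if n <= tau then kk sg
    else if [exists p in sg, p.1 \notin Q] then
      costly Dout Dir sg (tau + w) (fun sg1 => costly Dout Dir sg1 (tau + w + w) (fun sg2 =>
        publish Din sg2 Pub Q (fun Pub' Q' =>
          sssp_loop Dout Din Dir f' (tau + w + w) sg2 Pub' Q' kk)))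
    else sssp_loop Dout Din Dir f' (tau + w)
      (sg :|: [set p | settles (fun y d => (p.1, y, d) \in Pub) Dir sg (tau + w) p]) Pub Q kk
  else kk sg.

Definition sssp_opt (Dout : 'I_n -> nat -> bool) (PP : 'I_n -> option 'I_n) sg
    (y : 'I_n) (z : nat) : Prop :=
  exists l d m, [/\ PP l = Some y, 0 < d, Dout l d, z = d + m &
    (l = t /\ m = 0) \/ exists2 m' : B, (l, m') \in sg & m = m'].

Definition sssp (outF inF : pred 'I_n) (kont : ('I_n -> nat -> Prop) -> prog) : prog :=
  mbfs (2 * w) #|t |: L| outF v (v \in t |: L) (fun Dout PP =>
  mbfs (2 * w) #|t |: L| inF v (v \in t |: L) (fun Din _ =>
  bcast n Dl [set p : 'I_n * B | [&& p.1 == v, v \in L & Dout t p.2]] (fun Dir =>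
  publish Din set0 set0 set0 (fun Pub Q =>
  sssp_loop Dout Din Dir n 0 set0 Pub Q (fun sg => kont (sssp_opt Dout PP sg)))))).

End SsspProgram.

Lemma rch_rev n (F : rel 'I_n) x y k :
  rch (fun a b => F b a) (pred1 y) k x -> rch F (pred1 x) k y.
Proof.
elim: k x => [|k IH] x /=; first by rewrite eq_sym.
case/orP=> [/IH->//|/existsP[u /andP[e /IH hu]]].
have h1 : rch F (pred1 x) 1 u by apply: (@rch_step _ _ _ 0 u x) => //=.
by have := rch_trans h1 hu; rewrite addn1.
Qed.

Lemma isd_rev n (F : rel 'I_n) x y d :
  isd (fun a b => F b a) (pred1 y) d x = isd F (pred1 x) d y.
Proof.
have e k : rch (fun a b => F b a) (pred1 y) k x = rch F (pred1 x) k y.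
  by apply/idP/idP => /rch_rev.
by rewrite /isd !e.
Qed.

Lemma bigcup_own n (X : finType) (Q : 'I_n -> pred ('I_n * X)) :
  \bigcup_v [set p : 'I_n * X | (p.1 == v) && Q v p] = [set p | Q p.1 p].
Proof.
apply/setP => p; rewrite inE; apply/bigcupP/idP => [[v _]|h].
  by rewrite inE => /andP[/eqP ->].
by exists p.1 => //; rewrite inE eqxx.
Qed.

(** * Settling skeleton distances window by window *)

Section Settle.
Variables (n : nat) (w : nat) (L : {set 'I_n}) (t : 'I_n) (F : rel 'I_n).
Notation B := 'I_(base n).
Hypotheses (w0 : 0 < w) (wb : n + 2 * w <= base n).

Definition skedge (l y : 'I_n) (d : nat) : bool :=
  [&& l \in L, y \in L, w <= d, d <= 2 * w & isd F (pred1 y) d l].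

Definition skdir (l : 'I_n) (m : nat) : bool :=
  [&& l \in L, m <= 2 * w & isd F (pred1 t) m l].

Notation sk := (sk skdir skedge).

Definition settled (sg : {set 'I_n * B}) (tau : nat) : Prop :=
  forall l (m : B), (l, m) \in sg <-> least (sk l) m /\ m < tau.

Lemma sk_in l m : sk l m -> l \in L.
Proof. by case=> [l' m' /and3P[]|l' y d m' /and5P[]]. Qed.

Lemma sk_inv l m : sk l m ->
  skdir l m \/ exists y d m', [/\ m = d + m', skedge l y d & sk y m'].
Proof. by case=> [l' m' h|l' y d m' h h']; [left | right; exists y, d, m']. Qed.

Lemma not_unset (sg : {set 'I_n * B}) (l : 'I_n) : ~~ unset sg l -> exists m, (l, m) \in sg.
Proof. by rewrite negb_forall => /existsP[m]; rewrite negbK; exists m. Qed.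

Section Step.
Variables (sg Dir : {set 'I_n * B}) (tau : nat) (ed : 'I_n -> 'I_n -> B -> bool).
Hypotheses (hs : settled sg tau) (tb : tau + w <= base n).
Hypothesis hDir : forall l (m : B), ((l, m) \in Dir) = skdir l m.
Hypothesis hed : forall l y m d, l \in L -> unset sg l -> (y, m) \in sg -> ed l y d = skedge l y d.

Let R l := reachable_val (ed l) Dir sg l.

Lemma reachable_sk l m : l \in L -> unset sg l -> R l m -> sk l m.
Proof.
move=> lL hu /orP[|/existsP[[y m'] /existsP[d /and3P[h1 h2 /eqP ->]]]].
  by rewrite hDir; apply: sk_dir.
rewrite (@hed l y m') // in h2; apply: sk_edge h2 _ => /=.
by have [[]] := (hs y m').1 h1.
Qed.

(** Skeleton edges have length at least w, so the successor of [l] on a least walk has a value below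
    tau and is settled already. The edge predicate is trusted only from unset landmarks into settled
    ones, which is what publication provides. *)
Lemma least_reachable l (m : B) : unset sg l -> least (sk l) m -> m < tau + w -> R l m.
Proof.
move=> hu [hm mn] lt; have lL := sk_in hm.
have tb' : tau <= base n by lia.
case: (sk_inv hm) => [h|[y [d [m' [e h h']]]]]; first by rewrite /R /reachable_val hDir h.
have /and5P[_ _ wd dw _] := h.
have [m2 hm2 le2] := least_ex h'.
have hy : sk l (d + m2) by apply: sk_edge h (proj1 hm2).
have := mn _ hy => le3; have em : m2 = m' by lia.
have m2b : m2 < base n by have := ltn_ord m; lia.
have db : d < base n by lia.
have hin : (y, Ordinal m2b) \in sg by apply/hs; split=> //=; lia.
apply/orP; right; apply/existsP; exists (y, Ordinal m2b); apply/existsP; exists (Ordinal db).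
by rewrite hin (hed (Ordinal db) lL hu hin) h /= em -e eqxx.
Qed.

Definition settle_all : {set 'I_n * B} :=
  [set p | settles L (ed p.1) Dir sg (tau + w) p].

Lemma settled_step : settled (sg :|: settle_all) (tau + w).
Proof.
have tb' : tau <= base n by lia.
move=> l m; rewrite !inE; split.
  case/orP=> [/hs [h lt]|/and5P[/= lL hu lt hr /forallP mn]]; first by split=> //; lia.
  split=> //; have hm := reachable_sk lL hu hr; split=> // m' /least_ex [m2 hm2 le2].
  apply: leq_trans le2; rewrite leqNgt; apply/negP => lt2.
  have m2b : m2 < base n by have := ltn_ord m; lia.
  have := mn (Ordinal m2b); rewrite -/(R l _) (@least_reachable l (Ordinal m2b)) //=; last by lia.
  by rewrite leqNgt lt2.
case=> hm lt; have [hin|hin] := boolP ((l, m) \in sg) => //=.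
have lL := sk_in (proj1 hm).
have hu : unset sg l.
  apply/negPn/negP => /not_unset[m' hm']; case/negP: hin.
  have [hm2 _] := (hs l m').1 hm'.
  by have /val_inj -> : val m = val m' by apply: least_inj hm hm2.
apply/and5P; split=> //=; first exact: least_reachable.
by apply/forallP => m'; apply/implyP => /(reachable_sk lL hu); apply: (proj2 hm).
Qed.

End Step.

Definition unsettled (sg : {set 'I_n * B}) : {set 'I_n} := [set l in L | unset sg l].

Lemma card_settle (sg T : {set 'I_n * B}) :
  (forall p, p \in T -> p.1 \in L /\ unset sg p.1) ->
  (forall l m m', (l, m) \in T -> (l, m') \in T -> m = m') ->
  #|unsettled (sg :|: T)| + #|T| = #|unsettled sg|.
Proof.
move=> h1 h2.
have inj : {in T &, injective (fun p => p.1)}.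
  by move=> [l m] [l' m'] /= a b e; move: b; rewrite -e => b; rewrite (h2 _ _ _ a b).
rewrite -(card_in_imset inj) -cardsUI.
have -> : unsettled (sg :|: T) :&: [set p.1 | p in T] = set0.
  apply/setP => l; rewrite !inE; apply/negP => /andP[/andP[_ /forallP h] /imsetP[[l' m] hT /= e]].
  by have := h m; rewrite inE e hT orbT.
rewrite cards0 addn0; apply: eq_card => l; rewrite !inE.
apply/orP/andP => [[/andP[lL /forallP h]|/imsetP[p hT ->]]|[lL hu]].
- by split=> //; apply/forallP => m; have := h m; rewrite inE negb_or => /andP[].
- exact: h1.
have [/existsP[m hm]|h] := boolP [exists m, (l, m) \in T].
  by right; apply/imsetP; exists (l, m).
left; rewrite lL; apply/forallP => m; rewrite inE negb_or (forallP hu m).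
by rewrite negb_exists in h; rewrite (forallP h m).
Qed.

End Settle.

Lemma leq_card_bigcup (I X : finType) (A : pred I) (S : I -> {set X}) :
  #|\bigcup_(i in A) S i| <= \sum_(i in A) #|S i|.
Proof.
elim/big_rec2: _ => [|i a b _ IH]; first by rewrite cards0.
by rewrite cardsU; lia.
Qed.

Section TokenCards.
Variable n : nat.
Notation B := 'I_(base n).

Lemma n_base : n < base n.
Proof. by rewrite /base; lia. Qed.

Lemma card_tok2 : #|{: 'I_n * B}| <= ntok n.
Proof.
rewrite card_prod !card_ord /ntok !expnS expn0 muln1 mulnA.
have := n_base; have : 0 < base n by []. nia.
Qed.

Lemma card_tok3 : #|{: 'I_n * 'I_n * B}| <= ntok n.
Proof.
rewrite !card_prod !card_ord /ntok !expnS expn0 muln1 mulnA leq_mul2r; apply/orP; right.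
by have := n_base; nia.
Qed.

Lemma card_tok1 : #|{: 'I_n}| <= ntok n.
Proof. by have := card_tok2; rewrite card_prod !card_ord /base; nia. Qed.

End TokenCards.

(** * Correctness and round bound of the single-target computation *)

Section SsspRule.
Variables (main : Input -> seq bool -> prog) (tl : nat -> nat).
Variables (n : nat) (E : rel 'I_n) (Post : ('I_n -> Output) -> Prop).
Variables (Dl w k : nat) (L : {set 'I_n}) (t : 'I_n) (F : rel 'I_n).
Notation B := 'I_(base n).
Notation ok := (ok main tl E Post).
Hypotheses (hD : diam_le E Dl) (hDb : Dl <= base n) (w0 : 0 < w) (wb : n + 2 * w <= base n).
Hypothesis FE : forall x y, F x y -> E x y.

Let Do v y d := [&& d <= 2 * w, y \in t |: L & isd F (pred1 y) d v].
Let Di v y d := [&& d <= 2 * w, y \in t |: L & isd F (pred1 v) d y].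
Let Dir : {set 'I_n * B} := [set p : 'I_n * B | skdir w L t F p.1 p.2].
Let ed0 (l y : 'I_n) (d : B) := [&& y \in L, w <= d & Do l y d].
Notation settled := (settled w L t F).
Notation skedge := (skedge w L F).

Lemma ed0E l y d : l \in L -> ed0 l y d = skedge l y d.
Proof.
move=> lL; rewrite /ed0 /Do /skedge lL /= !inE.
by case yL: (y \in L); rewrite ?orbT.
Qed.

Lemma ok_costly sg tau (kk : 'I_n -> {set 'I_n * B} -> prog) r :
  let T := settle_all w L sg Dir tau ed0 in
  ok (fun v => kk v (sg :|: T)) r ->
  ok (fun v => costly v Dl w L (Do v) Dir sg (tau + w) (kk v)) (8 * #|T| + 2 * Dl.+1 + r).
Proof.
move=> T h.
have eT := bigcup_own (fun v p => settles L (ed0 v) Dir sg (tau + w) p).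
rewrite /T /settle_all -eT.
apply: (@ok_bcast main tl n E _ Dl (fun v => [set p : 'I_n * B | (p.1 == v) &&
  settles L (ed0 v) Dir sg (tau + w) p]) hD hDb (card_tok2 n) Post (fun v Z => kk v (sg :|: Z)) r).
by rewrite eT.
Qed.

Let newly (sg : {set 'I_n * B}) (Q : {set 'I_n}) :=
  [set v in L | (v \notin Q) && (#|in_edges w L (Di v) sg| <= k)].
Let newpub sg Q : {set 'I_n * 'I_n * B} :=
  [set q | (q.1.2 \in newly sg Q) && ((q.1.1, q.2) \in in_edges w L (Di q.1.2) sg)].

Lemma card_newpub sg Q : #|newpub sg Q| <= k * #|newly sg Q|.
Proof.
apply: (@leq_trans #|\bigcup_(v in newly sg Q) [set (p.1, v, p.2) | p in in_edges w L (Di v) sg]|).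
  apply: subset_leq_card; apply/subsetP => -[[l v] d]; rewrite inE /= => /andP[h1 h2].
  by apply/bigcupP; exists v => //; apply/imsetP; exists (l, d).
apply: leq_trans (leq_card_bigcup _ _) _.
rewrite mulnC -sum_nat_const; apply: leq_sum => v; rewrite inE => /and3P[_ _ h].
by apply: leq_trans h; apply: leq_imset_card.
Qed.

(** Each newly published landmark pays for at most k in-edges and for its own name, hence the factor
    k+1. *)
Lemma ok_publish sg Pub Q (kk : 'I_n -> {set 'I_n * 'I_n * B} -> {set 'I_n} -> prog) r :
  ok (fun v => kk v (Pub :|: newpub sg Q) (Q :|: newly sg Q)) r ->
  ok (fun v => publish v Dl w k L (Di v) sg Pub Q (kk v))
     (8 * k.+1 * #|newly sg Q| + 4 * Dl.+1 + r).
Proof.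
move=> h; have go v : [&& v \in L, v \notin Q & #|in_edges w L (Di v) sg| <= k] = (v \in newly sg Q).
  by rewrite inE.
apply: (@ok_leq _ _ _ _ _ _ (8 * #|newpub sg Q| + 2 * Dl.+1 + (8 * #|newly sg Q| + 2 * Dl.+1 + r))).
  by have := card_newpub sg Q; lia.
have e1 : \bigcup_v (if v \in newly sg Q then
    [set q : 'I_n * 'I_n * B | (q.1.2 == v) && ((q.1.1, q.2) \in in_edges w L (Di v) sg)] else set0) = newpub sg Q.
  apply/setP => q; rewrite inE; apply/bigcupP/andP => [[v _]|[h1 h2]].
    by case: ifP => [hv|_]; [rewrite in_set => /andP[/eqP ->] | rewrite in_set0].
  by exists q.1.2 => //; rewrite h1 in_set eqxx.
have e2 : \bigcup_v (if v \in newly sg Q then [set v] else set0) = newly sg Q.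
  apply/setP => x; apply/bigcupP/idP => [[v _]|hx].
    by case: ifP => [hv|_]; rewrite ?in_set1 ?in_set0 // => /eqP ->.
  by exists x => //; rewrite hx in_set1.
have H := @ok_bcast main tl n E _ Dl
  (fun v => if v \in newly sg Q then
    [set q : 'I_n * 'I_n * B | (q.1.2 == v) && ((q.1.1, q.2) \in in_edges w L (Di v) sg)] else set0)
  hD hDb (card_tok3 n) Post (fun v Z => bcast n Dl (if v \in newly sg Q then [set v] else set0)
    (fun Y => kk v (Pub :|: Z) (Q :|: Y))) (8 * #|newly sg Q| + 2 * Dl.+1 + r).
rewrite e1 in H; apply: ok_ext (H _) => [v|]; first by rewrite /publish go.
have H2 := @ok_bcast main tl n E _ Dl (fun v => if v \in newly sg Q then [set v] else set0)
  hD hDb (card_tok1 n) Post (fun v Y => kk v (Pub :|: newpub sg Q) (Q :|: Y)) r.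
by rewrite e2 in H2; apply: H2.
Qed.

Lemma in_edgesE v sg p : v \in L -> (p \in in_edges w L (Di v) sg) = unset sg p.1 && skedge p.1 v p.2.
Proof.
move=> vL; rewrite inE /Di /skedge vL !inE /=.
by case pL: (p.1 \in L); rewrite ?orbT /= ?andbF.
Qed.

Lemma settled_unset sg tau sg' tau' l : tau <= tau' -> settled sg tau -> settled sg' tau' ->
  unset sg' l -> unset sg l.
Proof.
move=> le h h' /forallP hu; apply/forallP => m; apply: contra (hu m) => /h[h1 h2].
by apply/h'; split=> //; apply: leq_trans le.
Qed.

Lemma settle_cards sg tau ed : 
  #|unsettled L (sg :|: settle_all w L sg Dir tau ed)| + #|settle_all w L sg Dir tau ed| = #|unsettled L sg|.
Proof.
apply: card_settle => [p|l m m']; first by rewrite inE => /and5P[].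
rewrite !inE => /and5P[_ _ _ /= r1 /forallP m1] /and5P[_ _ _ /= r2 /forallP m2].
by apply: val_inj; apply/eqP; rewrite eqn_leq (implyP (m1 _) r2) (implyP (m2 _) r1).
Qed.

Lemma DirE l (m : B) : ((l, m) \in Dir) = skdir w L t F l m.
Proof. by rewrite inE. Qed.

Lemma settled_costly sg tau : tau + w <= base n -> settled sg tau ->
  settled (sg :|: settle_all w L sg Dir tau ed0) (tau + w).
Proof.
move=> tb h; apply: settled_step => // [l m|l y m d lL _ _]; first exact: DirE.
exact: ed0E.
Qed.

(** [v] has a value below tau and its in-edges have length at most 2w, so all its in-neighbours
    settle below tau + 2w. More than k of them were unset in the snapshot [sp]. *)
Lemma heavy_settle sg tau sp sg2 v (m : B) :
  settled sg tau -> tau + w + w <= base n -> settled sg2 (tau + w + w) -> 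
  (v, m) \in sg -> k < #|in_edges w L (Di v) sp| ->
  (forall l, unset sg2 l -> unset sp l) ->
  #|unsettled L sg2| + k.+1 <= #|unsettled L sp|.
Proof.
move=> hs tb hs2 vm kh sub.
have [[skv _] mt] := (hs v m).1 vm; have vL := sk_in skv.
set S := in_edges w L (Di v) sp in kh.
have inj : {in S &, injective (fun p => p.1)}.
  move=> [l d] [l' d'] /=; rewrite !in_edgesE //= => /andP[_ /and5P[_ _ _ _ h1]] + e.
  rewrite -e => /andP[_ /and5P[_ _ _ _ h2]]; congr pair; apply: val_inj; exact: isd_inj h1 h2.
apply: leq_trans (_ : #|unsettled L sg2| + #|[set p.1 | p in S]| <= _).
  by rewrite leq_add2l (card_in_imset inj).
rewrite -cardsUI (_ : _ :&: _ = set0) ?cards0 ?addn0.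
  apply: subset_leq_card; apply/subsetP => l; rewrite !inE => /orP[/andP[lL /sub ->]|]; first by rewrite lL.
  by case/imsetP => -[l' d]; rewrite in_edgesE //= => /andP[hu /and5P[lL _ _ _ _]] ->; rewrite lL.
apply/setP => l; rewrite !inE; apply/negP => /andP[/andP[_ /forallP hu] /imsetP[[l' d] hS /= e]].
move: hS; rewrite -e in_edgesE //= => /andP[_ he]; have /and5P[_ _ _ d2 _] := he.
have [m' hm' le] := least_ex (sk_edge he skv).
have m'b : m' < base n by lia.
by have /negP := hu (Ordinal m'b); apply; apply/hs2; split=> //=; lia.
Qed.

(** [sp] is the settled set at the last publication, when every landmark outside [Q] was too heavy
    to publish. Three budgets: 8 rounds per landmark settled, 8(k+1) per landmark published, and
    8(Dl+1) per communicating step; by [heavy_settle] at most #|unsettled L sp| / (k+1) such steps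
    remain. *)
Lemma ok_loop f tau sg (Pub : {set 'I_n * 'I_n * B}) (Q : {set 'I_n}) (sp : {set 'I_n * B}) (kk : 'I_n -> {set 'I_n * B} -> prog) r :
  n - tau <= f -> settled sg tau ->
  (forall l v d, (l, v, d) \in Pub -> skedge l v d) ->
  (forall v l (d : B), v \in Q -> unset sg l -> skedge l v d -> (l, v, d) \in Pub) ->
  (forall l, unset sg l -> unset sp l) ->
  (forall v, v \in L -> v \notin Q -> k < #|in_edges w L (Di v) sp|) ->
  (forall sg' tau', n <= tau' -> settled sg' tau' -> ok (fun v => kk v sg') r) ->
  ok (fun v => sssp_loop v Dl w k L (Do v) (Di v) Dir f tau sg Pub Q (kk v))
     (8 * #|unsettled L sg| + 8 * k.+1 * #|L :\: Q| + (#|unsettled L sp| %/ k.+1) * (8 * Dl.+1) + r).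
Proof.
move=> hf hs p1 p2 hsub hh hk.
elim: f tau sg Pub Q sp hf hs p1 p2 hsub hh => [|f IH] tau sg Pub Q sp hf hs p1 p2 hsub hh.
  apply: (@ok_leq _ _ _ _ _ _ r); first exact: leq_addl.
  by apply: (hk sg tau) => //; lia.
have [nt|tn] := leqP n tau.
  apply: (@ok_leq _ _ _ _ _ _ r); first exact: leq_addl.
  by apply: ok_ext (hk sg tau nt hs) => v; rewrite /= nt.
have [trig|ntrig] := boolP [exists p in sg, p.1 \notin Q]; last first.
  (* Silent window: every settled landmark is in [Q], so the published edges agree with the true
     ones wherever [settled_step] looks. *)
  have hs' : settled (sg :|: settle_all w L sg Dir tau (fun l y d => (l, y, d) \in Pub)) (tau + w).
    apply: settled_step => // [|l m|l y m d lL hu hy]; [by lia | exact: DirE |].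
    apply/idP/idP => [/p1 //|hed]; apply: p2 => //.
    rewrite negb_exists in ntrig; have := forallP ntrig (y, m); rewrite hy /=.
    by rewrite negbK.
  apply: (@ok_leq _ _ _ _ _ _ (8 * #|unsettled L (sg :|: settle_all w L sg Dir tau (fun l y d => (l, y, d) \in Pub))| + 8 * k.+1 * #|L :\: Q| + (#|unsettled L sp| %/ k.+1) * (8 * Dl.+1) + r)).
    by have := settle_cards sg tau (fun l y d => (l, y, d) \in Pub); lia.
  apply: ok_ext (IH (tau + w) _ Pub Q sp _ hs' p1 _ _ hh) => [v||v l d vQ hu|l hu].
  - by rewrite /= leqNgt tn (negbTE ntrig).
  - by lia.
  - by apply: p2 => //; apply: settled_unset hs hs' hu; lia.
  - by apply: hsub; apply: settled_unset hs hs' hu; lia.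
set T1 := settle_all w L sg Dir tau ed0.
have tb1 : tau + w <= base n by lia.
have hs1 : settled (sg :|: T1) (tau + w) by apply: settled_costly.
set sg1 := sg :|: T1 in hs1.
set T2 := settle_all w L sg1 Dir (tau + w) ed0.
have tb2 : tau + w + w <= base n by lia.
have hs2 : settled (sg1 :|: T2) (tau + w + w) by apply: settled_costly.
set sg2 := sg1 :|: T2 in hs2.
have c1 : #|unsettled L sg1| + #|T1| = #|unsettled L sg| by apply: settle_cards.
have c2 : #|unsettled L sg2| + #|T2| = #|unsettled L sg1| by apply: settle_cards.
have sub2 l : unset sg2 l -> unset sg l by apply: settled_unset hs hs2; lia.
have heavy : #|unsettled L sg2| + k.+1 <= #|unsettled L sp|.
  case/existsP: trig => -[v m] /= /andP[vm vQ].
  have vL : v \in L by have [[h _] _] := (hs v m).1 vm; apply: sk_in h.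
  by apply: (heavy_settle hs tb2 hs2 vm (hh v vL vQ)) => l /sub2/hsub.
have hdiv : (#|unsettled L sg2| %/ k.+1).+1 <= #|unsettled L sp| %/ k.+1.
  by apply: leq_trans (leq_div2r k.+1 heavy); rewrite divnDr // divnn /= addn1.
have cN : #|L :\: (Q :|: newly sg2 Q)| + #|newly sg2 Q| = #|L :\: Q|.
  rewrite -setDDl -(cardsID (newly sg2 Q) (L :\: Q)) addnC; congr (_ + _).
  apply: eq_card => v; rewrite !inE; case: (v \in L); case: (v \in Q) => //=.
apply: (@ok_leq _ _ _ _ _ _ (8 * #|T1| + 2 * Dl.+1 + (8 * #|T2| + 2 * Dl.+1 +
  (8 * k.+1 * #|newly sg2 Q| + 4 * Dl.+1 +
  (8 * #|unsettled L sg2| + 8 * k.+1 * #|L :\: (Q :|: newly sg2 Q)| + (#|unsettled L sg2| %/ k.+1) * (8 * Dl.+1) + r))))).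
  by rewrite -cN; nia.
apply: ok_ext (ok_costly (sg := sg) (tau := tau) (kk := fun v sg1 =>
  costly v Dl w L (Do v) Dir sg1 (tau + w + w) (fun sg2 =>
        publish v Dl w k L (Di v) sg2 Pub Q (fun Pub' Q' =>
          sssp_loop v Dl w k L (Do v) (Di v) Dir f (tau + w + w) sg2 Pub' Q' (kk v)))) _).
  by move=> v; rewrite /= leqNgt tn trig.
apply: ok_costly; apply: ok_publish.
apply: IH => //; first by lia.
- move=> l v d; rewrite inE => /orP[/p1 //|]; rewrite inE /= => /andP[].
  by rewrite inE => /andP[vL _]; rewrite in_edgesE // => /andP[].
- move=> v l d; rewrite inE => /orP[vQ|vN] hu he; rewrite inE.
    by rewrite (p2 v) //; apply: sub2.
  apply/orP; right; rewrite inE /= vN in_edgesE /= ?hu ?he //.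
  by move: vN; rewrite inE => /andP[].
- move=> v vL; rewrite inE negb_or => /andP[vQ]; rewrite inE vL vQ /= -ltnNge //.
Qed.

Section SsspOptions.
Variables (PP : 'I_n -> 'I_n -> option 'I_n) (sg : {set 'I_n * B}) (tau : nat).
Hypothesis PPE : forall x l d, l \in t |: L -> d < 2 * w -> isd F (pred1 l) d.+1 x ->
  exists u, [/\ PP x l = Some u, F x u & isd F (pred1 l) d u].
Hypotheses (nt : n <= tau) (hs : settled sg tau).

Lemma LtL l : l \in L -> l \in t |: L.
Proof. by move=> h; rewrite in_setU h orbT. Qed.

(** While d > 1 the walk keeps heading for [l]. At d = 1 the next node is [l] itself, whose least
    value comes either from a direct route to [t] or from a skeleton edge into a settled
    landmark. *)
Lemma sssp_opt_desc x y z : x != t -> sssp_opt t (Do x) (PP x) sg y z ->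
  [/\ F x y, 0 < z & y = t \/ exists y' z', sssp_opt t (Do y) (PP y) sg y' z' /\ z' < z].
Proof.
have tL : t \in t |: L by exact: setU11.
move=> xt.
case=> l [d [m [hP d0 /and3P[d2 lt hd] -> hm]]].
case: d d0 d2 hd => // d _ d2 hd.
have [u [hu1 hu2 hu3]] := @PPE x l d lt d2 hd.
move: hu1; rewrite hP => -[eu]; rewrite -eu {u eu} in hu2 hu3.
split=> //; have [yt|yt] := eqVneq y t; first by left.
right; case: d d2 hd hu3 => [|d] d2 hd hu3; last first.
  have [u [h1 h2 h3]] := @PPE y l d lt (ltnW d2) hu3.
  exists u, (d.+1 + m); split; last by slia.
  by exists l, d.+1, m; split=> //; apply/and3P; split=> //; apply: ltnW.
have yl : y = l by apply/eqP; case/andP: hu3.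
case: hm => [[lt' _]|[m' lm em]]; first by rewrite yl lt' eqxx in yt.
have [[skl mn] mt] := (hs l m').1 lm; rewrite -yl in skl mn.
case: (sk_inv skl) => [/and3P[yL m2 ht]|[y2 [d2' [m2 [e he hsk2]]]]].
  have m0 : 0 < m'.
    rewrite lt0n; apply/negP => /eqP e0; move: ht; rewrite e0 => /andP[/= /eqP yt' _].
    by rewrite yt' eqxx in yt.
  case: (nat_of_ord m') m0 m2 ht em => // m1 _ m2 ht em.
  have [u [h1 h2 h3]] := @PPE y t m1 tL m2 ht.
  exists u, (m1.+1 + 0); split; last by slia.
  by exists t, m1.+1, 0; split=> //; [apply/and3P | left].
have /and5P[yL y2L wd d2w hd2] := he.
(* Minimality of the value of [y] forces the tail m2 to be the skeleton distance of [y2], so it is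
   settled too. *)
have [m3 hm3 le3] := least_ex hsk2.
have := mn _ (sk_edge he (proj1 hm3)) => le4; have e3 : m3 = m2 by slia.
case: d2' he wd d2w hd2 e le4 => [|d2'] he wd d2w hd2 e le4; first by slia.
have [u [h1 h2 h3]] := @PPE y y2 d2' (LtL y2L) d2w hd2.
have m3b : m3 < base n by have := ltn_ord m'; slia.
exists u, (d2'.+1 + m3); split; last by slia.
exists y2, d2'.+1, m3; split=> //; first by apply/and3P; split=> //; apply: LtL.
by right; exists (Ordinal m3b) => //; apply/hs; split=> //=; slia.
Qed.

(** The canonical path has fewer than n <= tau edges, so the value of the first landmark met on it
    has been settled. *)
Lemma sssp_opt_compl s q : hit F w L -> s != t -> dwalk F s t q ->
  exists y z, sssp_opt t (Do s) (PP s) sg y z /\ z <= size q.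
Proof.
move=> hL st hq; have tL : t \in t |: L by exact: setU11.
have hc := canonP hq; have cq : size (canon F s t) <= size q by case: hc => _; apply.
have cn : size (canon F s t) < n by apply: isd_lt (shortest_isd hc).
have := @sk_entry n (skdir w L t F) skedge F w L 0 s t q w0 hL hq.
case=> //.
- by move=> l d lL d2 hd; rewrite addn0; apply/and3P.
- by move=> l l' d lL l'L wd d2 hd; apply/and5P.
- case=> hd /andP[d0 d2].
  case: (size (canon F s t)) d0 d2 hd cq cn => // d _ d2 hd cq cn.
  have [u [h1 h2 h3]] := @PPE s t d tL d2 hd.
  exists u, (d.+1 + 0); split; last by slia.
  by exists t, d.+1, 0; split=> //; [apply/and3P | left].
case=> l [d [[lL d0 d2 hd hsk] le]].
have [m hm le2] := least_ex hsk.
case: d d0 d2 hd hsk le le2 => // d _ d2 hd hsk le le2.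
have [u [h1 h2 h3]] := @PPE s l d (LtL lL) d2 hd.
exists u, (d.+1 + m); split; last by slia.
have mb : m < base n by slia.
exists l, d.+1, m; split=> //; first by apply/and3P; split=> //; apply: LtL.
by right; exists (Ordinal mb) => //; apply/hs; split=> //=; slia.
Qed.

End SsspOptions.

(** Of the 18 rounds per landmark two belong to the two searches, eight to the broadcast of [Dir]
    and eight to settling. *)
Lemma ok_sssp s (kont : 'I_n -> ('I_n -> nat -> Prop) -> prog) r :
  hit F w L -> s != t ->
  (forall opt : 'I_n -> 'I_n -> nat -> Prop,
     (forall x y z, x != t -> opt x y z ->
        [/\ F x y, 0 < z & y = t \/ exists y' z', opt y y' z' /\ z' < z]) ->
     (forall q, dwalk F s t q -> exists y z, opt s y z /\ z <= size q) ->
     ok (fun v => kont v (opt v)) r) ->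
  ok (fun v => sssp v Dl w k L t (F v) (fun u => F u v) (kont v))
     (4 * w + 18 * #|L| + 6 + 8 * k.+1 * #|L| + 6 * Dl.+1 + (#|L| %/ k.+1) * (8 * Dl.+1) + r).
Proof.
move=> hL st hk.
have cL : #|t |: L| <= #|L|.+1 by rewrite cardsU1; case: (t \notin L).
have lb : 2 * w <= base n by lia.
pose R1 := 8 * #|L| + 8 * k.+1 * #|L| + (#|L| %/ k.+1) * (8 * Dl.+1) + r.
apply: (@ok_leq _ _ _ _ _ _ ((2 * w + #|t |: L|).+1 + ((2 * w + #|t |: L|).+1 +
  (8 * #|L| + 2 * Dl.+1 + (4 * Dl.+1 + R1))))); first by rewrite /R1; lia.
pose loop v Dout Din Dr P Q PP := sssp_loop v Dl w k L Dout Din Dr n 0 set0 P Q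
  (fun sg => kont v (sssp_opt t Dout PP sg)).
pose pubs v Dout Din PP Dr := publish v Dl w k L Din set0 set0 set0 (fun P Q => loop v Dout Din Dr P Q PP).
pose dirs v (Dout Din : 'I_n -> nat -> bool) PP := bcast n Dl [set p : 'I_n * B | [&& p.1 == v, v \in L & Dout t p.2]] (pubs v Dout Din PP).
have H1 := @ok_mbfs main tl n E Post (2 * w) #|t |: L| (fun v => F v) (t |: L)
  (fun v Dout PP => mbfs (2 * w) #|t |: L| (fun u => F u v) v (v \in t |: L) (fun Din _ => dirs v Dout Din PP)).
apply: H1 => // PP hPP.
have e1 : (fun v u => uadj E u v && F v u) =2 F.
  by move=> v u; case h: (F v u); rewrite ?andbF // /uadj (FE h) orbT.
have H2 := @ok_mbfs main tl n E Post (2 * w) #|t |: L| (fun v u => F u v) (t |: L)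
  (fun v Din _ => dirs v (Do v) Din (PP v)).
apply: ok_ext (H2 _ lb (leqnn _) _) => [v|PP' _].
  congr (mbfs _ _ _ _ _ _); apply: functional_extensionality => Din; apply: functional_extensionality => PP'.
  congr (dirs v _ _ _); apply: functional_extensionality => y; apply: functional_extensionality => d.
  by rewrite /Do (eq_isd e1 (frefl _)).
have e2 : (fun v u => uadj E u v && F u v) =2 (fun v u => F u v).
  by move=> v u; case h: (F u v); rewrite ?andbF // /uadj (FE h).
have eDir : \bigcup_v [set p : 'I_n * B | [&& p.1 == v, v \in L & Do v t p.2]] = Dir.
  rewrite (bigcup_own (fun v (p : 'I_n * B) => (v \in L) && Do v t p.2)).
  by apply/setP => p; rewrite !in_set /Do /skdir setU11.
have Dir_le : #|Dir| <= #|L|.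
  have inj : {in Dir &, injective (fun p => p.1)}.
    move=> [l d] [l' d'] /=; rewrite !in_set /= => /and3P[_ _ h1] + e.
    rewrite -e => /and3P[_ _ h2]; congr pair; apply: val_inj; exact: isd_inj h1 h2.
  rewrite -(card_in_imset inj); apply: subset_leq_card; apply/subsetP => l /imsetP[[l' d]].
  by rewrite in_set => /and3P[lL _ _] ->.
apply: (@ok_leq _ _ _ _ _ _ (8 * #|Dir| + 2 * Dl.+1 + (4 * Dl.+1 + R1))); first by lia.
have H3 := @ok_bcast main tl n E _ Dl (fun v => [set p : 'I_n * B | [&& p.1 == v, v \in L & Do v t p.2]])
  hD hDb (card_tok2 n) Post (fun v => pubs v (Do v) (Di v) (PP v)) (4 * Dl.+1 + R1).
rewrite eDir in H3; apply: ok_ext (H3 _) => [v|].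
  rewrite /dirs; congr (bcast _ _ _ (pubs v _ _ _)).
  apply: functional_extensionality => y; apply: functional_extensionality => d.
  by rewrite /Di (eq_isd e2 (frefl _)) isd_rev.
pose N := newly set0 set0.
apply: (@ok_leq _ _ _ _ _ _ (8 * k.+1 * #|N| + 4 * Dl.+1 + (8 * #|L| + 8 * k.+1 * #|L :\: N| + (#|L| %/ k.+1) * (8 * Dl.+1) + r))).
  have : #|L :\: N| + #|N| = #|L|.
    rewrite -(cardsID N L) addnC; congr (_ + _); apply: eq_card => v; rewrite !in_set.
    by case: (v \in L).
  by rewrite /R1 => <-; nia.
apply: ok_publish; rewrite !set0U -/N /loop.
have us l : unset (set0 : {set 'I_n * B}) l by apply/forallP => m; rewrite in_set0.
have cu : #|unsettled L (set0 : {set 'I_n * B})| = #|L|.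
  by apply: eq_card => l; rewrite in_set us andbT.
have hs0 : settled set0 0 by move=> l m; rewrite in_set0; split=> // -[].
have H4 := @ok_loop n 0 set0 (newpub set0 set0) N set0 (fun v sg => kont v (sssp_opt t (Do v) (PP v) sg)) r.
rewrite cu in H4; apply: H4 => //.
- by rewrite subn0.
- by move=> l v d; rewrite in_set /= => /andP[]; rewrite in_set => /andP[vL _]; rewrite in_edgesE // => /andP[].
- move=> v l d vN _ he; rewrite in_set /= vN in_edgesE /= ?us ?he //.
  by move: vN; rewrite in_set => /andP[].
- by move=> v vL; rewrite in_set vL in_set0 /= -ltnNge.
move=> sg tau nt hs.
have PPE x l d : l \in t |: L -> d < 2 * w -> isd F (pred1 l) d.+1 x ->
    exists u, [/\ PP x l = Some u, F x u & isd F (pred1 l) d u].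
  rewrite -(eq_isd e1 (frefl _)) => lt d2 /(hPP x l d lt d2)[u [h1 h2 h3]].
  by exists u; split=> //; [rewrite -e1 | rewrite -(eq_isd e1 (frefl _))].
apply: hk => [x y z|q hq]; first by move=> xt; have := sssp_opt_desc PPE nt hs xt; apply.
exact: (sssp_opt_compl PPE nt hs hL st hq).
Qed.

End SsspRule.

(** * All replacement paths at once *)

(* Bitwise search for the minimum, over all nodes, of the values [mine i c]. *)
Fixpoint aggmin n (Dl f : nat) (cur : 'I_n -> nat) (mine : 'I_n -> nat -> Prop)
    (kk : ('I_n -> nat) -> {set 'I_n} -> prog) : prog :=
  if f is f'.+1 then
    bcast n Dl [set i : 'I_n | asb (exists2 c, mine i c & c < cur i + 2 ^ f')] (fun T =>
      aggmin Dl f' (fun i => if i \in T then cur i else cur i + 2 ^ f') mine kk)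
  else bcast n Dl [set i : 'I_n | asb (mine i (cur i))] (fun T => kk cur T).

Lemma card_ord_lt n (A : {set 'I_n}) m : (forall i, i \in A -> i < m) -> #|A| <= m.
Proof.
move=> hA; rewrite cardE -(size_map val) -[X in _ <= X](size_iota 0).
apply: uniq_leq_size; first by rewrite map_inj_uniq ?enum_uniq //; apply: val_inj.
by move=> x /mapP[i]; rewrite mem_enum => /hA lt ->; rewrite mem_iota.
Qed.

Section AggRule.
Variables (main : Input -> seq bool -> prog) (tl : nat -> nat).
Variables (n : nat) (E : rel 'I_n) (Post : ('I_n -> Output) -> Prop).
Notation ok := (ok main tl E Post).
Variables (Dl h : nat) (mine : 'I_n -> 'I_n -> nat -> Prop).
Hypotheses (hD : diam_le E Dl) (hDb : Dl <= base n).
Hypothesis mine_lt : forall v i c, mine v i c -> i < h.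

Let U i c := exists v, mine v i c.

Lemma ok_bcast_idx (Q : 'I_n -> 'I_n -> Prop) (k : 'I_n -> {set 'I_n} -> prog) r :
  (forall v i, Q v i -> i < h) ->
  ok (fun v => k v [set i | asb (exists v, Q v i)]) r ->
  ok (fun v => bcast n Dl [set i | asb (Q v i)] (k v)) (8 * h + 2 * Dl.+1 + r).
Proof.
move=> hQ hk.
have e : \bigcup_v [set i | asb (Q v i)] = [set i | asb (exists v, Q v i)].
  apply/setP => i; rewrite inE; apply/bigcupP/asbP => [[v _]|[v hv]].
    by rewrite inE => /asbP; exists v.
  by exists v => //; rewrite inE; apply/asbP.
have cT : #|[set i : 'I_n | asb (exists v, Q v i)]| <= h.
  by apply: card_ord_lt => i; rewrite inE => /asbP[v /hQ].
have H := @ok_bcast main tl n E _ Dl (fun v => [set i | asb (Q v i)]) hD hDb (card_tok1 n) Post k r.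
rewrite e in H; apply: ok_leq (H hk); by rewrite !leq_add2r leq_mul2l cT.
Qed.

(** Invariant with f bits to go: [cur i] is at most every value at i, and if some value is below
    2^N, one is below cur i + 2^f. The last broadcast tells an attained minimum from an index
    without candidates. *)
Lemma ok_aggmin N (kk : 'I_n -> ('I_n -> nat) -> {set 'I_n} -> prog) r :
  (forall cur (T : {set 'I_n}),
     (forall i, i \in T -> U i (cur i)) -> (forall i c, U i c -> cur i <= c) ->
     (forall i c, U i c -> c < 2 ^ N -> i \in T) ->
     ok (fun v => kk v cur T) r) ->
  ok (fun v => aggmin Dl N (fun _ => 0) (mine v) (kk v)) (N.+1 * (8 * h + 2 * Dl.+1) + r).
Proof.
move=> hk.
suff H f cur : (forall i c, U i c -> cur i <= c) ->
    (forall i c, U i c -> c < 2 ^ N -> exists2 c', U i c' & c' < cur i + 2 ^ f) ->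
    ok (fun v => aggmin Dl f cur (mine v) (kk v)) (f.+1 * (8 * h + 2 * Dl.+1) + r).
  by apply: H => // i c hU lt; exists c.
elim: f cur => [|f IH] cur h1 h2.
  rewrite mul1n; apply: ok_bcast_idx => [v i|]; first exact: mine_lt.
  apply: hk => // [i|i c hU lt]; rewrite inE; first by move/asbP.
  have [c' hU' lt'] := h2 i c hU lt; apply/asbP.
  by have le := h1 _ _ hU'; have <- : c' = cur i by rewrite expn0 in lt'; lia.
rewrite mulSn -addnA; apply: (@ok_bcast_idx (fun v i => exists2 c, mine v i c & c < cur i + 2 ^ f)) => [v i [c hc _]|].
  exact: mine_lt hc.
apply: IH => [i c hU|i c hU lt]; rewrite inE.
  case: asbP => [_|nh]; first exact: h1.
  by rewrite leqNgt; apply/negP => lt; apply: nh; case: hU => v hv; exists v, c.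
case: asbP => [[v [c' hc lt']]|_]; first by exists c' => //; exists v.
by have [c' h3 h4] := h2 i c hU lt; exists c' => //; rewrite -addnA addnn -mul2n -expnS.
Qed.

End AggRule.

(** * Detours off the path: the program *)

Section PathProgram.
Variables (n : nat) (pv : nat -> 'I_n) (h : nat).
Notation B := 'I_(base n).

Definition path_edge (x y : 'I_n) : bool :=
  [exists i : 'I_h, (x == pv i) && (y == pv i.+1)].

Definition path_set : {set 'I_n} := [set pv i | i : 'I_h.+1].

Variables (v : 'I_n) (Dl w : nat) (L : {set 'I_n}).

(** For k > i the path from [pv k] on is intact; its length h - k is the offset [c] of the skeleton
    lemmas. *)
Definition det_dir (W : {set 'I_n * 'I_n * B}) (i : nat) (l : 'I_n) (m : nat) : Prop :=
  exists k (d : B), [/\ i < k, k <= h, (l, pv k, d) \in W & m = d + (h - k)].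

Definition det_edge (W : {set 'I_n * 'I_n * B}) (l y : 'I_n) (d : nat) : Prop :=
  exists2 d' : B, (l, y, d') \in W & [/\ y \in L, 0 < d & d = d'].

Definition det_opt (Dout : 'I_n -> nat -> bool) (PP : 'I_n -> option 'I_n) W (i : nat)
    (y : 'I_n) (z : nat) : Prop :=
  exists l d m, [/\ PP l = Some y, 0 < d, Dout l d, z = d + m &
    (l \in L /\ least (sk (det_dir W i) (det_edge W) l) m) \/
    exists k, [/\ i < k, k <= h, l = pv k & m = h - k]].

(* The detour for edge i may leave the path at j; z is the length of the rest. *)
Definition leave_val (det : nat -> 'I_n -> nat -> Prop) (i : 'I_n) (c : nat) : Prop :=
  exists j z, [/\ j <= i, i < h, v = pv j, best_val (det i) = Some z & c = (j + z) * n + j].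

(** The three stretches of a replacement path: detour, suffix after re-entry, prefix before leaving.
    The minimum [cur i'] unpacks into total length (quotient by n) and leaving position
    (remainder). *)
Definition all_opt (det : nat -> 'I_n -> nat -> Prop) (cur : 'I_n -> nat) (T : {set 'I_n})
    (i : nat) (y : 'I_n) (z : nat) : Prop :=
  [\/ det i y z,
      exists k, [/\ i < k, k < h, v = pv k, y = pv k.+1 & z = h - k] |
      exists (i' : 'I_n) j, [/\ val i' = i, i' \in T, j < cur i' %% n, v = pv j &
        y = pv j.+1 /\ z = cur i' %/ n - j]].

Definition rp_all (outE : pred 'I_n) (kont : (nat -> 'I_n -> nat -> Prop) -> prog) : prog :=
  mbfs (2 * w) #|L :|: path_set| (fun u => outE u && ~~ path_edge v u) v (v \in L :|: path_set)
    (fun Dout PP =>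
  bcast n Dl [set p : 'I_n * ('I_n * B) | [&& p.1 == v, v \in L & Dout p.2.1 p.2.2]] (fun W' =>
  let W := [set p : 'I_n * 'I_n * B | (p.1.1, (p.1.2, p.2)) \in W'] in
  let det := det_opt Dout PP W in
  aggmin Dl (2 * nbits n) (fun _ => 0) (leave_val det) (fun cur T =>
  kont (all_opt det cur T)))).

End PathProgram.

(** * Detours off the path: correctness and round bound *)

Section PathRule.
Variables (main : Input -> seq bool -> prog) (tl : nat -> nat).
Variables (n : nat) (E : rel 'I_n) (Post : ('I_n -> Output) -> Prop).
Notation ok := (ok main tl E Post).
Notation B := 'I_(base n).
Variables (Dl w : nat) (L : {set 'I_n}) (s t : 'I_n) (ps : seq 'I_n).
Hypotheses (hD : diam_le E Dl) (hDb : Dl <= base n) (w0 : 0 < w) (wb : n + 2 * w <= base n).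
Hypotheses (st : s != t) (hps : shortest_path E s t ps).
Let pv i := nth s (s :: ps) i.
Let h := size ps.
Let G x y := E x y && ~~ path_edge pv h x y.
Let PS := path_set pv h.
Hypothesis hL : hit G w L.

Let FF i := remove_edge E (pv i) (pv i.+1).

Lemma pv_inj i j : i <= h -> j <= h -> pv i = pv j -> i = j.
Proof. by move=> a b; apply: shortest_inj hps. Qed.

Lemma pv0 : pv 0 = s. Proof. by []. Qed.

Lemma pvh : pv h = t.
Proof. by case: hps => [[_ e] _]; rewrite /pv -last_nth. Qed.

Lemma pv_edge i : i < h -> E (pv i) (pv i.+1).
Proof. by case: hps => [[/(pathP s) hp _] _] /hp. Qed.

Lemma h_lt : h < n.
Proof. exact: isd_lt (shortest_isd hps). Qed.

Lemma h_gt0 : 0 < h.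
Proof. by rewrite lt0n; apply/negP => /eqP e; have := st; rewrite -pvh -pv0 e eqxx. Qed.

Lemma pv_PS k : k <= h -> pv k \in PS.
Proof. by rewrite -ltnS => lt; apply/imsetP; exists (Ordinal lt). Qed.

(** Detours avoid all path edges, so one search serves every failing edge. *)
Lemma G_FF i x y : i < h -> G x y -> FF i x y.
Proof.
move=> ih /andP[e np]; rewrite /FF /remove_edge e /=; apply: contra np => h2.
by apply/existsP; exists (Ordinal ih).
Qed.

Lemma pv_FF i k : i < h -> k < h -> k != i -> FF i (pv k) (pv k.+1).
Proof.
move=> ih kh ki; rewrite /FF /remove_edge pv_edge //=; apply/negP => /andP[/eqP e _].
by case/negP: ki; apply/eqP; apply: pv_inj e; lia.
Qed.

(** Take the last visit p to pv 0, ..., pv i and the first later visit r to the rest of the path. No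
    vertex strictly between is on the path, so this piece uses no path edge; since [ps] is shortest,
    the outer pieces of [q] may be exchanged for pieces of [ps]. *)
Lemma detour i q : i < h -> dwalk (FF i) s t q ->
  exists j k g, [/\ j <= i, i < k, k <= h, dwalk G (pv j) (pv k) g & j + size g + (h - k) <= size q].
Proof.
move=> ih hq; have hqE : dwalk E s t q.
  case: hq => a b; split=> //; apply: sub_path a => x y; by rewrite /FF /remove_edge => /andP[].
pose X p := nth s (s :: q) p.
pose A p := (p <= size q) && [exists j : 'I_i.+1, X p == pv j].
have exA : exists p, A p by exists 0; apply/existsP; exists ord0; rewrite pv0.
have bA p : A p -> p <= size q by case/andP.
case: (ex_maxnP exA bA) => p /andP[pq /existsP[j /eqP ej]] pmax.
pose C r := [&& p < r, r <= size q & [exists k : 'I_h.+1, (i < k) && (X r == pv k)]].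
have exC : exists r, C r.
  exists (size q); have Xt : X (size q) = t by case: hq => _ e; rewrite /X -last_nth.
  have pltq : p < size q.
    rewrite ltn_neqAle pq andbT; apply/eqP => e; move: ej; rewrite e Xt -pvh => /pv_inj.
    by have := ltn_ord j; lia.
  rewrite /C pltq leqnn /=; apply/existsP; exists ord_max.
  by rewrite /= ih Xt -pvh eqxx.
case: (ex_minnP exC) => r /and3P[pr rq /existsP[k /andP[ik /eqP ek]]] rmin.
have hsub := dwalk_sub (ltnW pr) rq hq.
exists j, k, (drop p (take r q)).
have ji := ltn_ord j; have kh := ltn_ord k.
split=> //; try lia.
  rewrite -ej -ek; case: hsub => a b; split=> //.
  apply/(pathP s) => u; rewrite size_drop size_takel // => ult.
  have := (pathP s a) u; rewrite size_drop size_takel // => /(_ ult).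
  have eX c : c <= r - p -> nth s (X p :: drop p (take r q)) c = X (p + c).
    case: c => [|c] hc; first by rewrite addn0.
    by rewrite /= nth_drop nth_take; [rewrite /X addnS | lia].
  have -> : nth s (drop p (take r q)) u = X (p + u.+1) by rewrite -(eX u.+1).
  rewrite -/(X p) eX; last exact: ltnW.
  move=> hF; have hE : E (X (p + u)) (X (p + u.+1)) by case/andP: hF.
  rewrite /G hE /=; apply/negP => /existsP[j' /andP[/eqP e1 /eqP e2]].
  have j'h := ltn_ord j'.
  (* A path edge starting in the prefix must start at p; ending in the prefix it contradicts the
     choice of p, otherwise it is the removed edge. One starting beyond i contradicts the choice of
     r. *)
  have [j'i|ij'] := leqP j' i.
    have u0 : p + u <= p.
      apply: pmax; apply/andP; split; first by lia.
      by apply/existsP; exists (Ordinal (j'i : j' < i.+1)); apply/eqP.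
    have eu : u = 0 by lia.
    move: e1 e2 hF; rewrite eu addn0 addn1 => e1 e2 hF.
    have [ji2|ij2] := ltnP j' i.
      have : p.+1 <= p; last by lia.
      apply: pmax; apply/andP; split; first by lia.
      by apply/existsP; exists (Ordinal (ji2 : j'.+1 < i.+1)); apply/eqP.
    have eji : nat_of_ord j' = i by lia.
    by move: hF; rewrite /FF /remove_edge e1 e2 eji !eqxx andbF.
  have lu : u != 0.
    apply/negP => /eqP eu; move: e1; rewrite eu addn0 ej => /pv_inj; lia.
  have : r <= p + u; last by lia.
  apply: rmin; apply/and3P; split; [lia | lia |].
  have j'h2 : j' < h.+1 by lia.
  by apply/existsP; exists (Ordinal j'h2); rewrite /= ij' e1 eqxx.
have jp : j <= p.
  have hj : nat_of_ord j <= size ps by rewrite -/h; lia.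
  have h1 := shortest_sub (leq0n j) hj hps.
  have h2 := dwalk_take pq hqE; rewrite -/(X p) ej in h2.
  by have := isd_le_dwalk h1 h2; rewrite subn0 size_takel.
have kr : h - k <= size q - r.
  have h1 := shortest_sub (_ : k <= size ps) (leqnn _) hps.
  have h2 := dwalk_drop rq hqE; rewrite -/(X r) ek in h2.
  have := isd_le_dwalk (h1 _) _; rewrite -/(pv h) pvh => /(_ _ _ h2); rewrite size_drop; apply; rewrite -/h; lia.
rewrite size_drop size_takel //; lia.
Qed.

Let Do v y d := [&& d <= 2 * w, y \in L :|: PS & isd G (pred1 y) d v].
Let W : {set 'I_n * 'I_n * B} := [set p : 'I_n * 'I_n * B | (p.1.1 \in L) && Do p.1.1 p.1.2 p.2].

Section PathOptions.
Variables (PP : 'I_n -> 'I_n -> option 'I_n) (cur : 'I_n -> nat) (T : {set 'I_n}).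
Hypothesis PPE : forall x l d, l \in L :|: PS -> d < 2 * w -> isd G (pred1 l) d.+1 x ->
  exists u, [/\ PP x l = Some u, G x u & isd G (pred1 l) d u].
Let det v := det_opt pv h L (Do v) (PP v) W.
Hypothesis aggT : forall i, i \in T -> exists v, leave_val pv h v (det v) i (cur i).
Hypothesis agg_le : forall i v c, leave_val pv h v (det v) i c -> cur i <= c.
Hypothesis agg_in : forall i v c, leave_val pv h v (det v) i c -> c < 2 ^ (2 * nbits n) -> i \in T.
Let opt v := all_opt pv h v (det v) cur T.

Lemma L_tok l : l \in L -> l \in L :|: PS.
Proof. by rewrite in_setU => ->. Qed.

Lemma PS_tok k : k <= h -> pv k \in L :|: PS.
Proof. by move=> kh; rewrite in_setU pv_PS ?orbT. Qed.

Lemma suffix_opt i k : i < k -> k < h -> opt (pv k) i (pv k.+1) (h - k).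
Proof. by move=> ik kh; constructor 2; exists k. Qed.

(** As for a single target, with one more way to end: on reaching [pv k] with k > i the walk
    continues along the suffix. *)
Lemma det_desc i x y z : i < h -> x != t -> det x i y z ->
  [/\ FF i x y, 0 < z & y = t \/ exists y' z', opt y i y' z' /\ z' < z].
Proof.
move=> ih xt [l [d [m [hP d0 /and3P[d2 lt hd] -> hm]]]].
case: d d0 d2 hd => // d _ d2 hd.
have [u [hu1 hu2 hu3]] := @PPE x l d lt d2 hd.
move: hu1; rewrite hP => -[eu]; rewrite -eu {u eu} in hu2 hu3.
split=> //; first exact: G_FF.
have [yt|yt] := eqVneq y t; [by left | right].
case: d d2 hd hu3 => [|d] d2 hd hu3; last first.
  have [u [h1 h2 h3]] := @PPE y l d lt (ltnW d2) hu3.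
  exists u, (d.+1 + m); split; last by slia.
  constructor 1; exists l, d.+1, m; split=> //; apply/and3P; split=> //; exact: ltnW.
have yl : y = l by apply/eqP; case/andP: hu3.
have suff_k k : i < k -> k <= h -> y = pv k -> opt y i (pv k.+1) (h - k).
  move=> ik kh yk; rewrite yk; apply: suffix_opt => //; rewrite ltn_neqAle kh andbT.
  by apply: contraNneq yt => e; rewrite yk e pvh.
case: hm => [[lL [skl mn]]|[k [ik kh lk ->]]]; last first.
  by exists (pv k.+1), (h - k); split; [apply: suff_k; rewrite ?yl | slia].
rewrite -yl in skl mn lL.
have inv : det_dir pv h W i y m \/ exists y2 d2 m2, [/\ m = d2 + m2, det_edge L W y y2 d2 & sk (det_dir pv h W i) (det_edge L W) y2 m2].
  by case: skl => [l' m' h1|l' y2 d3 m2 h1 h2]; [left | right; exists y2, d3, m2].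
case: inv => [[k [d3 [ik kh]]]|[y2 [d3 [m2 [e [d4 h4 [y2L d30 ed]] hsk2]]]]].
  rewrite in_set => /andP[_ /= /and3P[d32 _ hd3]] em.
  case: (nat_of_ord d3) d32 hd3 em => [|d4] d32 hd3 em.
    exists (pv k.+1), (h - k); split; last by slia.
    by apply: suff_k => //; apply/eqP; case/andP: hd3.
  have [u [h1 h2 h3]] := @PPE y (pv k) d4 (PS_tok kh) d32 hd3.
  exists u, (d4.+1 + (h - k)); split; last by slia.
  constructor 1; exists (pv k), d4.+1, (h - k); split=> //; last by right; exists k.
  by apply/and3P; split=> //; apply: PS_tok.
move: h4; rewrite in_set => /andP[_ /= /and3P[d32 _ hd3]]; rewrite -ed in d32 hd3.
have [m3 hm3 le3] := least_ex hsk2.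
have he : det_edge L W y y2 d3.
  by exists d4; rewrite // in_set /= lL /= /Do -ed d32 (L_tok y2L) hd3.
have := mn _ (sk_edge he (proj1 hm3)) => le4.
case: d3 d30 d32 hd3 {he ed} e le4 => // d3 _ d32 hd3 e le4.
have [u [h1 h2 h3]] := @PPE y y2 d3 (L_tok y2L) d32 hd3.
exists u, (d3.+1 + m3); split; last by slia.
constructor 1; exists y2, d3.+1, m3; split=> //; last by left.
by apply/and3P; split=> //; apply: L_tok.
Qed.

Lemma cur_dec i : i \in T -> exists j z, [/\ j <= i, val i < h, best_val (det (pv j) i) = Some z,
  cur i %% n = j & cur i %/ n = j + z].
Proof.
case/aggT=> v [j [z [ji ih -> hz ->]]]; exists j, z.
have jn : j < n by apply: leq_ltn_trans ji (ltn_ord i).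
have n0 : 0 < n by apply: leq_ltn_trans jn.
by split=> //; [rewrite modnMDl modn_small | rewrite divnMDl // divn_small // addn0].
Qed.

(** On the prefix the bound drops by one per edge; the step into the leaving vertex meets that
    vertex's own detour value, which is the total minus its position. *)
Lemma all_opt_desc i x y z : i < h -> x != t -> opt x i y z ->
  [/\ FF i x y, 0 < z & y = t \/ exists y' z', opt y i y' z' /\ z' < z].
Proof.
move=> ih xt [hd|[k [ik kh -> -> ->]]|[i' [j [ei iT]]]]; first exact: det_desc hd.
  split; [by apply: pv_FF; rewrite // neq_ltn ik orbT | by rewrite subn_gt0 |].
  have [e|ne] := eqVneq k.+1 h; first by left; rewrite e pvh.
  have kh' : k.+1 < h by rewrite ltn_neqAle ne.
  right; exists (pv k.+2), (h - k.+1); split; last by slia.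
  by apply: suffix_opt => //; apply: ltnW.
have [j1 [z1 [j1i _ hz em ed]]] := cur_dec iT.
rewrite em ed => jj -> [-> ->]; have [[y1 hy1] mn] := (best_some hz).1.
rewrite ei in j1i hy1 hz.
have z10 : 0 < z1 by case: hy1 => l [d [m [_ d0 _ -> _]]]; rewrite addn_gt0 d0.
have ji : j < i by apply: leq_trans jj j1i.
split; [by apply: pv_FF; rewrite ?neq_ltn ?ji // (ltn_trans ji) | by slia |].
right; have [e|ne] := eqVneq j.+1 j1.
  exists y1, z1; rewrite e; split; last by slia.
  by constructor 1.
exists (pv j.+2), (j1 + z1 - j.+1); split; last by slia.
constructor 3; exists i', j.+1; split=> //; last by rewrite ed.
by rewrite em ltn_neqAle ne.
Qed.

(** By [detour] some [pv j] offers a total no longer than a shortest replacement path, and the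
    minimum over all leaving vertices is at most that. *)
Lemma all_opt_compl i q : i < h -> dwalk (FF i) s t q ->
  exists y z, opt s i y z /\ z <= size q.
Proof.
move=> ih /[dup] /canonP hc0 hq.
have lec : size (canon (FF i) s t) <= size q by case: (hc0) => _; apply.
have ltc : size (canon (FF i) s t) < n by apply: isd_lt (shortest_isd hc0).
have [j [k [g [ji ik kh hg le]]]] := detour ih (proj1 hc0).
set c := size (canon (FF i) s t) in lec ltc le.
have ne : pv j != pv k by apply/negP => /eqP /pv_inj; slia.
have hcg := canonP hg.
have leg : size (canon G (pv j) (pv k)) <= size g by case: hcg => _; apply.
have [y0 [z0 [hdet lez0]]] : exists y z, det (pv j) i y z /\ z <= size g + (h - k).
  have := @sk_entry n (det_dir pv h W i) (det_edge L W) G w L (h - k) (pv j) (pv k) g w0 hL hg.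
  case=> //.
  - move=> l d lL d2 hd; have db : d < base n by slia.
    exists k, (Ordinal db); split=> //; rewrite in_set /= lL /=.
    by apply/and3P; split=> //; apply: PS_tok.
  - move=> l l' d lL l'L wd d2 hd; have db : d < base n by slia.
    exists (Ordinal db); last by split=> //; apply: leq_trans w0 wd.
    by rewrite in_set /= lL /=; apply/and3P; split=> //; apply: L_tok.
  - case=> hd /andP[d0 d2].
    case: (size (canon G (pv j) (pv k))) d0 d2 hd leg => // d _ d2 hd leg.
    have [u [h1 h2 h3]] := @PPE (pv j) (pv k) d (PS_tok kh) d2 hd.
    exists u, (d.+1 + (h - k)); split; last by rewrite leq_add2r.
    exists (pv k), d.+1, (h - k); split=> //; last by right; exists k.
    by apply/and3P; split=> //; apply: PS_tok.
  case=> l [d [[lL d0 d2 hd hsk] led]].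
  have [m hm le2] := least_ex hsk.
  case: d d0 d2 hd hsk led le2 => // d _ d2 hd hsk led le2.
  have [u [h1 h2 h3]] := @PPE (pv j) l d (L_tok lL) d2 hd.
  exists u, (d.+1 + m); split; last by slia.
  exists l, d.+1, m; split=> //; last by left.
  by apply/and3P; split=> //; apply: L_tok.
have [z1 hz1 lez1] := best_le hdet.
have hn := h_lt; have n0 : 0 < n by apply: leq_ltn_trans hn.
pose i' := Ordinal (ltn_trans ih hn).
have lv : leave_val pv h (pv j) (det (pv j)) i' ((j + z1) * n + j) by exists j, z1.
(* The total j + z1 is at most the length of a shortest replacement path, hence below n; the code is
   below n^2, which explains the [2 * nbits n] bits. *)
have code_lt : (j + z1) * n + j < 2 ^ (2 * nbits n).
  have jz : j + z1 < n by slia.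
  have [nB _] := trunc_log2P n; rewrite -/(nbits n) in nB.
  apply: (@leq_trans (n * n)); last by rewrite mul2n -addnn expnD; apply: leq_mul; apply: ltnW.
  have jn : j < n by slia.
  by apply: (@leq_trans ((j + z1).+1 * n)); [rewrite mulSn; slia | rewrite leq_mul2r jz orbT].
have iT := agg_in lv code_lt; have curle := agg_le lv.
have [j1 [z2 [j1i _ hz2 em ed]]] := cur_dec iT.
have le3 : j1 + z2 <= j + z1.
  rewrite -ed; apply: leq_trans (leq_div2r n curle) _.
  by rewrite divnMDl // divn_small ?addn0 //; slia.
(* When the path is left at [s] itself the detour option serves; otherwise the first path edge
   does. *)
case: j1 em ed hz2 j1i le3 => [|j1] em ed hz2 j1i le3.
  have [[[y hy] _] _] := best_some hz2.
  by exists y, z2; split; [constructor 1 | slia].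
exists (pv 1), (j1.+1 + z2 - 0); split; last by slia.
by constructor 3; exists i', 0; rewrite em ed.
Qed.

End PathOptions.

(** Only links from landmarks, to landmarks or path vertices, are published: at most #|L| (#|L| + h
    + 1) tokens. The first leg of a detour is known at the vertex where it starts. *)
Lemma ok_rp_all (kont : 'I_n -> (nat -> 'I_n -> nat -> Prop) -> prog) r :
  (forall opt : 'I_n -> nat -> 'I_n -> nat -> Prop,
     (forall i, i < h -> forall x y z, x != t -> opt x i y z ->
        [/\ FF i x y, 0 < z & y = t \/ exists y' z', opt y i y' z' /\ z' < z]) ->
     (forall i, i < h -> forall q, dwalk (FF i) s t q -> exists y z, opt s i y z /\ z <= size q) ->
     ok (fun v => kont v (opt v)) r) ->
  ok (fun v => rp_all pv h v Dl w L (E v) (kont v))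
     (2 * w + #|L| + h + 2 + (8 * (#|L| * (#|L| + h.+1)) + 2 * Dl.+1) +
      ((2 * nbits n).+1 * (8 * h + 2 * Dl.+1) + r)).
Proof.
move=> hk.
have cPS : #|PS| <= h.+1 by apply: leq_trans (leq_imset_card _ _) _; rewrite card_ord.
have cLP : #|L :|: PS| <= #|L| + h.+1 by apply: leq_trans (leq_card_setU _ _) _; rewrite leq_add2l.
have lb : 2 * w <= base n by slia.
pose R1 := (2 * nbits n).+1 * (8 * h + 2 * Dl.+1) + r.
apply: (@ok_leq _ _ _ _ _ _ ((2 * w + #|L :|: PS|).+1 + (8 * (#|L| * (#|L| + h.+1)) + 2 * Dl.+1 + R1))).
  by rewrite /R1; move: cLP; move: #|L :|: PS| => a cLP; slia.
pose agg v (Dout : 'I_n -> nat -> bool) PP (W' : {set 'I_n * ('I_n * B)}) :=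
  let W := [set p : 'I_n * 'I_n * B | (p.1.1, (p.1.2, p.2)) \in W'] in
  let det := det_opt pv h L Dout PP W in
  aggmin Dl (2 * nbits n) (fun _ => 0) (leave_val pv h v det) (fun cur T => kont v (all_opt pv h v det cur T)).
pose bc v (Dout : 'I_n -> nat -> bool) PP :=
  bcast n Dl [set p : 'I_n * ('I_n * B) | [&& p.1 == v, v \in L & Dout p.2.1 p.2.2]] (agg v Dout PP).
have H1 := @ok_mbfs main tl n E Post (2 * w) #|L :|: PS| (fun v u => E v u && ~~ path_edge pv h v u) (L :|: PS) bc.
apply: H1 => // PP hPP.
have e1 : (fun v u => uadj E u v && (E v u && ~~ path_edge pv h v u)) =2 G.
  by move=> v u; rewrite /G /uadj; case: (E v u); rewrite ?andbF // orbT.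
pose W' : {set 'I_n * ('I_n * B)} := [set p : 'I_n * ('I_n * B) | (p.1 \in L) && Do p.1 p.2.1 p.2.2].
have eW : \bigcup_v [set p : 'I_n * ('I_n * B) | [&& p.1 == v, v \in L & Do v p.2.1 p.2.2]] = W'.
  exact: (bigcup_own (fun v (p : 'I_n * ('I_n * B)) => (v \in L) && Do v p.2.1 p.2.2)).
have cW : #|W'| <= #|L| * (#|L| + h.+1).
  have inj : {in W' &, injective (fun p => (p.1, p.2.1))}.
    move=> [l [y d]] [l' [y' d']] /=; rewrite !in_set /= => /and4P[_ _ _ h1] + [e e'].
    rewrite -e -e' => /and4P[_ _ _ h2]; do 2 congr pair; apply: val_inj; exact: isd_inj h1 h2.
  apply: leq_trans (_ : #|L| * #|L :|: PS| <= _); last by rewrite leq_mul2l cLP orbT.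
  rewrite -(card_in_imset inj) -cardsX; apply: subset_leq_card; apply/subsetP => x /imsetP[[l [y d]]].
  by rewrite in_set => /and4P[/= h1 _ h2 _] ->; rewrite in_setX h1.
have c3 : #|{: 'I_n * ('I_n * B)}| <= ntok n.
  by have := card_tok3 n; rewrite !card_prod mulnA.
apply: (@ok_leq _ _ _ _ _ _ (8 * #|W'| + 2 * Dl.+1 + R1)).
  by rewrite !leq_add2r leq_mul2l cW.
have H2 := @ok_bcast main tl n E _ Dl (fun v => [set p : 'I_n * ('I_n * B) | [&& p.1 == v, v \in L & Do v p.2.1 p.2.2]])
  hD hDb c3 Post (fun v => agg v (Do v) (PP v)) R1.
rewrite eW in H2; apply: ok_ext (H2 _) => [v|].
  congr (bc v _ _); apply: functional_extensionality => y; apply: functional_extensionality => d.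
  by rewrite /Do (eq_isd e1 (frefl _)).
have PPE x l d : l \in L :|: PS -> d < 2 * w -> isd G (pred1 l) d.+1 x ->
    exists u, [/\ PP x l = Some u, G x u & isd G (pred1 l) d u].
  rewrite -(eq_isd e1 (frefl _)) => lt d2 /(hPP x l d lt d2)[u [h1 h2 h3]].
  by exists u; split=> //; [rewrite -e1 | rewrite -(eq_isd e1 (frefl _))].
have eWW : [set p : 'I_n * 'I_n * B | (p.1.1, (p.1.2, p.2)) \in W'] = W.
  by apply/setP => p; rewrite !in_set.
rewrite /agg eWW.
apply: (@ok_aggmin main tl n E Post Dl h (fun v => leave_val pv h v (det_opt pv h L (Do v) (PP v) W)) hD hDb).
  by move=> v i c [j [z []]].
move=> cur T a1 a2 a3.
apply: (hk (fun v => all_opt pv h v (det_opt pv h L (Do v) (PP v) W) cur T)) => [i ih x y z xt|i ih q hq].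
  exact: (all_opt_desc PPE a1 ih xt).
apply: (all_opt_compl PPE a1 _ _ ih hq) => [i' v c hv|i' v c hv].
  by apply: a2; exists v.
by apply: a3; exists v.
Qed.

End PathRule.

(** * The algorithm *)

Definition search (N : nat) (P : pred nat) : nat := find P (iota 0 N.+1).

Lemma searchP N (P : pred nat) : P N ->
  [/\ P (search N P), search N P <= N & forall x, x < search N P -> ~~ P x].
Proof.
move=> PN; have hs : has P (iota 0 N.+1) by apply/hasP; exists N => //; rewrite mem_iota add0n ltnSn.
have lt : search N P < N.+1 by move: hs; rewrite has_find size_iota.
split=> //; first by have := nth_find 0 hs; rewrite nth_iota.
by move=> x hx; have := before_find 0 hx; rewrite nth_iota ?add0n ?(ltn_trans hx) // => ->.
Qed.

Definition width_all (n h : nat) : nat :=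
  search n (fun w => (n ^ 2 <= w ^ 3) && (n * h <= w ^ 2)).
(** Apart from the cap this is w >= sqrt n * Dl^(1/4). The cap [minn Dl n] guarantees a solution up
    to n, as the estimate [Dl] may exceed n. *)
Definition width_single (n Dl : nat) : nat :=
  search n (fun w => n ^ 2 * minn Dl n <= w ^ 4).
Definition degree_bound (Dl : nat) : nat := search Dl (fun k => Dl <= k ^ 2).

Lemma width_allP n h : 1 < n -> h <= n -> let w := width_all n h in
  [/\ n ^ 2 <= w ^ 3, n * h <= w ^ 2, w <= n, 0 < w &
      forall x, x < w -> x ^ 3 < n ^ 2 \/ x ^ 2 < n * h].
Proof.
move=> n1 hn w.
have [|/andP[h1 h2] h3 h4] := @searchP n (fun w => (n ^ 2 <= w ^ 3) && (n * h <= w ^ 2)).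
  by rewrite leq_exp2l //= -mulnn leq_mul2l hn orbT.
split=> //.
  rewrite lt0n; apply/negP => /eqP e; move: (h1 : n ^ 2 <= w ^ 3).
  by rewrite e exp0n // leqn0 expn_eq0 => /andP[/eqP n0 _]; lia.
move=> x /h4; rewrite negb_and -!ltnNge => /orP[]; by [left | right].
Qed.

Lemma width_singleP n Dl : 1 < n -> 0 < Dl -> let w := width_single n Dl in
  [/\ n ^ 2 * minn Dl n <= w ^ 4, w <= n, 0 < w & forall x, x < w -> x ^ 4 < n ^ 2 * Dl].
Proof.
move=> n1 Dl0 w.
have [|h1 h3 h4] := @searchP n (fun w => n ^ 2 * minn Dl n <= w ^ 4).
  rewrite (_ : 4 = 2 + 2) // expnD leq_mul2l; apply/orP; right.
  by apply: leq_trans (geq_minr _ _) _; rewrite -mulnn leq_pmull //; apply: ltnW.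
split=> //.
  rewrite lt0n; apply/negP => /eqP e; move: (h1 : n ^ 2 * minn Dl n <= w ^ 4).
  rewrite e exp0n // leqn0 muln_eq0 expn_eq0.
  move=> /orP[/andP[/eqP n0 _]|/eqP]; first by lia.
  by move: Dl0 n1; rewrite /minn; case: ifP; lia.
move=> x /h4; rewrite -ltnNge => lt; apply: leq_trans lt _.
by rewrite leq_mul2l geq_minl orbT.
Qed.

Lemma degree_boundP Dl : 0 < Dl -> let k := degree_bound Dl in Dl <= k ^ 2 /\ k ^ 2 <= 4 * Dl.
Proof.
move=> Dl0 k; have [|h1 h3 h4] := @searchP Dl (fun k => Dl <= k ^ 2).
  by rewrite -mulnn leq_pmull.
split=> //; have {}h4 : forall x, x < k -> ~~ (Dl <= x ^ 2) := h4.
case: (k) h4 => [|[|k']] h4; [by [] | by rewrite exp1n; lia |].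
by have := h4 k'.+1 (ltnSn _); rewrite -ltnNge -!mulnn; nia.
Qed.

Section Program.
Variables (n : nat) (v : 'I_n).

Fixpoint all_sssp (Dl w k : nat) (L : {set 'I_n}) (t : 'I_n) (outE inE : pred 'I_n)
    (pv : nat -> 'I_n) (i : nat) (opts : nat -> 'I_n -> nat -> Prop)
    (kont : (nat -> 'I_n -> nat -> Prop) -> prog) : prog :=
  if i is i'.+1 then
    sssp v Dl w k L t (fun u => outE u && ~~ ((v == pv i') && (u == pv i'.+1)))
      (fun u => inE u && ~~ ((u == pv i') && (v == pv i'.+1)))
      (fun o => all_sssp Dl w k L t outE inE pv i' (fun j => if j == i' then o else opts j) kont)
  else kont opts.

Definition claims (is_s : bool) (pv : nat -> 'I_n) (h : nat) (opt : nat -> 'I_n -> nat -> Prop) : Output :=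
  (if is_s then [seq ((val (pv i), val (pv i.+1)), best_val (opt i)) | i <- iota 0 h] else [::],
   pmap (fun i => omap (fun y : 'I_n => ((val (pv i), val (pv i.+1)), val y)) (best_succ (opt i)))
     (iota 0 h)).

(** There is one draw per node; when more draws are wanted than nodes exist, all vertices become
    landmarks, which still respects the bound [ndraws n w]. *)
Definition sample (w : nat) (tape : seq bool) : {set 'I_n} :=
  [set x : 'I_n | if ndraws n w <= n then (val v < ndraws n w) && (dec tape == val x) else x == v].

(** The test compares the two round bounds up to logarithms; n, h and [Dl] are known to all nodes,
    so they choose alike. *)
Definition solve (Dl h : nat) (pv : nat -> 'I_n) (t : 'I_n) (outE inE : pred 'I_n)
    (tape : seq bool) (kont : (nat -> 'I_n -> nat -> Prop) -> prog) : prog :=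
  let wa := width_all n h in
  let ws := width_single n Dl in
  if wa + Dl <= h * (ws + Dl) then
    bcast n Dl (sample wa tape) (fun L => rp_all pv h v Dl wa L outE kont)
  else
    bcast n Dl (sample ws tape) (fun L =>
      all_sssp Dl ws (degree_bound Dl) L t outE inE pv h (fun _ _ _ => False) kont).

Definition node_prog (outE inE : pred 'I_n) (is_s is_t : bool) (sc : option nat) (tape : seq bool) : prog :=
  find_diam v n 1 (fun Dl =>
  bcast n Dl [set p : 'I_n * 'I_n | (p.1 == v) && (sc == Some (val p.2))] (fun PE =>
  bcast n Dl (if is_s then [set v] else set0) (fun S =>
  bcast n Dl (if is_t then [set v] else set0) (fun T =>
  if [pick s in S] is Some s then if [pick t in T] is Some t then
    let h := #|PE| in
    (* Beyond h the value is [s], to agree with the default in [nth s (s :: ps)]. *)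
    let pv i := if i <= h then iter i (fun x => odflt x [pick y | (x, y) \in PE]) s else s in
    solve Dl h pv t outE inE tape (fun opt => Done (claims is_s pv h opt))
  else Done ([::], [::]) else Done ([::], [::]))))).

End Program.

Definition main_prog (i : Input) (tape : seq bool) : prog :=
  if @insub nat (fun x => x < in_n i) 'I_(in_n i) (in_id i) is Some v then
    node_prog v (fun u => val u \in in_out i) (fun u => val u \in in_in i)
      (in_is_s i) (in_is_t i) (in_succ i) tape
  else Done ([::], [::]).

Definition rp_algo : Algo := algo_of main_prog nbits.

(** * Correctness of the claims and of the two modes *)

Section Correct.
Variables (n : nat) (E : rel 'I_n) (s t : 'I_n) (ps : seq 'I_n).
Hypotheses (st : s != t) (hps : shortest_path E s t ps).
Let pv i := nth s (s :: ps) i.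
Let h := size ps.
Let FF i := remove_edge E (pv i) (pv i.+1).

Definition good_opts (opt : 'I_n -> nat -> 'I_n -> nat -> Prop) (i : nat) : Prop :=
  (forall x y z, x != t -> opt x i y z ->
     [/\ FF i x y, 0 < z & y = t \/ exists y' z', opt y i y' z' /\ z' < z]) /\
  (forall q, dwalk (FF i) s t q -> exists y z, opt s i y z /\ z <= size q).

Lemma pv_pair_inj i i' : i < h -> i' < h ->
  (val (pv i), val (pv i.+1)) = (val (pv i'), val (pv i'.+1)) -> i = i'.
Proof. by move=> ih i'h [/val_inj e _]; apply: (shortest_inj _ _ hps e); apply: ltnW. Qed.

Lemma claims_correct opt : (forall i, i < h -> good_opts opt i) ->
  rp_correct E s t ps (fun v => claims (v == s) pv h (opt v)).
Proof.
move=> hopt i ih /=; rewrite -/(pv i) -[nth s ps i]/(pv i.+1).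
have [hd hc] := hopt i ih.
have [h1 h2] := follow_correct (opt := fun x => opt x i) hd st hc.
split; [|split].
- exists s, (best_val (opt s i)); rewrite eqxx.
  by apply: map_f; rewrite mem_iota.
- move=> v l; case: eqP => [->|//] /mapP[i']; rewrite mem_iota /= add0n => i'h [e1 e2 ->].
  have -> // : i' = i by apply: pv_pair_inj => //; exact: (f_equal2 pair (esym e1) (esym e2)).
case: h2 => [h2|[q [hq hsucc]]]; [by left | right].
exists q; split=> // j jq w; have hs := hsucc j jq.
rewrite mem_pmap; apply/mapP/eqP => [[i']|->].
  rewrite mem_iota /= add0n => i'h; case Eb: best_succ => [y|] //= [e1 e2 ->].
  have ei : i' = i by apply: pv_pair_inj => //; exact: (f_equal2 pair (esym e1) (esym e2)).
  by move: Eb; rewrite ei hs => -[->].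
by exists i; rewrite ?mem_iota // hs.
Qed.

Section Run.
Variables (main : Input -> seq bool -> prog) (tl : nat -> nat) (Post : ('I_n -> Output) -> Prop).
Variable Dl : nat.
Hypotheses (hD : diam_le E Dl) (hDb : Dl <= base n) (Dl0 : 0 < Dl) (n1 : 1 < n).
Notation ok := (ok main tl E Post).
Let wa := width_all n h.
Let ws := width_single n Dl.
Let k := degree_bound Dl.
Definition all_mode : bool := wa + Dl <= h * (ws + Dl).
Definition width : nat := if all_mode then wa else ws.
Let G x y := E x y && ~~ path_edge pv h x y.

Lemma h_ltn : h < n. Proof. exact: isd_lt (shortest_isd hps). Qed.

Lemma width_gt0 : 0 < width.
Proof.
by rewrite /width; case: ifP => _; [case: (width_allP n1 (ltnW h_ltn)) | case: (width_singleP n1 Dl0)].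
Qed.

Lemma width_le : width <= n.
Proof.
by rewrite /width; case: ifP => _; [case: (width_allP n1 (ltnW h_ltn)) | case: (width_singleP n1 Dl0)].
Qed.

Lemma width_base : n + 2 * width <= base n.
Proof. by have := width_le; rewrite /base; slia. Qed.

Definition hit_all (L : {set 'I_n}) : Prop :=
  hit G width L /\ forall i, i < h -> hit (FF i) width L.

Definition sssp_cost (c : nat) : nat :=
  4 * ws + 18 * c + 6 + 8 * k.+1 * c + 6 * Dl.+1 + (c %/ k.+1) * (8 * Dl.+1).

Lemma ok_all_sssp L i opts (kont : 'I_n -> (nat -> 'I_n -> nat -> Prop) -> prog) r :
  ~~ all_mode -> hit_all L -> i <= h ->
  (forall j, i <= j -> j < h -> good_opts opts j) ->
  (forall opt, (forall j, j < h -> good_opts opt j) -> ok (fun v => kont v (opt v)) r) ->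
  ok (fun v => all_sssp v Dl ws k L t (E v) (fun u => E u v) pv i (opts v) (kont v))
     (i * sssp_cost #|L| + r).
Proof.
move=> nm [_ hL] + + hk; elim: i opts => [|i IH] opts ih hopt; first by apply: hk => j jh; apply: hopt.
have ew : width = ws by rewrite /width (negbTE nm).
have w0 := width_gt0; have wb := width_base; rewrite ew in w0 wb hL.
have FE x y : FF i x y -> E x y by case/andP.
rewrite mulSn -addnA.
have H := @ok_sssp main tl n E Post Dl ws k L t (FF i) hD hDb w0 wb FE s
  (fun v o => all_sssp v Dl ws k L t (E v) (fun u => E u v) pv i
    (fun j => if j == i then o else opts v j) (kont v)) (i * sssp_cost #|L| + r) (hL i ih) st.
apply: H => o hd hc.
apply: (IH (fun v j => if j == i then o v else opts v j)) => [|j ij jh]; first exact: ltnW.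
have [->|ne] := eqVneq j i; first by rewrite /good_opts eqxx; split.
have ij' : i < j by rewrite ltn_neqAle eq_sym ne.
by rewrite /good_opts (negbTE ne); apply: hopt.
Qed.

Definition solve_cost (c : nat) : nat :=
  if all_mode then 2 * wa + c + h + 2 + (8 * (c * (c + h.+1)) + 2 * Dl.+1) +
      (2 * nbits n).+1 * (8 * h + 2 * Dl.+1)
  else h * sssp_cost c.

Lemma ok_solve L (tape : 'I_n -> seq bool) (kont : 'I_n -> (nat -> 'I_n -> nat -> Prop) -> prog) r :
  \bigcup_v sample v width (tape v) = L -> hit_all L ->
  (forall opt, (forall i, i < h -> good_opts opt i) -> ok (fun v => kont v (opt v)) r) ->
  ok (fun v => solve v Dl h pv t (E v) (fun u => E u v) (tape v) (kont v))
     (8 * #|L| + 2 * Dl.+1 + (solve_cost #|L| + r)).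
Proof.
move=> eL hL hk; have w0 := width_gt0; have wb := width_base.
have mode_eq : (width_all n h + Dl <= h * (width_single n Dl + Dl)) = all_mode by [].
rewrite /solve /solve_cost mode_eq.
case Em: all_mode; rewrite /width Em in eL w0 wb hL.
  have H := @ok_bcast main tl n E _ Dl (fun v => sample v wa (tape v)) hD hDb (card_tok1 n) Post
    (fun v L => rp_all pv h v Dl wa L (E v) (kont v)) (solve_cost #|L| + r).
  rewrite eL /solve_cost Em in H; apply: H; rewrite -addnA.
  have hG : hit G wa L by case: hL; rewrite /width Em.
  have H2 := @ok_rp_all main tl n E Post Dl wa L s t ps hD hDb w0 wb st hps hG kont r.
  apply: H2 => opt hd hc; apply: hk => i ih.
  by split=> [x y z|q]; [exact: hd | exact: hc].
have H := @ok_bcast main tl n E _ Dl (fun v => sample v ws (tape v)) hD hDb (card_tok1 n) Post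
    (fun v L => all_sssp v Dl ws k L t (E v) (fun u => E u v) pv h (fun _ _ _ => False) (kont v))
    (solve_cost #|L| + r).
rewrite eL /solve_cost Em in H; apply: H.
apply: (@ok_all_sssp L h (fun _ _ _ _ => False)) => //; first by rewrite Em.
by move=> j hj jh; lia.
Qed.

End Run.
End Correct.

(** * The complete node program and the sampling of landmarks *)

Lemma n_gt1 n (s t : 'I_n) : s != t -> 1 < n.
Proof.
move=> st; rewrite ltnNge; apply/negP => n1; case/eqP: st; apply: val_inj => /=.
by have := ltn_ord s; have := ltn_ord t; lia.
Qed.

Section Node.
Variables (n : nat) (E : rel 'I_n) (s t : 'I_n) (ps : seq 'I_n) (D : nat).
Hypotheses (hDm : undirected_diameter E D) (st : s != t) (hps : shortest_path E s t ps).
Let pv i := nth s (s :: ps) i.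
Let h := size ps.

Definition succ_id (v : 'I_n) : option nat :=
  if v \in belast s ps then Some (val (nth s ps (index v (s :: ps)))) else None.

Lemma succ_idP x y : (succ_id x == Some (val y)) <-> exists i, [/\ i < h, x = pv i & y = pv i.+1].
Proof.
have un := shortest_uniq hps.
have nb i : i < h -> nth s (belast s ps) i = pv i.
  by move=> ih; rewrite /pv lastI nth_rcons size_belast ih.
have mb i : i < h -> pv i \in belast s ps.
  by move=> ih; rewrite -nb // mem_nth // size_belast.
have ix i : i < h -> index (pv i) (s :: ps) = i.
  by move=> ih; rewrite index_uniq //= ltnS ltnW.
rewrite /succ_id; split.
  case: ifP => // /(nthP s)[i]; rewrite size_belast => ih; rewrite nb // => <-.
  by rewrite ix // => /eqP[/val_inj e]; exists i.
by case=> i [ih -> ->]; rewrite mb // ix.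
Qed.

Lemma pick_set1 (T : finType) (x : T) : [pick y in [set x]] = Some x.
Proof. by case: pickP => [y|/(_ x)]; rewrite in_set1 ?eqxx // => /eqP ->. Qed.

Lemma bigcup_if1 (x : 'I_n) : \bigcup_v (if v == x then [set v] else set0) = [set x].
Proof.
apply/setP => y; rewrite in_set1; apply/bigcupP/eqP => [[v _]|->].
  by case: eqP => [->|_]; rewrite ?in_set0 // in_set1 => /eqP.
by exists x => //; rewrite eqxx in_set1.
Qed.

Definition total_cost (Dl c : nat) : nat :=
  32 * D + ((8 * h + 2 * Dl.+1) + (2 * (8 + 2 * Dl.+1) + (8 * c + 2 * Dl.+1 + solve_cost ps Dl c))).

(** Deterministic statement: every tape assignment whose landmarks satisfy [hit_all] succeeds. [Dl]
    is fixed before the tapes, so the window width does not depend on the random choices. *)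
Lemma ok_node_prog main tl : D < n /\ exists Dl, [/\ D <= Dl <= 4 * D, 0 < Dl &
  forall (tape : 'I_n -> seq bool) L,
    \bigcup_v sample v (width ps Dl) (tape v) = L -> hit_all E s ps Dl L ->
    ok main tl E (rp_correct E s t ps)
      (fun v => node_prog v (E v) (fun u => E u v) (v == s) (v == t) (succ_id v) (tape v))
      (total_cost Dl #|L|)].
Proof.
have [Dn [Dl [hD /andP[D1 D2] Dl0 hk]]] := ok_find_diam main tl hDm (n_gt1 st).
split=> //; exists Dl; split=> //; first by rewrite D1 D2.
move=> tape L eL hL; rewrite /total_cost; apply: hk.
have hDb : Dl <= base n by rewrite /base; slia.
have c2 : #|{: 'I_n * 'I_n}| <= ntok n.
  apply: leq_trans (card_tok2 n); rewrite !card_prod !card_ord leq_mul2l.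
  by rewrite ltnW ?orbT // /base; slia.
pose PE : {set 'I_n * 'I_n} := [set p : 'I_n * 'I_n | succ_id p.1 == Some (val p.2)].
have ePE : \bigcup_v [set p : 'I_n * 'I_n | (p.1 == v) && (succ_id v == Some (val p.2))] = PE.
  exact: (bigcup_own (fun v (p : 'I_n * 'I_n) => succ_id v == Some (val p.2))).
have inPE x y : ((x, y) \in PE) = (succ_id x == Some (val y)) by rewrite in_set.
have cPE : #|PE| = h.
  pose f (i : 'I_h) := (pv i, pv i.+1).
  have inj : injective f.
    move=> i j [e _]; apply: val_inj; apply: (shortest_inj _ _ hps e); apply: ltnW; exact: ltn_ord.
  rewrite -[RHS]card_ord -[RHS](card_imset _ inj); apply: eq_card => -[x y].
  rewrite inPE; apply/idP/imsetP => [/succ_idP[i [ih -> ->]]|[i _ [-> ->]]].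
    by exists (Ordinal ih).
  by apply/succ_idP; exists i; split=> //; apply: ltn_ord.
have epv : (fun i => if i <= #|PE| then iter i (fun x => odflt x [pick y | (x, y) \in PE]) s else s) = pv.
  apply: functional_extensionality => i; rewrite cPE; case: ifP => [|/negbT]; last first.
    by rewrite -ltnNge => lt; rewrite /pv nth_default.
  elim: i => [//|i IH] ih; rewrite iterS IH ?(ltnW ih) //.
  case: pickP => [y|/(_ (pv i.+1))]; rewrite inPE; last first.
    by have -> : succ_id (pv i) == Some (val (pv i.+1)) by apply/succ_idP; exists i.
  case/succ_idP=> j [jh e ->]; have -> // : j = i.
  by apply/esym; apply: (shortest_inj _ _ hps e); apply: ltnW.
pose k4 v (h' : nat) (pv' : nat -> 'I_n) t' := solve v Dl h' pv' t' (E v) (fun u => E u v) (tape v)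
  (fun opt => Done (claims (v == s) pv' h' opt)).
pose k3 v (PE : {set 'I_n * 'I_n}) (S T : {set 'I_n}) :=
  if [pick s in S] is Some s then if [pick t in T] is Some t then
    k4 v #|PE| (fun i => if i <= #|PE| then iter i (fun x => odflt x [pick y | (x, y) \in PE]) s else s) t
  else Done ([::], [::]) else Done ([::], [::]).
have H1 := @ok_bcast main tl n E _ Dl
  (fun v => [set p : 'I_n * 'I_n | (p.1 == v) && (succ_id v == Some (val p.2))]) hD hDb c2
  (rp_correct E s t ps) (fun v PE => bcast n Dl (if v == s then [set v] else set0)
    (fun S => bcast n Dl (if v == t then [set v] else set0) (fun T => k3 v PE S T))).
rewrite ePE cPE in H1; refine (H1 _ _).
set C := 8 * #|L| + 2 * Dl.+1 + solve_cost ps Dl #|L|.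
apply: (@ok_leq _ _ _ _ _ _ (8 * 1 + 2 * Dl.+1 + (8 * 1 + 2 * Dl.+1 + C))).
  by move: C => C; slia.
have H2 := @ok_bcast main tl n E _ Dl (fun v => if v == s then [set v] else set0) hD hDb (card_tok1 n)
  (rp_correct E s t ps) (fun v S => bcast n Dl (if v == t then [set v] else set0) (fun T => k3 v PE S T)).
rewrite bigcup_if1 cards1 in H2; refine (H2 _ _).
have H3 := @ok_bcast main tl n E _ Dl (fun v => if v == t then [set v] else set0) hD hDb (card_tok1 n)
  (rp_correct E s t ps) (fun v T => k3 v PE [set s] T).
rewrite bigcup_if1 cards1 in H3; refine (H3 _ _).
rewrite /k3 !pick_set1 epv cPE /k4 -[C]addn0 /C -(addnA _ (solve_cost _ _ _)).
have H4 := ok_solve (main := main) (tl := tl) (Post := rp_correct E s t ps)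
  (kont := fun v opt => Done (claims (v == s) pv h opt)) (r := 0) st hps hD hDb Dl0 (n_gt1 st) eL hL.
refine (H4 _) => opt hopt.
by apply: (ok_done main tl E (o := fun v => claims (v == s) pv h (opt v))); apply: claims_correct.
Qed.

(** Windows are indexed by (r, x, y, a), where r < h stands for the graph without path edge r and r
    = h for the graph without the whole path. These n^4 windows and a factor n for failure
    probability 1/n account for the 5 in [ndraws]. *)
Lemma sample_whp Dl : 0 < Dl ->
  #|{: {ffun 'I_n -> (nbits n).-tuple bool}}| * (n - 1) <=
  #|[set tp : {ffun 'I_n -> (nbits n).-tuple bool} |
      asb (hit_all E s ps Dl (\bigcup_v sample v (width ps Dl) (val (tp v))))]| * n.
Proof.
move=> Dl0; set w := width _ _; set m := ndraws n w.
have w0 : 0 < w by apply: (width_gt0 hps Dl0 (n_gt1 st)).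
have wn : w <= n by apply: (width_le hps Dl0 (n_gt1 st)).
have [mn|nm] := leqP m n; last first.
  rewrite leq_mul ?leq_subr //; apply: subset_leq_card; apply/subsetP => tp _; rewrite in_set.
  have -> : \bigcup_v sample v w (val (tp v)) = setT.
    apply/setP => x; rewrite in_setT; apply/bigcupP; exists x => //.
    by rewrite in_set -/m leqNgt nm eqxx.
  apply/asbP; split=> [|i _] x y a wW; have /card_gt0P[z hz] := leq_trans w0 wW.
    by apply/existsP; exists z; rewrite hz in_setT.
  by apply/existsP; exists z; rewrite hz in_setT.
pose rels (r : 'I_n) := if r < h then remove_edge E (pv r) (pv r.+1)
  else fun x y => E x y && ~~ path_edge pv h x y.
pose W (j : 'I_n * 'I_n * 'I_n * 'I_n) := window (rels j.1.1.1) w j.1.1.2 j.1.2 j.2.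
have [nB nB2] := trunc_log2P n; rewrite -/(nbits n) in nB nB2.
have hJ : #|{: 'I_n * 'I_n * 'I_n * 'I_n}| * n <= 2 ^ (5 * nbits n).
  rewrite !card_prod !card_ord (_ : n * n * n * n * n = n ^ 5); last by rewrite !expnS expn0 muln1 !mulnA.
  rewrite (mulnC 5) expnM.
  by rewrite leq_exp2r // ltnW.
have em : m %/ (5 * nbits n) = (2 ^ nbits n %/ w).+1 by rewrite /m /ndraws mulKn.
have hm : 2 ^ nbits n <= m %/ (5 * nbits n) * w by rewrite em ltnW // ltn_ceil.
have n0 : 0 < n := ltnW (n_gt1 st).
have := hits_whp W n0 (ltnW nB) mn _ hm _ hJ; move=> /(_ _ _)H.
apply: leq_trans (H _ _) _ => //; first by apply: leq_trans wn _; apply: ltnW.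
rewrite leq_mul2r; apply/orP; right; apply: subset_leq_card; apply/subsetP => tp; rewrite !in_set.
move=> /forallP hh; apply/asbP.
have eL : \bigcup_v sample v w (val (tp v)) = draw m tp.
  apply/setP => x; rewrite in_set; apply/bigcupP/existsP => [[v _]|[v hv]].
    by rewrite in_set -/m mn => hv; exists v.
  by exists v => //; rewrite in_set -/m mn.
rewrite eL.
have hn : h < n by apply: (isd_lt (shortest_isd hps)).
split=> [|i ih] x y a wW.
  by have := hh (Ordinal hn, x, y, a); rewrite /W /rels /= ltnn => /implyP; apply.
by have := hh (Ordinal (ltn_trans ih hn), x, y, a); rewrite /W /rels /= ih => /implyP; apply.
Qed.

Lemma card_sample w (tape : 'I_n -> seq bool) : #|\bigcup_v sample v w (tape v)| <= ndraws n w.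
Proof.
set m := ndraws n w; have [mn|nm] := leqP m n; last first.
  by apply: leq_trans (max_card _) _; rewrite card_ord ltnW.
pose f (v : 'I_n) := odflt v (insub (dec (tape v))).
apply: (@leq_trans #|[set f v | v in [set v : 'I_n | v < m]]|).
  apply: subset_leq_card; apply/subsetP => x /bigcupP[v _]; rewrite in_set -/m mn => /andP[vm /eqP e].
  by apply/imsetP; exists v; rewrite ?in_set // /f e valK.
apply: leq_trans (leq_imset_card _ _) _; apply: card_ord_lt => i.
by rewrite in_set.
Qed.

End Node.

(** * Integer cost estimates *)

Lemma leq_of_sqr a b : a ^ 2 <= b ^ 2 -> a <= b.
Proof. by rewrite leq_exp2r. Qed.

(** 15 = 5 * 3: 2^B <= 2n, and the extra draw per group adds w <= n. *)
Lemma ndraws_width n w : 0 < w -> w <= n -> ndraws n w * w <= 15 * (nbits n * n).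
Proof.
move=> w0 wn; have [_ /(_ (leq_trans w0 wn)) nB] := trunc_log2P n.
rewrite /ndraws -/(nbits n) in nB *; set B := nbits n in nB *.
have : (2 ^ B %/ w).+1 * w <= 3 * n.
  by rewrite mulSn; have := leq_trunc_div (2 ^ B) w; slia.
move: (_.+1) => q hq; rewrite -mulnA; apply: leq_trans (leq_mul (leqnn (5 * B)) hq) _.
by rewrite mulnA mulnC; nia.
Qed.

(** From c w <= 15 B n the two conditions on w give c^2 <= 225 B^2 w and c h <= 15 B w; also h <= w.
    The last bracket pays for the diameter estimate and the initial broadcasts. *)
Lemma cost_all w n h Dl c B : 0 < w -> 0 < B -> 0 < Dl -> h <= n -> c * w <= 15 * (B * n) ->
  n ^ 2 <= w ^ 3 -> n * h <= w ^ 2 ->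
  2 * w + c + h + 2 + (8 * (c * (c + h.+1)) + 2 * Dl.+1) + (2 * B).+1 * (8 * h + 2 * Dl.+1) +
  (32 * Dl + 8 * h + 8 * Dl.+1 + 16 + 8 * c) <= 100 * 100 * (B ^ 2 * (w + Dl)).
Proof.
move=> w0 B0 Dl0 hn hc h3 h2.
have c2 : c ^ 2 <= 225 * (B ^ 2 * w).
  rewrite -(@leq_pmul2r (w ^ 2)) ?expn_gt0 ?w0 //.
  have s1 : (c * w) * (c * w) <= (15 * (B * n)) * (15 * (B * n)) by apply: leq_mul.
  have s2 : (B * B) * n ^ 2 <= (B * B) * w ^ 3 by rewrite leq_mul2l h3 orbT.
  by move: s1 s2; rewrite !expnS !expn0 !muln1; clear; lia.
have ch : c * h <= 15 * (B * w).
  rewrite -(@leq_pmul2r w) //.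
  have s1 : (c * w) * h <= 15 * (B * n) * h by rewrite leq_mul2r hc orbT.
  have s2 : B * (n * h) <= B * w ^ 2 by rewrite leq_mul2l h2 orbT.
  by move: s1 s2; rewrite !expnS !expn0 !muln1; clear; lia.
have hw : h <= w.
  by apply: leq_of_sqr; apply: leq_trans h2; rewrite -mulnn leq_mul2r hn orbT.
have cc : c <= c ^ 2 by rewrite -mulnn; case: (c) => // c'; rewrite leq_pmulr.
have BB : B <= B ^ 2 by rewrite -mulnn leq_pmulr.
set Y := B ^ 2 * (w + Dl).
have y1 : B ^ 2 * w <= Y by rewrite leq_mul2l leq_addr orbT.
have y2 : B * (w + Dl) <= Y by rewrite leq_mul2r BB orbT.
have y3 : w + Dl <= B * (w + Dl) by rewrite leq_pmull.
have y4 : B * w <= B * (w + Dl) by rewrite leq_mul2l leq_addr orbT.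
have e1 : c * (c + h.+1) = c ^ 2 + c * h + c by rewrite -mulnn; slia.
have e2 : (2 * B).+1 * (8 * h + 2 * Dl.+1) <= 30 * (B * (w + Dl)).
  apply: (@leq_trans (3 * B * (10 * (w + Dl)))); last by slia.
  by apply: leq_mul; slia.
rewrite e1; move: e2; set a6 := (2 * B).+1 * _ => e2.
move: (B ^ 2 * w) (B * (w + Dl)) (B * w) (c ^ 2) (c * h) a6 Y y1 y2 y3 y4 c2 ch cc e2 => a1 a2 a3 a4 a5 a6 a7.
by slia.
Qed.

(** n k <= 4 w^2 turns c w <= 15 B n into c k <= 60 B w, and Dl <= k^2 bounds the communicating
    windows by (c / (k+1)) Dl <= c k as well. *)
Lemma cost_single w n h k Dl c B : 0 < w -> 0 < B -> 0 < Dl -> 0 < h -> Dl <= 4 * n ->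
  c * w <= 15 * (B * n) -> n ^ 2 * minn Dl n <= w ^ 4 -> Dl <= k ^ 2 -> k ^ 2 <= 4 * Dl ->
  h * (4 * w + 18 * c + 6 + 8 * k.+1 * c + 6 * Dl.+1 + (c %/ k.+1) * (8 * Dl.+1)) +
  (32 * Dl + 8 * h + 8 * Dl.+1 + 16 + 8 * c) <= 100 * 100 * (B ^ 2 * (h * (w + Dl))).
Proof.
move=> w0 B0 Dl0 h0 Dn hc h4 hk1 hk2.
have k0 : 0 < k by rewrite lt0n; apply/negP => /eqP e; move: hk1; rewrite e; slia.
have nk : n * k <= 4 * w ^ 2.
  apply: leq_of_sqr.
  (* Dl <= 4 n gives Dl <= 4 * minn Dl n, which makes up for the cap in [width_single]. *)
  have s1 : n ^ 2 * k ^ 2 <= n ^ 2 * (16 * minn Dl n).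
    by rewrite leq_mul2l; apply/orP; right; apply: leq_trans hk2 _; rewrite /minn; case: ifP; slia.
  by move: s1 h4; rewrite !expnS !expn0 !muln1; move: (minn _ _) => x; clear; lia.
have ck : c * k <= 60 * (B * w).
  rewrite -(@leq_pmul2r w) //.
  have s1 : (c * w) * k <= 15 * (B * n) * k by rewrite leq_mul2r hc orbT.
  have s2 : B * (n * k) <= B * (4 * w ^ 2) by rewrite leq_mul2l nk orbT.
  by move: s1 s2; rewrite !expnS !expn0 !muln1; clear; lia.
have c1 : c <= c * k by rewrite leq_pmulr.
have cd : (c %/ k.+1) * Dl <= c * k.
  apply: (@leq_trans ((c %/ k.+1) * (k.+1 * k))); last by rewrite mulnA leq_mul2r leq_trunc_div orbT.
  by rewrite leq_mul2l (leq_trans hk1) ?orbT // -mulnn leq_mul2r leqnSn orbT.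
have c3 : c %/ k.+1 <= c by apply: leq_div.
set Y := B * (w + Dl).
have y1 : B * w <= Y by rewrite leq_mul2l leq_addr orbT.
have y2 : w + Dl <= Y by rewrite leq_pmull.
have inner : 4 * w + 18 * c + 6 + 8 * k.+1 * c + 6 * Dl.+1 + (c %/ k.+1) * (8 * Dl.+1) <= 50 * 100 * Y.
  have -> : 8 * k.+1 * c = 8 * (c * k) + 8 * c by clear; lia.
  have -> : (c %/ k.+1) * (8 * Dl.+1) = 8 * (c %/ k.+1 * Dl) + 8 * (c %/ k.+1) by move: (c %/ k.+1) => x; clear; lia.
  move: (c %/ k.+1 * Dl) (c %/ k.+1) (c * k) (B * w) Y y1 y2 cd c3 c1 ck => a1 a2 a3 a4 a5.
  slia.
have pre : 32 * Dl + 8 * h + 8 * Dl.+1 + 16 + 8 * c <= 50 * 100 * (h * Y).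
  have : Y <= h * Y by rewrite leq_pmull.
  have : h <= h * Y by rewrite leq_pmulr //; apply: leq_trans y2; slia.
  move: (h * Y) (B * w) (c * k) y1 y2 ck c1 => a1 a2 a3; slia.
have : h * (4 * w + 18 * c + 6 + 8 * k.+1 * c + 6 * Dl.+1 + (c %/ k.+1) * (8 * Dl.+1)) <= 50 * 100 * (h * Y).
  by rewrite (mulnCA (50 * 100)) leq_mul2l inner orbT.
have : h * Y <= B ^ 2 * (h * (w + Dl)).
  by rewrite /Y mulnCA leq_mul2r -mulnn leq_pmulr // orbT.
set a2 := B ^ 2 * _; move: (h * Y) a2 pre => a1 a2; slia.
Qed.

Lemma total_cost_le n (s t : 'I_n) (E : rel 'I_n) ps D Dl c :
  s != t -> shortest_path E s t ps -> D < n -> D <= Dl <= 4 * D -> 0 < Dl -> 1 < n ->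
  c <= ndraws n (width ps Dl) ->
  total_cost ps D Dl c <= 100 * 100 * (nbits n ^ 2 *
    minn (width_all n (size ps) + Dl) (size ps * (width_single n Dl + Dl))).
Proof.
move=> st hps Dn /andP[D1 D2] Dl0 n1 hc.
have hn : size ps <= n by apply: ltnW; apply: (isd_lt (shortest_isd hps)).
have h0 : 0 < size ps by apply: (h_gt0 st hps).
have B0 : 0 < nbits n by [].
rewrite /total_cost /solve_cost; rewrite /width in hc; case Em: all_mode in hc *.
all: rewrite /all_mode in Em.
  have [w3 w2 wn w0 _] := width_allP n1 hn.
  have hc' : c * width_all n (size ps) <= 15 * (nbits n * n).
    by apply: leq_trans (ndraws_width w0 wn); rewrite leq_mul2r hc orbT.
  have := cost_all w0 B0 Dl0 hn hc' w3 w2.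
  rewrite (minn_idPl Em); move: (nbits n ^ 2 * _) (_.+1 * _) (c * _) => a1 a2 a3.
  by move: D1; clear; lia.
have [w4 wn w0 _] := width_singleP n1 Dl0; have [k1 k2] := degree_boundP Dl0.
have hc' : c * width_single n Dl <= 15 * (nbits n * n).
  by apply: leq_trans (ndraws_width w0 wn); rewrite leq_mul2r hc orbT.
have Dn4 : Dl <= 4 * n by apply: leq_trans D2 _; rewrite leq_mul2l ltnW.
have := cost_single w0 B0 Dl0 h0 Dn4 hc' w4 k1 k2.
rewrite /sssp_cost; have /minn_idPr -> : size ps * (width_single n Dl + Dl) <= width_all n (size ps) + Dl.
  by apply: ltnW; rewrite ltnNge Em.
move: (nbits n ^ 2 * _) (size ps * _) => a1 a2.
by move: D1; clear; lia.
Qed.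

(** * Comparison with the real-valued round bound *)

Section RealBounds.
Local Open Scope R_scope.

Lemma INR_addn a b : INR (a + b)%N = INR a + INR b.
Proof. by rewrite -plusE plus_INR. Qed.

Lemma INR_muln a b : INR (a * b)%N = INR a * INR b.
Proof. by rewrite -multE mult_INR. Qed.

Lemma INR_expn a k : INR (a ^ k)%N = INR a ^ k.
Proof. by elim: k => [//|k IH]; rewrite expnS INR_muln IH. Qed.

Lemma INR_leq a b : (a <= b)%N -> INR a <= INR b.
Proof. by move/leP; apply: le_INR. Qed.

Lemma INR_ltn a b : (a < b)%N -> INR a < INR b.
Proof. by move/ltP; apply: lt_INR. Qed.

(** log2 n = ln n / ln 2, and ln 2 > 1/2. *)
Lemma nbits_ln n : (1 < n)%N -> INR (nbits n) <= 2 * (1 + ln (INR n)).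
Proof.
move=> n1; have n0 : (0 < n)%N by apply: ltnW.
have le : INR 2 ^ trunc_log 2 n <= INR n.
  by rewrite -INR_expn; apply: INR_leq; apply: trunc_logP.
have l2 := ln_lt_2.
have p2 : 0 < INR 2 by rewrite /=; lra.
have : INR (trunc_log 2 n) * ln 2 <= ln (INR n).
  rewrite -ln_pow; last by lra.
  have := pow_lt _ (trunc_log 2 n) p2 => h.
  case: le => [lt|<-]; last by right.
  by left; apply: ln_increasing.
have := pos_INR (trunc_log 2 n); rewrite /nbits S_INR => h1 h2.
nra.
Qed.

Lemma pow_lt_inv x y k : 0 <= y -> x ^ k < y ^ k -> x <= y.
Proof.
move=> y0 lt; case: (Rle_lt_dec x y) => // yx; exfalso.
have := pow_incr y x k; move=> /(_ _)H; have : y ^ k <= x ^ k by apply: H; lra.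
lra.
Qed.

(** By minimality the width minus one violates one of the two conditions, so it is at most the
    corresponding root. *)
Lemma width_all_real n h : (1 < n)%N -> (h <= n)%N ->
  INR (width_all n h) <= 1 + (Rpower (INR n) (2 / 3) + sqrt (INR n * INR h)).
Proof.
move=> n1 hn; have [_ _ _ w0 mn] := width_allP n1 hn.
have n0 : 0 < INR n by apply: (INR_ltn (a := 0)); apply: ltnW.
have rp : 0 < Rpower (INR n) (2 / 3) by apply: exp_pos.
have sp := sqrt_pos (INR n * INR h).
move: mn w0; case: (width_all n h) => // x mn _; rewrite S_INR.
suff : INR x <= Rpower (INR n) (2 / 3) \/ INR x <= sqrt (INR n * INR h) by case; lra.
case: (mn x (ltnSn x)) => /INR_ltn.
  rewrite !INR_expn => lt; left; apply: (@pow_lt_inv _ _ 3); first by lra.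
  rewrite -(Rpower_pow 3 _ rp) Rpower_mult.
  have -> : 2 / 3 * INR 3 = INR 2 by rewrite /=; field.
  by rewrite Rpower_pow.
rewrite INR_muln INR_expn => lt; right; apply: (@pow_lt_inv _ _ 2); first exact: sqrt_pos.
by rewrite pow2_sqrt //; apply: Rmult_le_pos; apply: pos_INR.
Qed.

Lemma width_single_real n Dl : (1 < n)%N -> (0 < Dl)%N ->
  INR (width_single n Dl) <= 1 + sqrt (INR n) * sqrt (sqrt (INR Dl)).
Proof.
move=> n1 Dl0; have [_ _ w0 mn] := width_singleP n1 Dl0.
move: mn w0; case: (width_single n Dl) => // x mn _; rewrite S_INR.
suff : INR x <= sqrt (INR n) * sqrt (sqrt (INR Dl)) by lra.
have := mn x (ltnSn x) => /INR_ltn; rewrite INR_muln !INR_expn => lt.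
apply: (@pow_lt_inv _ _ 4); first by apply: Rmult_le_pos; apply: sqrt_pos.
have p1 := pow2_sqrt _ (pos_INR n); have p2 := pow2_sqrt _ (sqrt_pos (INR Dl)).
have p3 := pow2_sqrt _ (pos_INR Dl).
suff -> : (sqrt (INR n) * sqrt (sqrt (INR Dl))) ^ 4 = INR n ^ 2 * INR Dl by [].
rewrite -{2}p1 -{2}p3 -{2}p2; ring.
Qed.

(** 20 = 4 * 5: the square of [nbits n] is at most 4 (1 + ln n)^2, and rounding the width up
    together with Dl <= 4 D costs a factor 5, as D >= 1. *)
Lemma bound_real n h D Dl : (1 < n)%N -> (h <= n)%N -> (D <= Dl <= 4 * D)%N -> (0 < Dl)%N ->
  INR (100 * 100 * (nbits n ^ 2 * minn (width_all n h + Dl) (h * (width_single n Dl + Dl))))%N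
  <= round_bound (100 * 100 * 20)%N 2 n h D.
Proof.
move=> n1 hn /andP[D1 D2] Dl0.
have D0 : (0 < D)%N by lia.
have rD : 1 <= INR D by apply: (INR_leq (a := 1)).
have rDl : INR Dl <= 4 * INR D.
  have := INR_leq D2; rewrite INR_muln; suff -> : INR 4 = 4 by []. by rewrite /=; ring.
have rh := pos_INR h.
rewrite /round_bound; set TA := (_ + _ + INR D); set TB := (_ + INR D) * INR h.
set a := (width_all n h + Dl)%N; set b := (h * _)%N.
have ha : INR a <= 5 * TA.
  have := width_all_real n1 hn; rewrite /a INR_addn /TA => hw.
  have rp : 0 < Rpower (INR n) (2 / 3) by apply: exp_pos.
  have sp := sqrt_pos (INR n * INR h); lra.
have hb : INR b <= 5 * TB.
  have := width_single_real n1 Dl0; rewrite /b INR_muln INR_addn /TB => hw.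
  have s4 : sqrt (sqrt (INR Dl)) <= 2 * sqrt (sqrt (INR D)).
    have e : 2 = sqrt (sqrt 16).
      have -> : 16 = (2 * 2) * (2 * 2) by ring.
      rewrite sqrt_square; last by lra.
      by rewrite sqrt_square; lra.
    have s0 := sqrt_pos 16; rewrite {1}e -!sqrt_mult; try lra; try exact: sqrt_pos; try exact: pos_INR.
    by apply: sqrt_le_1_alt; apply: sqrt_le_1_alt; lra.
  have sn := sqrt_pos (INR n); have sD := sqrt_pos (sqrt (INR D)).
  have hy : sqrt (INR n) * sqrt (sqrt (INR Dl)) <= 2 * (sqrt (INR n) * sqrt (sqrt (INR D))).
    have -> : 2 * (sqrt (INR n) * sqrt (sqrt (INR D))) = sqrt (INR n) * (2 * sqrt (sqrt (INR D))) by ring.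
    exact: Rmult_le_compat_l.
  have y0 : 0 <= sqrt (INR n) * sqrt (sqrt (INR D)) by apply: Rmult_le_pos.
  have : INR (width_single n Dl) + INR Dl <= 5 * (sqrt (INR n) * sqrt (sqrt (INR D)) + INR D) by lra.
  by move=> h5; rewrite Rmult_comm -Rmult_assoc; apply: Rmult_le_compat_r.
have hmin : INR (minn a b) <= 5 * Rmin TA TB.
  have h1 : INR (minn a b) <= INR a by apply: INR_leq; apply: geq_minl.
  have h2 : INR (minn a b) <= INR b by apply: INR_leq; apply: geq_minr.
  suff : INR (minn a b) / 5 <= Rmin TA TB by lra.
  by apply: Rmin_glb; lra.
have hB := nbits_ln n1; have B0 := pos_INR (nbits n).
have m0 := pos_INR (minn a b).
set l := 1 + ln (INR n) in hB *.
rewrite (INR_muln (100 * 100) 20) (INR_muln (100 * 100)) (INR_muln 100 100) (INR_muln (nbits n ^ 2)) INR_expn.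
have -> : INR 100 = 100 by rewrite INR_IZR_INZ.
have -> : INR 20 = 20 by rewrite INR_IZR_INZ.
have hB2 : INR (nbits n) ^ 2 <= 4 * l ^ 2 by nra.
have hB0 : 0 <= INR (nbits n) ^ 2 by nra.
have : INR (nbits n) ^ 2 * INR (minn a b) <= (4 * l ^ 2) * (5 * Rmin TA TB).
  by apply: Rmult_le_compat.
move: (INR (nbits n) ^ 2 * _) (l ^ 2) (Rmin TA TB) => x y z; nra.
Qed.

End RealBounds.

Lemma main_progE n (E : rel 'I_n) s t ps v tape :
  main_prog (local_input E s t ps v) tape =
  node_prog v (E v) (fun u => E u v) (v == s) (v == t) (succ_id s ps v) tape.
Proof.
rewrite /main_prog [in_id _]/= valK /=.
have memE (P : pred 'I_n) : (fun u : 'I_n => val u \in [seq val u | u <- enum 'I_n & P u]) = P.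
  apply: functional_extensionality => u; rewrite mem_map; last exact: val_inj.
  by rewrite mem_filter mem_enum andbT.
by rewrite (memE (E v)) (memE (fun u => E u v)).
Qed.

Theorem theorem3 :
  exists (A : Algo) (c k : nat),
  forall (n : nat) (E : rel 'I_n) (s t : 'I_n) (ps : seq 'I_n) (D : nat),
    irreflexive E ->
    undirected_diameter E D ->
    s != t ->
    shortest_path E s t ps ->
    whp_succeeds A E s t ps (round_bound c k n (size ps) D).
Proof.
exists rp_algo, (100 * 100 * 20), 2 => n E s t ps D _ hD st hps.
have n1 := n_gt1 st.
have [Dn [Dl [hDl Dl0 hrun]]] := ok_node_prog hD st hps main_prog nbits.
rewrite /whp_succeeds; apply: leq_trans (sample_whp st hps Dl0) _.
rewrite leq_mul2r; apply/orP; right; apply: subset_leq_card; apply/subsetP => tp.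
rewrite !in_set => /asbP hit_tp; apply/asbP.
have [r [out [rle hout hcor]]] := hrun (fun v => val (tp v)) _ (erefl _) hit_tp.
exists r; split; last first.
  exists out; split=> // v; rewrite -(hout v) run_iter.
  congr (a_out _ (iter r _ _ v)); apply: functional_extensionality => u.
  by rewrite -main_progE.
have hn : size ps <= n by apply: ltnW; apply: (isd_lt (shortest_isd hps)).
apply: Rle_trans (bound_real n1 hn hDl Dl0); apply: INR_leq; apply: leq_trans rle _.
by apply: (total_cost_le st hps Dn hDl Dl0 n1); apply: card_sample.
Qed.
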